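(* Let $\Gamma$ denote the bicomplex gamma function and $\zeta$ the bicomplex Riemann zeta function. The following statements are satisfied. (i) $\Gamma(1+\omega)=\omega\,\Gamma(\omega)$ for $\omega\in\Omega_-$; (ii) $\Gamma(1-\omega)\,\Gamma(\omega)=\dfrac{\pi}{\sin \pi\omega}$ for $\omega\in\Omega$; (iii) $\zeta(\omega)=2\,(2\pi)^{\omega-1}\sin\!\left(\frac{\pi}{2}\omega\right)\Gamma(1-\omega)\,\zeta(1-\omega)$ for $\omega\in 1+\mathbb{B}_\ast$.
   Context: $\mathbb{B}=\{a+b\mathbf{i}+c\mathbf{j}+d\mathbf{k}: a,b,c,d\in\mathbb{R}\}$ is the commutative real algebra of bicomplex numbers, with $\mathbf{i}^2=\mathbf{k}^2=-1$, $\mathbf{j}^2=1$, $\mathbf{i}\mathbf{k}=\mathbf{k}\mathbf{i}=\mathbf{j}$. Put $\mathbf{e}_1=\frac{1+\mathbf{j}}{2}$, $\mathbf{e}_2=\frac{1-\mathbf{j}}{2}$ (idempotents with $\mathbf{e}_1+\mathbf{e}_2=1$, $\mathbf{e}_1\mathbf{e}_2=0$). Identify $\mathbb{C}$ with $\{x+\mathbf{i}y: x,y\in\mathbb{R}\}\subset\mathbb{B}$. Every $\omega\in\mathbb{B}$ is written uniquely as $\omega=\mathcal{P}_1(\omega)\mathbf{e}_1+\mathcal{P}_2(\omega)\mathbf{e}_2$ with $\mathcal{P}_1(\omega),\mathcal{P}_2(\omega)\in\mathbb{C}$, and $\omega\mapsto(\mathcal{P}_1(\omega),\mathcal{P}_2(\omega))$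 is an algebra isomorphism $\mathbb{B}\to\mathbb{C}\times\mathbb{C}$. $\mathbb{B}_\ast$ is the group of units of $\mathbb{B}$: $\omega\in\mathbb{B}_\ast$ iff $\mathcal{P}_1(\omega)\neq0$ and $\mathcal{P}_2(\omega)\neq0$. $\mathbb{Z}^-$ is the set of nonpositive integers (including $0$). $\Omega_-=\{\omega\in\mathbb{B}:\mathcal{P}_1(\omega)\notin\mathbb{Z}^-\text{ and }\mathcal{P}_2(\omega)\notin\mathbb{Z}^-\}$ and $\Omega=\{\omega\in\mathbb{B}:\mathcal{P}_1(\omega)\notin\mathbb{Z}\text{ and }\mathcal{P}_2(\omega)\notin\mathbb{Z}\}$. The bicomplex exponential and sine are given by the usual power series; equivalently $e^\omega=e^{\mathcal{P}_1(\omega)}\mathbf{e}_1+e^{\mathcal{P}_2(\omega)}\mathbf{e}_2$ and $\sin\omega=\sin(\mathcal{P}_1(\omega))\mathbf{e}_1+\sin(\mathcal{P}_2(\omega))\mathbf{e}_2$. For real $t>0$, $t^\omega=e^{\omega\ln t}$. The bicomplex gamma function is $\Gamma(\omega)=\int_0^\infty e^{-t}t^{\omega-1}\,dt$ when $\mathrm{Re}\,\mathcal{P}_1(\omega)>0$ and $\mathrm{Re}\,\mathcal{P}_2(\omega)>0$, and is extended by analytic continuation to $\Omega_-$ by $\Gamma(\omega)=\Gamma(\mathcal{P}_1(\omega))\mathbf{e}_1+\Gamma(\mathcal{P}_2(\omega))\mathbf{e}_2$, with the classical complex gamma function on the right. The bicomplex zeta function is $\zeta(\omega)=\sum_{n\ge1}n^{-\omega}$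 when $\mathrm{Re}\,\mathcal{P}_1(\omega)>1$ and $\mathrm{Re}\,\mathcal{P}_2(\omega)>1$, and is extended by analytic continuation to $1+\mathbb{B}_\ast$ by $\zeta(\omega)=\zeta(\mathcal{P}_1(\omega))\mathbf{e}_1+\zeta(\mathcal{P}_2(\omega))\mathbf{e}_2$, with the classical Riemann zeta function on the right.
   Formalization: In (iii), Γ(1−ω) or ζ(1−ω) is undefined when some P_l(ω) is 0 or an integer ≥ 2; the equality is stated where all factors are defined, and at every ω in 1+B_* the right-hand side is shown to tend to ζ(ω) along those points. *)

(* Defs.v *)
From HB Require Import structures.
From mathcomp Require Import all_boot all_order all_algebra.
From mathcomp Require Import complex ring.
From mathcomp Require Import all_classical all_reals all_analysis.

Set Implicit Arguments.
Unset Strict Implicit.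
Unset Printing Implicit Defensive.

Import Order.TTheory GRing.Theory Num.Theory.
Import numFieldNormedType.Exports.

Local Open Scope classical_set_scope.
Local Open Scope ring_scope.

(* R[i] with the topology of its modulus. The alias is needed because the
   topological structures of a numFieldType are not found from the head symbol
   [complex]. *)
Definition cplx (R : realType) : numClosedFieldType := R[i].

Section ClassicalFunctions.
Variable R : realType.
Local Notation C := (cplx R).
Implicit Types (z s : C) (f : C -> C) (D : set C).

Definition ofReal (x : R) : C := Complex x 0.
Definition cRe z : R := complex.Re z.
Definition cIm z : R := complex.Im z.

Definition cexp z : C := limn (series (fun n : nat => z ^+ n / n`!%:R)).

Definition csin z : C :=
  limn (series (fun n : nat => (-1) ^+ n * z ^+ n.*2.+1 / (n.*2.+1)`!%:R)).

(* t ^ z for a real t > 0. *)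
Definition cpow (t : R) z : C := cexp (z * ofReal (ln t)).

Definition analytic_at f z0 : Prop :=
  exists a : nat -> C,
    \forall z \near z0, series (fun n => a n * (z - z0) ^+ n) @ \oo --> f z.

Definition analytic_on D f : Prop := forall z, D z -> analytic_at f z.

(* The analytic function on D that agrees with f0 on D0. In both uses below D
   is a connected open set and D0 a nonempty open subset of it, so that there is
   at most one such function on D; its values outside D are unspecified. *)
Definition analytic_continuation D0 f0 D : C -> C :=
  xget f0 [set f | analytic_on D f /\ forall z, D0 z -> f z = f0 z].

Definition integers : set C := [set z | exists m : int, z = m%:~R].
Definition nonpos_integers : set C := [set z | exists n : nat, z = - n%:R].

Definition cgamma_integrand z (t : R) : C := ofReal (expR (- t)) * cpow t (z - 1).

Definition cgamma_integral z : C :=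
  Complex
    (\int[lebesgue_measure]_(t in `]0, +oo[) cRe (cgamma_integrand z t))%R
    (\int[lebesgue_measure]_(t in `]0, +oo[) cIm (cgamma_integrand z t))%R.

Definition cgamma : C -> C :=
  analytic_continuation [set z | 0 < cRe z] cgamma_integral (~` nonpos_integers).

Definition czeta_series s : C := limn (series (fun n : nat => cpow n.+1%:R (- s))).

Definition czeta : C -> C :=
  analytic_continuation [set s | 1 < cRe s] czeta_series (~` [set 1]).

End ClassicalFunctions.

(* Bicomplex a b c d is a + b i + c j + d k. *)
Record bicomplex (R : realType) : Type := Bicomplex
  { bre : R; bim_i : R; bim_j : R; bim_k : R }.

Section BicomplexAlgebra.
Variable R : realType.
Local Notation C := (cplx R).
Local Notation B := (bicomplex R).
Implicit Types w : B.

Definition tuple_of_bicomplex w : R * R * R * R :=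
  (bre w, bim_i w, bim_j w, bim_k w).
Definition bicomplex_of_tuple (x : R * R * R * R) : B :=
  Bicomplex x.1.1.1 x.1.1.2 x.1.2 x.2.
Lemma tuple_of_bicomplexK : cancel tuple_of_bicomplex bicomplex_of_tuple.
Proof. by case. Qed.

HB.instance Definition _ := Choice.copy B (can_type tuple_of_bicomplexK).

Lemma bicomplexP w w' :
  [/\ bre w = bre w', bim_i w = bim_i w', bim_j w = bim_j w'
    & bim_k w = bim_k w'] -> w = w'.
Proof. by case: w => a b c d; case: w' => a' b' c' d' /= [-> -> -> ->]. Qed.

Definition badd w w' : B :=
  Bicomplex (bre w + bre w') (bim_i w + bim_i w')
            (bim_j w + bim_j w') (bim_k w + bim_k w').
Definition bopp w : B :=
  Bicomplex (- bre w) (- bim_i w) (- bim_j w) (- bim_k w).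

Let baddA : associative badd.
Proof. by move=> *; apply: bicomplexP; split; rewrite /= addrA. Qed.
Let baddC : commutative badd.
Proof. by move=> *; apply: bicomplexP; split; rewrite /= addrC. Qed.
Let badd0 : left_id (Bicomplex 0 0 0 0) badd.
Proof. by move=> *; apply: bicomplexP; split; rewrite /= add0r. Qed.
Let baddN : left_inverse (Bicomplex 0 0 0 0) bopp badd.
Proof. by move=> *; apply: bicomplexP; split; rewrite /= addNr. Qed.

HB.instance Definition _ := GRing.isZmodule.Build B baddA baddC badd0 baddN.

(* i^2 = k^2 = -1, j^2 = 1 and ik = j, whence ij = i(ik) = -k and
   jk = (ik)k = -i. *)
Definition bmul w w' : B :=
  let: Bicomplex a b c d := w in let: Bicomplex a' b' c' d' := w' in
  Bicomplex (a * a' - b * b' + c * c' - d * d')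
            (a * b' + b * a' - c * d' - d * c')
            (a * c' + c * a' + b * d' + d * b')
            (a * d' + d * a' - b * c' - c * b').

Let bmulA : associative bmul.
Proof.
by move=> [a b c d] [? ? ? ?] [? ? ? ?]; apply: bicomplexP; split=> /=; ring.
Qed.
Let bmulC : commutative bmul.
Proof. by move=> [a b c d] [? ? ? ?]; apply: bicomplexP; split=> /=; ring. Qed.
Let bmul1 : left_id (Bicomplex 1 0 0 0) bmul.
Proof. by move=> [a b c d]; apply: bicomplexP; split=> /=; ring. Qed.
Let bmulDl : left_distributive bmul badd.
Proof.
by move=> [a b c d] [? ? ? ?] [? ? ? ?]; apply: bicomplexP; split=> /=; ring.
Qed.
Let bone_neq0 : Bicomplex 1 0 0 0 != 0 :> B.
Proof. by apply/eqP => -[] /eqP; rewrite oner_eq0. Qed.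

HB.instance Definition _ :=
  GRing.Zmodule_isComNzRing.Build B bmulA bmulC bmul1 bmulDl bone_neq0.

Definition bscale (x : R) w : B :=
  Bicomplex (x * bre w) (x * bim_i w) (x * bim_j w) (x * bim_k w).

Let bscaleA x y w : bscale x (bscale y w) = bscale (x * y) w.
Proof. by apply: bicomplexP; split; rewrite /= mulrA. Qed.
Let bscale1 : left_id 1 bscale.
Proof. by move=> w; apply: bicomplexP; split; rewrite /= mul1r. Qed.
Let bscaleDr : right_distributive bscale +%R.
Proof. by move=> x w w'; apply: bicomplexP; split; rewrite /= mulrDr. Qed.
Let bscaleDl w : {morph bscale^~ w : x y / x + y}.
Proof. by move=> x y; apply: bicomplexP; split; rewrite /= mulrDl. Qed.

HB.instance Definition _ :=
  GRing.Zmodule_isLmodule.Build R B bscaleA bscale1 bscaleDr bscaleDl.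

Let bscaleAl (x : R) w w' : x *: (w * w') = (x *: w) * w'.
Proof.
by case: w w' => [a b c d] [? ? ? ?]; apply: bicomplexP; split=> /=; ring.
Qed.

HB.instance Definition _ := GRing.Lmodule_isLalgebra.Build R B bscaleAl.

Let bscaleAr (x : R) w w' : x *: (w * w') = w * (x *: w').
Proof. by rewrite mulrC bscaleAl mulrC. Qed.

HB.instance Definition _ := GRing.Lalgebra_isAlgebra.Build R B bscaleAr.

Definition be1 : B := Bicomplex 2^-1 0 2^-1 0.
Definition be2 : B := Bicomplex 2^-1 0 (- 2^-1) 0.

Definition ofC (z : C) : B := Bicomplex (cRe z) (cIm z) 0 0.

(* Since j e1 = e1, j e2 = - e2 and k = - i j, one has k e1 = - i e1 and
   k e2 = i e2. *)
Definition P1 w : C := Complex (bre w + bim_j w) (bim_i w - bim_k w).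
Definition P2 w : C := Complex (bre w - bim_j w) (bim_i w + bim_k w).

Definition bicomb (z1 z2 : C) : B := ofC z1 * be1 + ofC z2 * be2.

Lemma bicombE (z1 z2 : C) :
  bicomb z1 z2 = Bicomplex (2^-1 * (cRe z1 + cRe z2)) (2^-1 * (cIm z1 + cIm z2))
                  (2^-1 * (cRe z1 - cRe z2)) (2^-1 * (cIm z2 - cIm z1)).
Proof. by apply: bicomplexP; split=> /=; ring. Qed.

Lemma bicomb_proj w : bicomb (P1 w) (P2 w) = w.
Proof. by rewrite bicombE; apply: bicomplexP; split=> /=; field. Qed.

Lemma bicombK (z1 z2 : C) : P1 (bicomb z1 z2) = z1 /\ P2 (bicomb z1 z2) = z2.
Proof.
by rewrite bicombE; case: z1 z2 => [x1 y1] [x2 y2]; split;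
  congr Complex => /=; field.
Qed.

Lemma P1M w w' : P1 (w * w') = P1 w * P1 w'.
Proof. by case: w w' => [a b c d] [? ? ? ?]; congr Complex => /=; ring. Qed.

Lemma P2M w w' : P2 (w * w') = P2 w * P2 w'.
Proof. by case: w w' => [a b c d] [? ? ? ?]; congr Complex => /=; ring. Qed.

Lemma bicomb11 : bicomb 1 1 = 1.
Proof. by rewrite bicombE; apply: bicomplexP; split=> /=; field. Qed.

Lemma P1_1 : P1 1 = 1. Proof. by rewrite -bicomb11 (bicombK _ _).1. Qed.
Lemma P2_1 : P2 1 = 1. Proof. by rewrite -bicomb11 (bicombK _ _).2. Qed.

Definition bunit : pred B := fun w => (P1 w != 0) && (P2 w != 0).
Definition binv w : B := if bunit w then bicomb (P1 w)^-1 (P2 w)^-1 else w.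

Let bmulV : {in bunit, left_inverse 1 binv *%R}.
Proof.
move=> w uw; have {}uw : bunit w := uw.
rewrite /binv uw; case/andP: uw => h1 h2.
rewrite -(bicomb_proj (_ * w)) P1M P2M (bicombK _ _).1 (bicombK _ _).2.
by rewrite !mulVf // bicomb11.
Qed.

Let bunitP w w' : w' * w = 1 -> bunit w.
Proof.
move=> e; apply/andP; split; apply/eqP => e0.
- by move/(congr1 P1): e; rewrite P1M e0 mulr0 P1_1 => /esym/eqP; rewrite oner_eq0.
- by move/(congr1 P2): e; rewrite P2M e0 mulr0 P2_1 => /esym/eqP; rewrite oner_eq0.
Qed.

Let binv_out : {in [predC bunit], binv =1 id}.
Proof.
by move=> w uw; have {}uw : ~~ bunit w := uw; rewrite /binv (negbTE uw).
Qed.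

HB.instance Definition _ :=
  GRing.ComNzRing_hasMulInverse.Build B bmulV bunitP binv_out.

HB.instance Definition _ :=
  Topological.copy B (initial_topology tuple_of_bicomplex).

End BicomplexAlgebra.

Section BicomplexFunctions.
Variable R : realType.
Local Notation B := (bicomplex R).
Implicit Types w : B.

Definition Omega_minus : set B :=
  [set w | ~ nonpos_integers (P1 w) /\ ~ nonpos_integers (P2 w)].

Definition Omega : set B := [set w | ~ integers (P1 w) /\ ~ integers (P2 w)].

(* 1 + B_*, where B_* is the group of units. *)
Definition one_plus_units : set B := [set w | w - 1 \is a GRing.unit].

Definition bexp w : B := bicomb (cexp (P1 w)) (cexp (P2 w)).
Definition bsin w : B := bicomb (csin (P1 w)) (csin (P2 w)).

(* t ^ w for a real t > 0. *)
Definition bpow (t : R) w : B := bexp (ln t *: w).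

Definition bgamma w : B := bicomb (cgamma (P1 w)) (cgamma (P2 w)).
Definition bzeta w : B := bicomb (czeta (P1 w)) (czeta (P2 w)).

Definition zeta_rhs w : B :=
  2 * bpow (2 * pi) (w - 1) * bsin ((pi / 2) *: w) * bgamma (1 - w) * bzeta (1 - w).

(* The points at which both Gamma (1 - w) and zeta (1 - w) are defined. On
   one_plus_units, the singularities of zeta_rhs outside this set (some P_l w is 0
   or an integer >= 2) are removable, and the value there is the limit along it. *)
Definition zeta_rhs_dom : set B :=
  [set w | Omega_minus (1 - w) /\ one_plus_units (1 - w)].

End BicomplexFunctions.

(* Main.v *)
(* The idempotent components reduce everything to the complex functions Gamma and
   zeta; the identities are proved on a real interval and carried over by the
   identity theorem for power series.

   Euler's integral is analytic for Re z > 0, because the exponential series of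
   t ^ (z - x0) can be integrated term by term, and its recursion continues it to
   the left. For 0 < a < 1, Tonelli's theorem turns Gamma (a) Gamma (1 - a) into
   the integral of v ^ (a - 1) / (1 + v), which is expanded into the partial
   fractions of pi / sin (pi a).

   For x > 1, Gamma (x) zeta (x) is the integral of t ^ (x - 1) / (e ^ t - 1) over
   t > 0. Subtracting 1 / t - 1 / 2 on ]0, 1] continues it to Re s > -1, and for
   -1 < x < 0 the continuation is the integral of
   t ^ (x - 1) (1 / (e ^ t - 1) - 1 / t + 1 / 2). The partial fractions
   sum_n 2 t / (t ^ 2 + (2 pi n) ^ 2) of the last factor, integrated term by term,
   give the functional equation on -1 < x < 0. The continuation of zeta is glued
   from its series, from the right-hand side of the functional equation for
   Re s < 0, and from this integral in between. *)
Require Import Defs.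
From mathcomp Require Import all_boot all_order all_algebra.
From mathcomp Require Import complex ring lra.
From mathcomp Require Import all_classical all_reals all_analysis measurable_realfun.
Import Order.TTheory GRing.Theory Num.Theory.
Import numFieldNormedType.Exports.

Set Implicit Arguments.
Unset Strict Implicit.
Unset Printing Implicit Defensive.

Local Open Scope classical_set_scope.
Local Open Scope ring_scope.

(** [cgamma] and [czeta] are picked by [xget], so they become accessible only once some analytic
    continuation has been exhibited; afterwards they are handled through their analyticity and their
    values on the initial half-plane. Analyticity is carried by power series with an explicit
    absolute bound on a closed disk ([ps_disk]), a form stable under products and under summable
    families. The domains omit only real points, so uniqueness can follow a path that leaves the
    real axis at once. The partial fractions come from the Herglotz trick: both sides satisfy one
    duplication formula, and their difference tends to 0 at the origin. The expression
    [zmellin x + (x - 1)^-1 - (2 * x)^-1] is Gamma zeta for [1 < x] and the integral with [bern] for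
    [-1 < x < 0], because a power has opposite closed forms for its integrals over []0, 1]] and []1,
    +oo[]. Division by Gamma is multiplication by sin (pi s) Gamma (1 - s) / pi, the reflection
    formula. Where a factor of the right-hand side of the third claim is unspecified, the limit
    exists because zeta is continuous there. *)

Section Modulus.
Variable R : realType.
Local Notation C := (cplx R).
Implicit Types z w : C.

(** The norm of [cplx R] takes its values in [cplx R]; a modulus in [R] makes the estimates real
    inequalities. *)
Definition cmod z : R := Normc.normc z.
Arguments cmod : simpl never.

Lemma cmodE z : cmod z = Num.sqrt (cRe z ^+ 2 + cIm z ^+ 2).
Proof. by case: z. Qed.

Lemma cmodCE z : `|z| = ofReal (cmod z).
Proof. by rewrite normc_def cmodE. Qed.

Lemma cmod_ge0 z : 0 <= cmod z. Proof. by rewrite cmodE sqrtr_ge0. Qed.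
Hint Extern 0 (is_true (@Order.le _ _ _ (cmod _))) => apply: cmod_ge0 : core.

Lemma cmodM z w : cmod (z * w) = cmod z * cmod w. Proof. exact: Normc.normcM. Qed.
Lemma cmodV z : cmod z^-1 = (cmod z)^-1. Proof. exact: Normc.normcV. Qed.
Lemma cmodD z w : cmod (z + w) <= cmod z + cmod w. Proof. exact: le_normcD. Qed.
Lemma cmodN z : cmod (- z) = cmod z. Proof. exact: normcN. Qed.
Lemma cmod0 : cmod 0 = 0. Proof. exact: Normc.normc0. Qed.
Lemma cmod1 : cmod 1 = 1. Proof. exact: Normc.normc1. Qed.

Lemma cmod_eq0 z : (cmod z == 0) = (z == 0).
Proof. by apply/eqP/eqP => [/Normc.eq0_normc//|->]; rewrite cmod0. Qed.

Lemma cmod_gt0 z : (0 < cmod z) = (z != 0).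
Proof. by rewrite lt0r cmod_eq0 cmod_ge0 andbT. Qed.

Lemma cmodX z n : cmod (z ^+ n) = cmod z ^+ n.
Proof. by elim: n => [|n IH]; rewrite ?cmod1 // !exprS cmodM IH. Qed.

Lemma cmodB z w : cmod (z - w) = cmod (w - z).
Proof. by rewrite -cmodN opprB. Qed.

Lemma cmod_leB z w : cmod z - cmod w <= cmod (z - w).
Proof. by rewrite lerBlDr; have := cmodD (z - w) w; rewrite subrK. Qed.

Lemma cmod_sum (I : Type) (r : seq I) (P : pred I) (F : I -> C) :
  cmod (\sum_(i <- r | P i) F i) <= \sum_(i <- r | P i) cmod (F i).
Proof.
elim/big_ind2 : _ => [|z1 x1 z2 x2 h1 h2|//]; first by rewrite cmod0.
by apply: le_trans (cmodD _ _) (lerD _ _).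
Qed.

Lemma cmod_ofReal (x : R) : cmod (ofReal x) = `|x|.
Proof. by rewrite cmodE /= expr0n addr0 sqrtr_sqr. Qed.

Lemma cReD z w : cRe (z + w) = cRe z + cRe w. Proof. by case: z w => [? ?] []. Qed.
Lemma cImD z w : cIm (z + w) = cIm z + cIm w. Proof. by case: z w => [? ?] []. Qed.
Lemma cReN z : cRe (- z) = - cRe z. Proof. by case: z. Qed.
Lemma cImN z : cIm (- z) = - cIm z. Proof. by case: z. Qed.
Lemma cReB z w : cRe (z - w) = cRe z - cRe w. Proof. by rewrite cReD cReN. Qed.
Lemma cImB z w : cIm (z - w) = cIm z - cIm w. Proof. by rewrite cImD cImN. Qed.
Lemma cReM z w : cRe (z * w) = cRe z * cRe w - cIm z * cIm w.
Proof. by case: z w => [? ?] []. Qed.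
Lemma cImM z w : cIm (z * w) = cRe z * cIm w + cIm z * cRe w.
Proof. by case: z w => [? ?] []. Qed.

Lemma cRe_sum (I : Type) (r : seq I) (P : pred I) (F : I -> C) :
  cRe (\sum_(i <- r | P i) F i) = \sum_(i <- r | P i) cRe (F i).
Proof. by elim/big_ind2 : _ => // ? ? ? ? <- <-; exact: cReD. Qed.
Lemma cIm_sum (I : Type) (r : seq I) (P : pred I) (F : I -> C) :
  cIm (\sum_(i <- r | P i) F i) = \sum_(i <- r | P i) cIm (F i).
Proof. by elim/big_ind2 : _ => // ? ? ? ? <- <-; exact: cImD. Qed.

Lemma cplxP z w : cRe z = cRe w -> cIm z = cIm w -> z = w.
Proof. by case: z w => [? ?] [? ?] /= -> ->. Qed.

Lemma ler_cRe z : `|cRe z| <= cmod z.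
Proof. by rewrite cmodE -sqrtr_sqr ler_wsqrtr // lerDl sqr_ge0. Qed.
Lemma ler_cIm z : `|cIm z| <= cmod z.
Proof. by rewrite cmodE -sqrtr_sqr ler_wsqrtr // lerDr sqr_ge0. Qed.

Lemma cplxE z : z = ofReal (cRe z) + ofReal (cIm z) * Complex 0 1.
Proof. by apply: cplxP; rewrite ?(cReD, cImD, cReM, cImM) /=; ring. Qed.

Lemma ler_cmod z : cmod z <= `|cRe z| + `|cIm z|.
Proof.
rewrite {1}(cplxE z); apply: le_trans (cmodD _ _) _.
by rewrite cmodM !cmod_ofReal /cmod /= expr0n add0r expr1n sqrtr1 mulr1.
Qed.

Lemma ofRealD (x y : R) : ofReal (x + y) = ofReal x + ofReal y.
Proof. by apply: cplxP; rewrite ?(cReD, cImD) /= ?addr0. Qed.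
Lemma ofRealN (x : R) : ofReal (- x) = - ofReal x.
Proof. by apply: cplxP; rewrite ?(cReN, cImN) /= ?oppr0. Qed.
Lemma ofRealB (x y : R) : ofReal (x - y) = ofReal x - ofReal y.
Proof. by rewrite ofRealD ofRealN. Qed.
Lemma ofRealM (x y : R) : ofReal (x * y) = ofReal x * ofReal y.
Proof. by apply: cplxP; rewrite ?(cReM, cImM) /=; ring. Qed.
Lemma ofReal0 : ofReal 0 = 0 :> C. Proof. by []. Qed.
Lemma ofReal1 : ofReal 1 = 1 :> C. Proof. by []. Qed.
Lemma ofReal_nat n : ofReal n%:R = n%:R :> C.
Proof. by elim: n => // n IH; rewrite -!natr1 ofRealD IH. Qed.
Lemma ofReal_inj : injective (@ofReal R). Proof. by move=> x y []. Qed.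
Lemma ofReal_eq0 (x : R) : (ofReal x == 0) = (x == 0).
Proof. by rewrite -(inj_eq ofReal_inj). Qed.
Lemma ofRealX (x : R) n : ofReal (x ^+ n) = ofReal x ^+ n.
Proof. by elim: n => // n IH; rewrite !exprS ofRealM IH. Qed.
Lemma ofRealV (x : R) : ofReal x^-1 = (ofReal x)^-1.
Proof.
have [->|x0] := eqVneq x 0; first by rewrite invr0 ofReal0 invr0.
apply: (mulfI (_ : ofReal x != 0)); first by rewrite ofReal_eq0.
by rewrite -ofRealM mulfV // mulfV // ofReal_eq0.
Qed.
Lemma ofReal_sum (I : Type) (r : seq I) (P : pred I) (F : I -> R) :
  ofReal (\sum_(i <- r | P i) F i) = \sum_(i <- r | P i) ofReal (F i).
Proof. by elim/big_ind2 : _ => // ? ? ? ? <- <-; exact: ofRealD. Qed.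

Lemma cmod_nat n : cmod n%:R = n%:R.
Proof. by rewrite -ofReal_nat cmod_ofReal ger0_norm. Qed.

Lemma cplx_sq z : cmod z ^+ 2 = cRe z ^+ 2 + cIm z ^+ 2.
Proof. by rewrite cmodE sqr_sqrtr // addr_ge0 // sqr_ge0. Qed.

End Modulus.
Arguments cmod {R} z : simpl never.
#[global] Hint Extern 0 (is_true (@Order.le _ _ _ (cmod _))) => apply: cmod_ge0 : core.

(* Stated over an abstract field, since unification tends to unfold [cplx R]. *)
Section ClosedFieldConvergence.
Variables (K : numClosedFieldType) (T : Type) (F : set_system T).
Context {FF : Filter F}.
Implicit Types (u v : T -> K).

Lemma cvgC_cst (c : K) : (fun=> c) @ F --> c.
Proof. exact: cvg_cst. Qed.
Lemma cvgC_add u v (a b : K) : u x @[x --> F] --> a -> v x @[x --> F] --> b ->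
  (u x + v x) @[x --> F] --> a + b.
Proof. exact: cvgD. Qed.
Lemma cvgC_sub u v (a b : K) : u x @[x --> F] --> a -> v x @[x --> F] --> b ->
  (u x - v x) @[x --> F] --> a - b.
Proof. exact: cvgB. Qed.
Lemma cvgC_mul u v (a b : K) : u x @[x --> F] --> a -> v x @[x --> F] --> b ->
  (u x * v x) @[x --> F] --> a * b.
Proof. exact: cvgM. Qed.
Lemma cvgC_mull u (a c : K) : u x @[x --> F] --> a -> (c * u x) @[x --> F] --> c * a.
Proof. by move=> h; apply: cvgC_mul => //; exact: cvgC_cst. Qed.
Lemma cvgC_mulr u (a c : K) : u x @[x --> F] --> a -> (u x * c) @[x --> F] --> a * c.
Proof. by move=> h; apply: cvgC_mul => //; exact: cvgC_cst. Qed.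
Lemma cvgC_sum (N : nat) (u : T -> nat -> K) (v : nat -> K) :
  (forall k, u x k @[x --> F] --> v k) ->
  \sum_(0 <= k < N) u x k @[x --> F] --> \sum_(0 <= k < N) v k.
Proof.
move=> h; elim: N => [|N IH].
  have -> : (fun x => \sum_(0 <= k < 0) u x k) = (fun=> 0).
    by apply/funext => x; rewrite big_geq.
  by rewrite big_geq //; exact: cvg_cst.
have -> : (fun x => \sum_(0 <= k < N.+1) u x k) =
    (fun x => \sum_(0 <= k < N) u x k + u x N).
  by apply/funext => x; rewrite big_nat_recr.
by rewrite big_nat_recr //=; apply: cvgD.
Qed.

End ClosedFieldConvergence.

(** * Convergence in the complex plane in terms of the real modulus *)

Section Convergence.
Variable R : realType.
Local Notation C := (cplx R).

(** A positive element of [cplx R] is real, so the complex epsilons of the norm topology are exactly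
    the [ofReal e] with [0 < e]. *)
Lemma cvgCP (T : Type) (F : set_system T) {FF : Filter F} (u : T -> C) (l : C) :
  u x @[x --> F] --> l <-> cmod (u x - l) @[x --> F] --> (0 : R).
Proof.
split=> [ul|ul].
- apply/cvgrPdist_lt => e e0.
  have /cvgrPdist_lt /(_ (ofReal e)) := ul.
  rewrite ltcR => /(_ e0); apply: filterS => x /=.
  rewrite sub0r normrN (ger0_norm (cmod_ge0 _)) cmodCE ltcR cmodB => h.
  exact: h.
- apply/cvgrPdist_lt => e; rewrite ltcE /= => /andP[/eqP e2 e0].
  have {e2} -> : e = ofReal (cRe e) by apply: cplxP.
  move/cvgrPdist_lt : ul => /(_ _ e0); apply: filterS => x.
  by rewrite sub0r normrN (ger0_norm (cmod_ge0 _)) cmodCE ltcR cmodB.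
Qed.

Lemma cvgC_cRe (T : Type) (F : set_system T) {FF : Filter F} (u : T -> C) (l : C) :
  u x @[x --> F] --> l -> cRe (u x) @[x --> F] --> cRe l.
Proof.
move=> /cvgCP/cvgrPdist_lt ul; apply/cvgrPdist_lt => e /ul; apply: filterS => x.
rewrite sub0r normrN (ger0_norm (cmod_ge0 _)); apply: le_lt_trans.
by rewrite distrC -cReB ler_cRe.
Qed.

Lemma cvgC_cIm (T : Type) (F : set_system T) {FF : Filter F} (u : T -> C) (l : C) :
  u x @[x --> F] --> l -> cIm (u x) @[x --> F] --> cIm l.
Proof.
move=> /cvgCP/cvgrPdist_lt ul; apply/cvgrPdist_lt => e /ul; apply: filterS => x.
rewrite sub0r normrN (ger0_norm (cmod_ge0 _)); apply: le_lt_trans.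
by rewrite distrC -cImB ler_cIm.
Qed.

Lemma cvgC_ReIm (T : Type) (F : set_system T) {FF : Filter F} (u : T -> C) (l : C) :
  cRe (u x) @[x --> F] --> cRe l -> cIm (u x) @[x --> F] --> cIm l ->
  u x @[x --> F] --> l.
Proof.
move=> hr hi; apply/cvgCP.
have h : (`|cRe (u x) - cRe l| + `|cIm (u x) - cIm l|) @[x --> F] --> (0 : R).
  rewrite -[0]addr0; apply: cvgD; rewrite -(normr0 R); apply: cvg_norm.
  - by rewrite -(subrr (cRe l)); apply: cvgB => //; exact: cvg_cst.
  - by rewrite -(subrr (cIm l)); apply: cvgB => //; exact: cvg_cst.
apply: (squeeze_cvgr _ (cvg_cst 0) h).
by apply: nearW => x; rewrite cmod_ge0 /= -cReB -cImB ler_cmod.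
Qed.

Lemma cvgC_ofReal (T : Type) (F : set_system T) {FF : Filter F} (u : T -> R) (l : R) :
  u x @[x --> F] --> l -> ofReal (u x) @[x --> F] --> (ofReal l : C).
Proof. by move=> ul; apply: cvgC_ReIm => //=; exact: cvg_cst. Qed.

Lemma nearC (z0 : C) (P : set C) :
  (\forall z \near z0, P z) <->
  exists2 d : R, 0 < d & forall z, cmod (z - z0) < d -> P z.
Proof.
split.
- move=> /nbhs_ballP[e /= ]; rewrite ltcE /= => /andP[/eqP e2 e0] H.
  exists (cRe e) => // z hz; apply: H; rewrite -ball_normE /=.
  have -> : e = ofReal (cRe e) by apply: cplxP.
  by rewrite cmodCE ltcR cmodB.
- move=> [d d0 H]; apply/nbhs_ballP; exists (ofReal d) => /=; first by rewrite ltcR.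
  move=> z; rewrite -ball_normE /= cmodCE ltcR => hz.
  by apply: H; rewrite cmodB.
Qed.

Lemma limC_unique (u : nat -> C) (l l' : C) :
  u @ \oo --> l -> u @ \oo --> l' -> l = l'.
Proof. by move=> h h'; apply: (cvg_unique _ h h'); exact: norm_hausdorff. Qed.

Lemma limCE (u : nat -> C) (l : C) : u @ \oo --> l -> limn u = l.
Proof. by move=> h; apply: cvg_lim h; exact: norm_hausdorff. Qed.

Lemma cvgC_le (u : nat -> C) (l : C) (M : R) :
  u @ \oo --> l -> (forall n, cmod (u n) <= M) -> cmod l <= M.
Proof.
move=> /cvgCP ul uM; apply/ler_addgt0Pr => e e0.
move/cvgrPdist_lt : ul => /(_ _ e0) [N _ /(_ N (leqnn _))] /=.
rewrite sub0r normrN (ger0_norm (cmod_ge0 _)) => h.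
have -> : l = u N + (l - u N) by rewrite addrC subrK.
apply: le_trans (cmodD _ _) _; apply: lerD => //.
by rewrite cmodB ltW.
Qed.

End Convergence.

Lemma cvg_sumR_nat (V : realType) (T : Type) (F : set_system T) {FF : Filter F}
    (N : nat) (u : T -> nat -> V) (v : nat -> V) :
  (forall k, u x k @[x --> F] --> v k) ->
  \sum_(0 <= k < N) u x k @[x --> F] --> \sum_(0 <= k < N) v k.
Proof.
move=> h; elim: N => [|N IH].
  have -> : (fun x => \sum_(0 <= k < 0) u x k) = (fun=> 0).
    by apply/funext => x; rewrite big_geq.
  by rewrite big_geq //; exact: cvg_cst.
have -> : (fun x => \sum_(0 <= k < N.+1) u x k) =
    (fun x => \sum_(0 <= k < N) u x k + u x N).
  by apply/funext => x; rewrite big_nat_recr.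
by rewrite big_nat_recr //=; apply: cvgD.
Qed.

(** * Absolutely convergent series and dominated convergence for series *)

Section Series.
Variable R : realType.
Local Notation C := (cplx R).

Lemma series_bound_cvg (u : nat -> R) (M : R) : (forall k, 0 <= u k) ->
  (forall N, \sum_(0 <= k < N) u k <= M) ->
  exists L, [/\ series u @ \oo --> L, L <= M & forall N, \sum_(0 <= k < N) u k <= L].
Proof.
move=> u0 uM.
have nd : {homo series u : n m / (n <= m)%N >-> n <= m}.
  by apply/nondecreasing_seqP => n; rewrite /series /= big_nat_recr //= lerDl.
have cv : cvgn (series u).
  by apply: nondecreasing_is_cvgn => //; exists M => _ [n _ <-]; exact: uM.
exists (limn (series u)); split=> //; last exact: nondecreasing_cvgn_le.
by apply: limr_le => //; apply: nearW.
Qed.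

(** Completeness enters through the real and imaginary parts, each bounded by the modulus. *)
Lemma csum_bound_cvg (u : nat -> C) (M : R) :
  (forall N, \sum_(0 <= k < N) cmod (u k) <= M) ->
  exists2 l : C, series u @ \oo --> l & cmod l <= M.
Proof.
move=> uM.
have aux (f : C -> R) : (forall z, `|f z| <= cmod z) -> cvgn (series (f \o u)).
  move=> fz; apply: normed_cvg.
  have [//|N|L [h _ _]] := @series_bound_cvg (fun k => `|f (u k)|) M.
  - by apply: le_trans (uM N); apply: ler_sum => i _; exact: fz.
  - by apply/cvg_ex; exists L.
have /cvg_ex[a ha] := aux (@cRe R) (@ler_cRe R).
have /cvg_ex[b hb] := aux (@cIm R) (@ler_cIm R).
have cv : series u @ \oo --> (Complex a b : C).
  apply: cvgC_ReIm => /=.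
  - by under eq_fun do rewrite /series /= cRe_sum.
  - by under eq_fun do rewrite /series /= cIm_sum.
exists (Complex a b : C) => //.
apply: cvgC_le cv _ => n; apply: le_trans (cmod_sum _ _ _) _; exact: uM.
Qed.

Lemma csum_tail (u : nat -> C) (l : C) (M : nat -> R) (L : R) (I : nat) :
  series u @ \oo --> l -> (forall i, cmod (u i) <= M i) ->
  (forall N, \sum_(0 <= k < N) M k <= L) ->
  cmod (l - \sum_(0 <= k < I) u k) <= L - \sum_(0 <= k < I) M k.
Proof.
move=> ul uM ML.
have h : (fun n => series u (n + I)%N - \sum_(0 <= k < I) u k) @ \oo -->
    l - \sum_(0 <= k < I) u k.
  by apply: cvgC_sub; [rewrite cvg_shiftn | exact: cvgC_cst].
apply: cvgC_le h _ => n.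
rewrite /series /= (@big_cat_nat _ _ _ I) //= ?leq_addl // addrAC subrr add0r.
apply: le_trans (cmod_sum _ _ _) _.
rewrite lerBrDl.
apply: le_trans (ML (n + I)%N).
by rewrite [leRHS](@big_cat_nat _ _ _ I) //= ?leq_addl // lerD2l ler_sum.
Qed.

(** Cut at an index [I] beyond which the majorants sum to less than a third of epsilon: both tails
    are then small uniformly in [K], and the finite part converges. *)
Lemma tannery (u : nat -> nat -> C) (v : nat -> C) (M : nat -> R) (Mt : R)
    (s : nat -> C) (t : C) :
  (forall K i, cmod (u K i) <= M i) -> (forall N, \sum_(0 <= k < N) M k <= Mt) ->
  (forall i, u K i @[K --> \oo] --> v i) ->
  (forall K, series (u K) @ \oo --> s K) -> series v @ \oo --> t -> s @ \oo --> t.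
Proof.
move=> uM MMt uv us vt.
have M0 i : 0 <= M i by apply: le_trans (uM 0%N i).
have vM i : cmod (v i) <= M i by apply: cvgC_le (uv i) _ => K; exact: uM.
have [L [ML _ LM]] := series_bound_cvg M0 MMt.
apply/cvgCP/cvgrPdist_lt => e e0.
have e3 : 0 < e / 3 by rewrite divr_gt0.
have /cvgrPdist_lt /(_ _ e3) [I _ /(_ I (leqnn _))] /= := ML.
move=> hI; have {}hI : L - \sum_(0 <= k < I) M k < e / 3.
  by apply: le_lt_trans hI; exact: ler_norm.
have fin : (fun K => \sum_(0 <= k < I) u K k) @ \oo --> \sum_(0 <= k < I) v k.
  exact: cvgC_sum.
have /cvgCP/cvgrPdist_lt /(_ _ e3) := fin; apply: filterS => K.
rewrite !sub0r !normrN !(ger0_norm (cmod_ge0 _)) => hK.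
have h1 := csum_tail I (us K) (uM K) LM.
have h2 := csum_tail I vt vM LM.
have -> : s K - t = (s K - \sum_(0 <= k < I) u K k) +
   ((\sum_(0 <= k < I) u K k - \sum_(0 <= k < I) v k) +
    (\sum_(0 <= k < I) v k - t)) by ring.
apply: le_lt_trans (cmodD _ _) _.
have := cmodD (\sum_(0 <= k < I) u K k - \sum_(0 <= k < I) v k)
    (\sum_(0 <= k < I) v k - t).
rewrite (cmodB _ t); rewrite /series /= in hI *; lra.
Qed.

Lemma series_sum_cvg (a : nat -> nat -> C) (K : nat) (A : nat -> C) :
  (forall k, series (a^~ k) @ \oo --> A k) ->
  series (fun i => \sum_(0 <= k < K) a i k) @ \oo --> \sum_(0 <= k < K) A k.
Proof.
move=> h; have -> : series (fun i => \sum_(0 <= k < K) a i k) =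
    (fun N => \sum_(0 <= k < K) series (a^~ k) N).
  by apply/funext => N; rewrite /series /= exchange_big.
exact: cvgC_sum.
Qed.

End Series.

Lemma ler_pow (K : realDomainType) (x y : K) n : 0 <= x -> x <= y -> x ^+ n <= y ^+ n.
Proof. by move=> x0 xy; rewrite lerXn2r // nnegrE // (le_trans x0). Qed.

(** * Power series with an absolute bound on a closed disk *)

Section PowerSeries.
Variable R : realType.
Local Notation C := (cplx R).
Implicit Types (z : C) (f g : C -> C) (r M : R).

(** The bound [M] concerns the absolute series on the circle of radius [r], not only the values of
    [f]: infinite families can then be added as soon as their bounds are summable. *)
Definition ps_coef (a : nat -> C) f z0 r M :=
  [/\ 0 < r, (forall N, \sum_(0 <= k < N) cmod (a k) * r ^+ k <= M) &
  (forall z, cmod (z - z0) <= r -> series (fun k => a k * (z - z0) ^+ k) @ \oo --> f z)].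

Definition ps_disk f z0 r M := exists a : nat -> C, ps_coef a f z0 r M.

Lemma ps_disk_bound f z0 r M z : ps_disk f z0 r M ->
  cmod (z - z0) <= r -> cmod (f z) <= M.
Proof.
move=> [a [r0 aM af]] zr; apply: cvgC_le (af z zr) _ => n.
apply: le_trans (cmod_sum _ _ _) _; apply: le_trans (aM n).
apply: ler_sum => k _; rewrite cmodM cmodX ler_wpM2l // ler_pow //.
Qed.

Lemma ps_disk_ext f g z0 r M : (forall z, cmod (z - z0) <= r -> f z = g z) ->
  ps_disk f z0 r M -> ps_disk g z0 r M.
Proof. by move=> fg [a [r0 aM af]]; exists a; split=> [//|//|z zr]; rewrite -fg //; exact: af. Qed.

Lemma ps_disk_le f z0 r M r' M' : 0 < r' -> r' <= r -> M <= M' ->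
  ps_disk f z0 r M -> ps_disk f z0 r' M'.
Proof.
move=> r0 rr MM [a [_ aM af]]; exists a; split=> [//|N|z zr]; last first.
  by apply: af; apply: le_trans rr.
apply: le_trans MM; apply: le_trans (aM N); apply: ler_sum => k _.
by rewrite ler_wpM2l // ler_pow // ltW.
Qed.

Lemma ps_disk_cst c z0 r : 0 < r -> ps_disk (fun=> c) z0 r (cmod c).
Proof.
move=> r0; exists (fun k => if k is 0%N then c else 0); split=> [//|[|N]|z _].
- by rewrite big_geq.
- by rewrite big_nat_recl // mulr1 big1 ?addr0 // => i _ /=; rewrite cmod0 mul0r.
- rewrite -(cvg_shiftn 1).
  set v := (X in X @ _ --> _); have -> : v = (fun=> c); last exact: cvgC_cst.
  apply/funext => n; rewrite /v /series /= addn1 big_nat_recl //= expr0 mulr1.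
  by rewrite big1 ?addr0 // => i _; rewrite mul0r.
Qed.

Lemma ps_disk_scale c f z0 r M : ps_disk f z0 r M ->
  ps_disk (fun z => c * f z) z0 r (cmod c * M).
Proof.
move=> [a [r0 aM af]]; exists (fun k => c * a k); split=> [//|N|z zr].
- under eq_bigr do rewrite cmodM -mulrA.
  by rewrite -mulr_sumr ler_wpM2l.
- rewrite /series /=; under eq_fun do under eq_bigr do rewrite -mulrA.
  by under eq_fun do rewrite -mulr_sumr; apply: cvgC_mull; [exact: af].
Qed.

Lemma ps_disk_add f g z0 r M M' : ps_disk f z0 r M -> ps_disk g z0 r M' ->
  ps_disk (fun z => f z + g z) z0 r (M + M').
Proof.
move=> [a [r0 aM af]] [b [_ bM bg]]; exists (fun k => a k + b k).
split=> [//|N|z zr].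
- apply: le_trans (lerD (aM N) (bM N)); rewrite -big_split /=.
  apply: ler_sum => k _; rewrite -mulrDl ler_wpM2r ?cmodD //.
  by rewrite exprn_ge0 // ltW.
- rewrite /series /=; under eq_fun do (under eq_bigr do rewrite mulrDl; rewrite big_split /=).
  by apply: cvgC_add; [exact: af | exact: bg].
Qed.

Lemma ps_disk_shift f z0 r M : ps_disk f z0 r M ->
  ps_disk (fun z => (z - z0) * f z) z0 r (r * M).
Proof.
move=> [a [r0 aM af]]; exists (fun k => if k is k'.+1 then a k' else 0).
split=> [//|[|N]|z zr].
- by rewrite big_geq // mulr_ge0 ?(ltW r0) //; have := aM 0%N; rewrite big_geq.
- rewrite big_nat_recl //= cmod0 mul0r add0r.
  under eq_bigr do rewrite exprS mulrCA.
  by rewrite -mulr_sumr ler_wpM2l // ltW.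
- rewrite -(cvg_shiftn 1) /= /series /=.
  under eq_fun do (rewrite addn1 big_nat_recl //= mul0r add0r;
    under eq_bigr do rewrite exprS mulrCA; rewrite -mulr_sumr).
  by apply: cvgC_mull; [exact: af].
Qed.

Lemma ps_disk_shiftn f z0 r M n : ps_disk f z0 r M ->
  ps_disk (fun z => (z - z0) ^+ n * f z) z0 r (r ^+ n * M).
Proof.
move=> H; elim: n => [|n IH].
  by rewrite expr0 mul1r; apply: ps_disk_ext H => z _; rewrite mul1r.
rewrite exprS -mulrA; apply: ps_disk_ext (ps_disk_shift IH) => z _.
by rewrite exprS mulrA.
Qed.

(* The interchange of the two summations is dominated convergence for series. *)
Lemma ps_coef_series (F : nat -> C -> C) (S : C -> C) z0 r (M : nat -> R) (Mt : R)
    (a : nat -> nat -> C) (A : nat -> C) :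
  (forall i, ps_coef (a i) (F i) z0 r (M i)) -> (forall N, \sum_(0 <= i < N) M i <= Mt) ->
  (forall z, cmod (z - z0) <= r -> series (F^~ z) @ \oo --> S z) ->
  (forall k, series (a^~ k) @ \oo --> A k) ->
  ps_coef A S z0 r Mt.
Proof.
move=> aP MMt FS AP.
have r0 : 0 < r by case: (aP 0%N).
have rn0 k : 0 < r ^+ k by rewrite exprn_gt0.
split=> [//|N|z zr].
- have AP' k : series (fun i => a i k * ofReal (r ^+ k)) @ \oo --> A k * ofReal (r ^+ k).
    rewrite /series /=; under eq_fun do rewrite -mulr_suml.
    by apply: cvgC_mulr; [exact: AP].
  (* The bound on the coefficients [A k] is inherited from the finite sums over [i < I], by letting
     [I] grow. *)
  have h : (fun I => \sum_(0 <= k < N) cmod (\sum_(0 <= i < I) a i k * ofReal (r ^+ k))) @ \oo -->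
      \sum_(0 <= k < N) cmod (A k) * r ^+ k.
    apply: cvg_sumR_nat => k.
    have -> : cmod (A k) * r ^+ k = cmod (A k * ofReal (r ^+ k)).
      by rewrite cmodM cmod_ofReal ger0_norm // ltW.
    apply/cvgrPdist_lt => e e0; have /cvgCP/cvgrPdist_lt /(_ _ e0) := AP' k.
    apply: filterS => I; rewrite sub0r normrN (ger0_norm (cmod_ge0 _)).
    apply: le_lt_trans; rewrite distrC /series /=.
    by rewrite ler_norml cmod_leB andbT lerNl opprB cmodB cmod_leB.
  apply: (cvgr_to_le h); apply: nearW => I.
  apply: (@le_trans _ _ (\sum_(0 <= i < I) \sum_(0 <= k < N) cmod (a i k) * r ^+ k)).
    rewrite exchange_big /=; apply: ler_sum => k _.
    apply: le_trans (cmod_sum _ _ _) _; apply: ler_sum => i _.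
    by rewrite cmodM cmod_ofReal ger0_norm // ltW.
  apply: le_trans (MMt I); apply: ler_sum => i _.
  by case: (aP i).
(* The limit variable is the degree [K] at which all the expansions are cut; the dominated index is
   that of the functions [F i]. *)
- apply: (@tannery _ (fun K i => \sum_(0 <= k < K) a i k * (z - z0) ^+ k)
    (F^~ z) M Mt _ (S z)).
  + move=> K i; apply: le_trans (cmod_sum _ _ _) _.
    have [_ /(_ K) h _] := aP i; apply: le_trans h; apply: ler_sum => k _.
    by rewrite cmodM cmodX ler_wpM2l // ler_pow //.
  + exact: MMt.
  + by move=> i; have [_ _ /(_ _ zr)] := aP i.
  + move=> K; rewrite /series /=.
    apply: (@series_sum_cvg _ (fun i k => a i k * (z - z0) ^+ k)) => k.
    rewrite /series /=; under eq_fun do rewrite -mulr_suml.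
    by apply: cvgC_mulr; [exact: AP].
  + exact: FS.
Qed.

(** Each coefficient satisfies [cmod (a i k) * r ^+ k <= M i], so every column [a^~ k] is absolutely
    summable, and the column sums are the coefficients of [S]. *)
Lemma ps_disk_series (F : nat -> C -> C) (S : C -> C) z0 r (M : nat -> R) (Mt : R) :
  (forall i, ps_disk (F i) z0 r (M i)) -> (forall N, \sum_(0 <= i < N) M i <= Mt) ->
  (forall z, cmod (z - z0) <= r -> series (F^~ z) @ \oo --> S z) ->
  ps_disk S z0 r Mt.
Proof.
move=> FM MMt FS.
have /choice[a aP] : forall i, exists a : nat -> C, ps_coef a (F i) z0 r (M i).
  by move=> i; exact: FM.
have r0 : 0 < r by case: (aP 0%N).
have rn0 k : 0 < r ^+ k by rewrite exprn_gt0.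
have aM i k : cmod (a i k) * r ^+ k <= M i.
  have [_ /(_ k.+1) h _] := aP i; apply: le_trans h.
  rewrite big_nat_recr //= lerDr sumr_ge0 // => j _.
  by rewrite mulr_ge0 // ltW.
have /choice[A AP] : forall k, exists l : C, series (a^~ k) @ \oo --> l.
  move=> k; have [N|l h _] := @csum_bound_cvg _ (a^~ k) (Mt / r ^+ k).
    rewrite ler_pdivlMr // mulr_suml; apply: le_trans (MMt N).
    by apply: ler_sum => i _; exact: aM.
  by exists l.
exists A; exact: ps_coef_series aP MMt FS AP.
Qed.

(** Only [g] is expanded: [f] times the term of degree [i] of [g] is a disk with bound
    [cmod (b i) * r ^+ i * M], and [ps_disk_series] performs the rearrangement of the Cauchy
    product. *)
Lemma ps_disk_mul f g z0 r M M' : ps_disk f z0 r M -> ps_disk g z0 r M' ->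
  ps_disk (fun z => f z * g z) z0 r (M * M').
Proof.
move=> Hf [b [r0 bM bg]].
have M0 : 0 <= M.
  by apply: le_trans (ps_disk_bound Hf (_ : cmod (z0 - z0) <= r)); rewrite // subrr cmod0 ltW.
apply: (@ps_disk_series (fun i z => b i * ((z - z0) ^+ i * f z)) _ _ _
    (fun i => cmod (b i) * (r ^+ i * M))).
- by move=> i; apply: ps_disk_scale; exact: ps_disk_shiftn.
- move=> N; under eq_bigr do rewrite mulrA.
  by rewrite -mulr_suml mulrC ler_wpM2l.
- move=> z zr; rewrite /series /=; under eq_fun do (under eq_bigr do rewrite mulrA;
    rewrite -mulr_suml); rewrite mulrC.
  by apply: cvgC_mulr; [exact: bg].
Qed.

Lemma ps_disk_id z0 z1 r : 0 < r -> ps_disk (fun z => z - z1) z0 r (cmod (z0 - z1) + r).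
Proof.
move=> r0.
have := ps_disk_add (ps_disk_cst (z0 - z1) z0 r0) (ps_disk_shift (ps_disk_cst 1 z0 r0)).
by rewrite cmod1 mulr1; apply: ps_disk_ext => z _; ring.
Qed.

Lemma ps_disk_pow f z0 r M n : ps_disk f z0 r M ->
  ps_disk (fun z => f z ^+ n) z0 r (M ^+ n).
Proof.
move=> H; have r0 : 0 < r by case: H => ? [].
elim: n => [|n IH].
  by rewrite expr0 -(cmod1 R); exact: ps_disk_cst.
by rewrite exprS; apply: ps_disk_ext (ps_disk_mul H IH) => z _; rewrite exprS.
Qed.

(** Around [z1] the monomial [(z - z0) ^+ i] is itself a disk, with bound
    [(cmod (z1 - z0) + r1) ^+ i], hence at most [r ^+ i]. *)
Lemma ps_disk_recenter f z0 r M z1 r1 : ps_disk f z0 r M -> 0 < r1 ->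
  cmod (z1 - z0) + r1 <= r -> ps_disk f z1 r1 M.
Proof.
move=> [a [r0 aM af]] r1_gt0 h.
apply: (@ps_disk_series (fun i z => a i * (z - z0) ^+ i) _ _ _
  (fun i => cmod (a i) * (cmod (z1 - z0) + r1) ^+ i)).
- by move=> i; apply: ps_disk_scale; apply: ps_disk_pow; exact: ps_disk_id.
- move=> N; apply: le_trans (aM N); apply: ler_sum => k _.
  by rewrite ler_wpM2l // ler_pow // addr_ge0 // ltW.
- move=> z zr; apply: af; apply: le_trans h.
  have -> : z - z0 = (z1 - z0) + (z - z1) by ring.
  by apply: le_trans (cmodD _ _) _; rewrite lerD2l.
Qed.

Lemma cvg_geometricC (q : C) : cmod q < 1 ->
  series (fun k => q ^+ k) @ \oo --> (1 - q)^-1.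
Proof.
move=> q1.
have q1' : 1 - q != 0.
  rewrite subr_eq0; apply/eqP => h; by rewrite -h cmod1 ltxx in q1.
have -> : series (fun k => q ^+ k) = (fun n => (1 - q ^+ n) / (1 - q)).
  apply/funext => n; rewrite /series /=; elim: n => [|n IH].
    by rewrite big_geq // expr0 subrr mul0r.
  by rewrite big_nat_recr //= IH exprS; field.
rewrite -[X in _ --> X]mul1r; apply: cvgC_mulr.
rewrite -[X in _ --> X]subr0; apply: cvgC_sub; first exact: cvgC_cst.
apply/cvgCP; under eq_fun do rewrite subr0 cmodX.
by apply: cvg_expr; rewrite ger0_norm.
Qed.

(** With [d = z0 - p], the inverse of [z - p = d + (z - z0)] is a geometric series in
    [- d^-1 * (z - z0)]. *)
Lemma ps_disk_inv p z0 r : 0 < r -> r < cmod (z0 - p) ->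
  ps_disk (fun z => (z - p)^-1) z0 r (cmod (z0 - p) - r)^-1.
Proof.
move=> r0 rp; set d := z0 - p.
have d0 : 0 < cmod d by apply: lt_trans rp.
have dn : d != 0 by rewrite -cmod_gt0.
apply: (@ps_disk_series (fun i z => d^-1 * (- d^-1 * (z - z0)) ^+ i) _ _ _
  (fun i => (cmod d)^-1 * (r / cmod d) ^+ i)).
- move=> i; rewrite -cmodV; apply: ps_disk_scale; apply: ps_disk_pow.
  rewrite mulrC -cmodN; apply: ps_disk_scale.
  by have := ps_disk_id z0 z0 r0; rewrite subrr cmod0 add0r.
- move=> N; rewrite -mulr_sumr; set q := r / cmod d.
  have q0 : 0 <= q by rewrite divr_ge0 // ltW.
  have q1 : q < 1 by rewrite ltr_pdivrMr // mul1r.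
  have -> : (cmod d - r)^-1 = (cmod d)^-1 * (1 - q)^-1.
    by rewrite /q; field; rewrite !gt_eqF //= subr_gt0.
  rewrite ler_wpM2l ?invr_ge0 //.
  have -> : \sum_(0 <= i < N) q ^+ i = (1 - q ^+ N) / (1 - q).
    elim: N => [|N IH]; first by rewrite big_geq // expr0 subrr mul0r.
    by rewrite big_nat_recr //= IH exprS; field; rewrite gt_eqF // subr_gt0.
  rewrite -[leRHS]mul1r ler_wpM2r ?invr_ge0 ?subr_ge0 ?(ltW q1) //.
  by rewrite lerBlDr lerDl exprn_ge0.
- move=> z zr; rewrite /series /=; under eq_fun do rewrite -mulr_sumr.
  have zd : d + (z - z0) = z - p by rewrite /d; ring.
  have lt1 : cmod (- d^-1 * (z - z0)) < 1.
    rewrite cmodM cmodN cmodV mulrC ltr_pdivrMr // mul1r; exact: le_lt_trans rp.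
  have zp0 : z - p != 0.
    rewrite -zd -cmod_gt0; have := cmod_leB d (- (z - z0)).
    rewrite opprK cmodN => h; apply: lt_le_trans h; rewrite subr_gt0.
    exact: le_lt_trans rp.
  have -> : (z - p)^-1 = d^-1 * (1 - (- d^-1 * (z - z0)))^-1.
    rewrite -invfM; congr (_^-1); rewrite -zd; field; exact: dn.
  by apply: cvgC_mull; [exact: cvg_geometricC].
Qed.

End PowerSeries.

(** * The complex exponential and sine *)

Section Exponential.
Variable R : realType.
Local Notation C := (cplx R).
Implicit Types (z w : C).

Lemma fact_neq0 (K : numDomainType) n : (n`!)%:R != 0 :> K.
Proof. by rewrite pnatr_eq0 -lt0n fact_gt0. Qed.

Lemma exp_coeff_bound (x : R) N : 0 <= x -> \sum_(0 <= k < N) x ^+ k / k`!%:R <= expR x.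
Proof.
move=> x0.
have nd : {homo series (exp_coeff x) : n m / (n <= m)%N >-> n <= m}.
  apply/nondecreasing_seqP => n; rewrite /series /= big_nat_recr //= lerDl.
  by rewrite /exp_coeff /= divr_ge0 // exprn_ge0.
exact: (nondecreasing_cvgn_le nd (is_cvg_series_exp_coeff x)).
Qed.

Lemma cexp_cvg z : series (fun n => z ^+ n / n`!%:R) @ \oo --> cexp z.
Proof.
have [N|l h _] := @csum_bound_cvg _ (fun n => z ^+ n / n`!%:R) (expR (cmod z)).
  apply: le_trans (exp_coeff_bound N (cmod_ge0 z)).
  by apply: ler_sum => k _; rewrite cmodM cmodX cmodV cmod_nat.
by rewrite /cexp (limCE h).
Qed.

Lemma cexp0 : cexp 0 = 1 :> C.
Proof.
apply: limCE; rewrite -(cvg_shiftn 1).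
set v := (X in X @ _ --> _); have -> : v = (fun=> 1); last exact: cvgC_cst.
apply/funext => n; rewrite /v /series /= addn1 big_nat_recl //= expr0 divr1.
by rewrite big1 ?addr0 // => i _; rewrite exprS mul0r mul0r.
Qed.

(* Taylor expansion of the exponential at any point; the binomial theorem gives
   the expansion of each term of the exponential series. *)
Lemma ps_coef_cexp z0 (r : R) : 0 < r ->
  ps_coef (fun k => cexp z0 / k`!%:R) (@cexp R) z0 r (expR (cmod z0 + r)).
Proof.
move=> r0.
(* [a i k] is the coefficient of degree [k] in [z - z0] of the term of index [i] of the exponential
   series. *)
pose a i k : C := if (k <= i)%N then z0 ^+ (i - k) / ((i - k)`!%:R * k`!%:R) else 0.
have binE (K : numFieldType) (x y : K) i :
    (x + y) ^+ i / i`!%:R = \sum_(0 <= k < i.+1) x ^+ (i - k) / ((i - k)`!%:R * k`!%:R) * y ^+ k.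
  rewrite exprDn mulr_suml big_mkord; apply: eq_bigr => -[k ki] _ /=.
  rewrite -(bin_fact (ltnSE ki)) !natrM -mulr_natr; field.
  by rewrite !fact_neq0 pnatr_eq0 -lt0n bin_gt0 -ltnS ki.
have sub (K : nmodType) (F : nat -> K) i N : (forall k, (i < k)%N -> F k = 0) -> (i < N)%N ->
    \sum_(0 <= k < N) F k = \sum_(0 <= k < i.+1) F k.
  move=> F0 iN; rewrite (@big_cat_nat _ _ _ i.+1) //=.
  have -> : \sum_(i.+1 <= k < N) F k = 0; last by rewrite addr0.
  by rewrite big_nat_cond big1 // => k /andP[/andP[ik _] _]; exact: F0.
have aE i w : \sum_(0 <= k < i.+1) a i k * w ^+ k = (z0 + w) ^+ i / i`!%:R.
  rewrite binE; apply: eq_big_nat => k /andP[_ ki].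
  by rewrite /a -ltnS ki.
apply: (@ps_coef_series _ (fun i z => z ^+ i / i`!%:R) _ _ _
  (fun i => (cmod z0 + r) ^+ i / i`!%:R) _ a).
- move=> i; split=> // [N|z zr].
  + have -> : (cmod z0 + r) ^+ i / i`!%:R = \sum_(0 <= k < i.+1) cmod (a i k) * r ^+ k.
      rewrite binE; apply: eq_big_nat => k /andP[_ ki].
      by rewrite /a -ltnS ki cmodM cmodX cmodV cmodM !cmod_nat.
    have [iN|Ni] := ltnP i N.
      rewrite (sub _ _ i N) // => k ik; by rewrite /a leqNgt ik /= cmod0 mul0r.
    rewrite [leRHS](@big_cat_nat _ _ _ N) //= ?(leq_trans Ni) // lerDl.
    by apply: sumr_ge0 => k _; rewrite mulr_ge0 // exprn_ge0 // ltW.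
  + rewrite -(cvg_shiftn i.+1).
    set v := (X in X @ _ --> _); have -> : v = (fun=> z ^+ i / i`!%:R); last exact: cvgC_cst.
    apply/funext => n; rewrite /v /series /= (sub _ _ i) ?leq_addl //; last first.
      by move=> k ik; rewrite /a leqNgt ik /= mul0r.
    by rewrite aE addrC subrK.
- by move=> N; apply: exp_coeff_bound; rewrite addr_ge0 // ltW.
- by move=> z _; exact: cexp_cvg.
(* Column [k] starts at row [k]; from there on it is the exponential series of [z0] divided by the
   factorial of [k]. *)
- move=> k; rewrite -(cvg_shiftn k) /=.
  have -> : (fun n => series (a^~ k) (n + k)%N) =
     (fun n => series (fun j => z0 ^+ j / j`!%:R) n / k`!%:R).
    apply/funext => n; rewrite /series /= (@big_cat_nat _ _ _ k) //= ?leq_addl //.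
    have -> : \sum_(0 <= j < k) a j k = 0.
      by rewrite big_nat_cond big1 // => j /andP[/andP[_ jk] _]; rewrite /a leqNgt jk.
    rewrite add0r.
    rewrite -{1}[k]add0n big_addn addnK mulr_suml; apply: eq_bigr => j _.
    by rewrite /a leq_addl addnK invfM mulrA.
  by apply: cvgC_mulr; exact: cexp_cvg.
Qed.

(** The Taylor series at [z], taken at the point [z + w], is [cexp z] times the exponential series
    of [w]. *)
Lemma cexpD z w : cexp (z + w) = cexp z * cexp w.
Proof.
have r0 : 0 < cmod w + 1 by rewrite ltr_wpDl.
have [_ _ /(_ (z + w))] := ps_coef_cexp z r0.
rewrite [z + w - z]addrAC subrr add0r lerDl ler01 => /(_ isT) h.
apply: limC_unique h _.
have -> : series (fun k => cexp z / k`!%:R * w ^+ k) =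
    (fun n => cexp z * series (fun k => w ^+ k / k`!%:R) n).
  apply/funext => n; rewrite /series /= mulr_sumr; apply: eq_bigr => k _.
  by rewrite mulrAC mulrA.
by apply: cvgC_mull; exact: cexp_cvg.
Qed.

Lemma cexp_ofReal (x : R) : cexp (ofReal x) = ofReal (expR x).
Proof.
apply: limCE.
have -> : series (fun n => ofReal x ^+ n / n`!%:R) = (fun n => ofReal (series (exp_coeff x) n)).
  apply/funext => n; rewrite /series /= ofReal_sum.
  by apply: eq_bigr => k _; rewrite ofRealM ofRealV ofRealX ofReal_nat.
exact: cvgC_ofReal (is_cvg_series_exp_coeff x).
Qed.

Definition ci : C := Complex 0 1.

Lemma ci2 : ci * ci = -1.
Proof. by apply: cplxP; rewrite ?(cReM, cImM, cReN, cImN) /=; ring. Qed.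

Lemma ciX n : ci ^+ n = if odd n then (-1) ^+ n./2 * ci else (-1) ^+ n./2.
Proof.
elim: n => [|n IH]; first by rewrite /= expr0.
rewrite exprS IH /= uphalf_half; case: (odd n) => /=; rewrite ?addn0 //.
- by rewrite add1n exprS mulrCA ci2 mulrC.
- by rewrite mulrC.
Qed.

Lemma cexp_ci (y : R) : cexp (ofReal y * ci) = Complex (cos y) (sin y).
Proof.
have sgnE n : (-1) ^+ n = ofReal ((-1) ^+ n) :> C by rewrite ofRealX ofRealN ofReal1.
have termE n : (ofReal y * ci) ^+ n / n`!%:R = Complex (cos_coeff y n) (sin_coeff y n) :> C.
  rewrite exprMn ciX sgnE -!ofRealX -[n`!%:R]ofReal_nat -ofRealV /cos_coeff /sin_coeff /=.
  have oddE : odd n -> n./2 = n.-1./2.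
    by case: n => // n /= no; rewrite uphalf_half (negbTE no).
  case: (boolP (odd n)) oddE => no oddE /=.
  - rewrite -oddE // mulrA -!ofRealM.
    by apply: cplxP; rewrite ?(cReM, cImM) /=; rewrite -?exprnP; ring.
  - by apply: cplxP; rewrite ?(cReM, cImM) /=; rewrite -?exprnP; ring.
apply: limCE; apply: cvgC_ReIm.
- have -> : (fun n => cRe (series (fun n => (ofReal y * ci) ^+ n / n`!%:R) n)) =
      series (cos_coeff y).
    apply/funext => n; rewrite /series /= cRe_sum.
    by apply: eq_bigr => k _; rewrite termE.
  by rewrite /= unlock; exact: is_cvg_series_cos_coeff.
- have -> : (fun n => cIm (series (fun n => (ofReal y * ci) ^+ n / n`!%:R) n)) =
      series (sin_coeff y).
    apply/funext => n; rewrite /series /= cIm_sum.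
    by apply: eq_bigr => k _; rewrite termE.
  by rewrite /= unlock; exact: is_cvg_series_sin_coeff.
Qed.

Lemma cexpE z : cexp z = ofReal (expR (cRe z)) * Complex (cos (cIm z)) (sin (cIm z)).
Proof. by rewrite {1}(cplxE z) cexpD cexp_ofReal cexp_ci. Qed.

Lemma cRe_cexp z : cRe (cexp z) = expR (cRe z) * cos (cIm z).
Proof. by rewrite cexpE cReM /= mul0r subr0. Qed.
Lemma cIm_cexp z : cIm (cexp z) = expR (cRe z) * sin (cIm z).
Proof. by rewrite cexpE cImM /= mul0r addr0. Qed.

Lemma cmod_cexp z : cmod (cexp z) = expR (cRe z).
Proof.
rewrite cexpE cmodM cmod_ofReal ger0_norm ?expR_ge0 // cmodE /= cos2Dsin2 sqrtr1.
by rewrite mulr1.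
Qed.

(** In the difference of the two exponential series the terms of even index cancel, so its partial
    sums of even length [n.*2] are the partial sums of the sine series. *)
Lemma csinE z : csin z = (cexp (z * ci) - cexp (- z * ci)) / (2 * ci).
Proof.
have i0 : ci != 0 by rewrite -cmod_gt0 cmodE /= expr0n add0r expr1n sqrtr1.
apply: limCE.
pose u k := ((z * ci) ^+ k / k`!%:R - (- z * ci) ^+ k / k`!%:R) / (2 * ci).
have h : series u @ \oo --> (cexp (z * ci) - cexp (- z * ci)) / (2 * ci).
  have -> : series u = (fun n => (series (fun k => (z * ci) ^+ k / k`!%:R) n
      - series (fun k => (- z * ci) ^+ k / k`!%:R) n) / (2 * ci)).
    by apply/funext => n; rewrite /series /= -sumrB mulr_suml.
  by apply: cvgC_mulr; apply: cvgC_sub; exact: cexp_cvg.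
have odd_u n : u n.*2.+1 = (-1) ^+ n * z ^+ n.*2.+1 / (n.*2.+1)`!%:R.
  have s1 : (-1) ^+ n.*2.+1 = -1 :> C by rewrite -signr_odd /= odd_double expr1.
  rewrite /u !exprMn ciX [(- z) ^+ _]exprNn s1 /= odd_double /= uphalf_double.
  by field; rewrite i0 fact_neq0.
have even_u n : u n.*2 = 0.
  have s1 : (-1) ^+ n.*2 = 1 :> C by rewrite -signr_odd odd_double expr0.
  by rewrite /u !exprMn [(- z) ^+ _]exprNn s1 mul1r subrr mul0r.
have serE n : series u n.*2 = series (fun n : nat => (-1) ^+ n * z ^+ n.*2.+1 / (n.*2.+1)`!%:R) n.
  rewrite /series /=; elim: n => [|n IH]; first by rewrite !big_geq.
  by rewrite doubleS !big_nat_recr //= IH even_u odd_u addr0.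
rewrite -(eq_cvg _ _ serE).
apply: cvg_comp h.
by apply/cvgnyPge => A; exists A => // n /= An; rewrite -addnn (leq_trans An) // leq_addl.
Qed.

Lemma csin_ofReal (x : R) : csin (ofReal x) = ofReal (sin x).
Proof.
rewrite csinE -ofRealN !cexp_ci sinN cosN.
apply: cplxP; rewrite ?(cReM, cImM, cReB, cImB, cReD, cImD) /=; by field.
Qed.

End Exponential.

(** * Analytic functions, isolated zeros and the identity theorem *)

Section Analytic.
Variable R : realType.
Local Notation C := (cplx R).
Implicit Types (z w p q : C) (f g h : C -> C) (r M : R).

(** The Taylor remainder of order [m], divided by [(z - z0) ^+ m], is again a disk of the same
    radius. This is what divides out a zero and what gives the orders of vanishing below. *)
Lemma ps_coef_tail a f z0 r M m : ps_coef a f z0 r M -> exists g,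
  ps_coef (fun n => a (m + n)%N) g z0 r (M / r ^+ m) /\
  forall z, cmod (z - z0) <= r ->
    f z = \sum_(0 <= k < m) a k * (z - z0) ^+ k + (z - z0) ^+ m * g z.
Proof.
move=> [r0 aM af].
have rm0 : 0 < r ^+ m by rewrite exprn_gt0.
have bM N : \sum_(0 <= k < N) cmod (a (m + k)%N) * r ^+ k <= M / r ^+ m.
  rewrite ler_pdivlMr // mulr_suml; apply: le_trans (aM (N + m)%N).
  rewrite [leRHS](@big_cat_nat _ _ _ m) ?leq_addl //=.
  have -> : \sum_(m <= i < N + m) cmod (a i) * r ^+ i =
      \sum_(0 <= i < N) cmod (a (m + i)%N) * r ^+ i * r ^+ m.
    rewrite -{1}[m]add0n big_addn addnK; apply: eq_bigr => i _.
    by rewrite -mulrA -exprD addnC.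
  rewrite lerDr; apply: sumr_ge0 => i _; rewrite mulr_ge0 //.
  by rewrite exprn_ge0 // ltW.
have /choice[g gP] : forall z, exists l : C, cmod (z - z0) <= r ->
    series (fun k => a (m + k)%N * (z - z0) ^+ k) @ \oo --> l.
  move=> z; have [zr|zr] := lerP (cmod (z - z0)) r; last by exists 0.
  have [N|l hl _] := @csum_bound_cvg _ (fun k => a (m + k)%N * (z - z0) ^+ k) (M / r ^+ m).
    apply: le_trans (bM N); apply: ler_sum => k _.
    by rewrite cmodM cmodX ler_wpM2l // ler_pow.
  by exists l => _; exact: hl.
exists g; split; first by split => [//||z zr]; [exact: bM | exact: gP].
move=> z zr; apply: limC_unique (af z zr) _.
rewrite -(cvg_shiftn m).
set v := (X in X @ _ --> _).
have -> : v = fun n => \sum_(0 <= k < m) a k * (z - z0) ^+ k +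
    (z - z0) ^+ m * series (fun k => a (m + k)%N * (z - z0) ^+ k) n.
  apply/funext => n; rewrite /v /series /= (@big_cat_nat _ _ _ m) ?leq_addl //=.
  congr (_ + _); rewrite -{1}[m]add0n big_addn addnK mulr_sumr.
  by apply: eq_bigr => k _; rewrite mulrCA -exprD addnC.
by apply: cvgC_add; [exact: cvgC_cst | apply: cvgC_mull; exact: gP].
Qed.

(** Convergence at the single point [z0 + d / 2] makes the terms [cmod (a n) * (d / 2) ^+ n] bounded
    by some [B]. At half that radius, [d / 4], they are dominated by a geometric series of ratio
    1/2, whose sum is at most [2 * B]. *)
Lemma analytic_atP f z0 : analytic_at f z0 <-> exists r M, ps_disk f z0 r M.
Proof.
split; last first.
  move=> [r [M [a [r0 aM af]]]]; exists a; apply/nearC; exists r => // z zr.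
  by apply: af; exact: ltW.
move=> [a /nearC [d d0 af]].
have d2 : 0 < d / 2 by rewrite divr_gt0.
pose z1 := z0 + ofReal (d / 2).
have z1E : z1 - z0 = ofReal (d / 2) by rewrite /z1 addrAC subrr add0r.
have h1 : series (fun n => a n * (z1 - z0) ^+ n) @ \oo --> f z1.
  by apply: af; rewrite z1E cmod_ofReal ger0_norm ?(ltW d2) // ltr_pdivrMr // mulr_natr mulr2n ltrDl.
have h2 : (fun n => a n * ofReal (d / 2) ^+ n) @ \oo --> (0 : C).
  have e : (fun n => a n * ofReal (d / 2) ^+ n) =
      (fun n => series (fun n => a n * (z1 - z0) ^+ n) (n + 1)%N -
        series (fun n => a n * (z1 - z0) ^+ n) n).
    apply/funext => n; rewrite addn1 /series /= big_nat_recr //= z1E.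
    by rewrite addrAC subrr add0r.
  rewrite e -[X in _ --> X](subrr (f z1)); apply: cvgC_sub => //.
  by rewrite (cvg_shiftn 1 (series (fun n => a n * (z1 - z0) ^+ n))).
have [B B0 hB] : exists2 B, 0 < B & forall n, cmod (a n) * (d / 2) ^+ n <= B.
  have /cvgCP/cvgrPdist_lt /(_ _ ltr01) [N _ hN] := h2.
  exists (1 + \sum_(0 <= k < N) cmod (a k) * (d / 2) ^+ k).
    rewrite ltr_pwDl // sumr_ge0 // => i _; rewrite mulr_ge0 //.
    by rewrite exprn_ge0 // ltW.
  move=> n; have [nN|Nn] := ltnP n N.
    have pos i : 0 <= cmod (a i) * (d / 2) ^+ i.
      by rewrite mulr_ge0 // exprn_ge0 // ltW.
    apply: ler_wpDl => //; rewrite (bigD1_seq n) ?iota_uniq ?mem_index_iota //=.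
    by rewrite lerDl sumr_ge0.
  have /= := hN n Nn; rewrite sub0r normrN (ger0_norm (cmod_ge0 _)) subr0.
  rewrite cmodM cmodX cmod_ofReal (ger0_norm (ltW d2)) => /ltW h.
  apply: le_trans h _; rewrite lerDl sumr_ge0 // => i _; rewrite mulr_ge0 //.
  by rewrite exprn_ge0 // ltW.
exists (d / 4), (B * 2), a; split.
- by rewrite divr_gt0.
- move=> N; apply: (@le_trans _ _ (\sum_(0 <= k < N) B * 2^-1 ^+ k)).
    apply: ler_sum => k _.
    have -> : d / 4 = (d / 2) * 2^-1 by field.
    rewrite exprMn mulrA ler_wpM2r // exprn_ge0 //.
  rewrite -mulr_sumr ler_wpM2l ?(ltW B0) //.
  have -> : \sum_(0 <= i < N) 2^-1 ^+ i = 2 - 2 * 2^-1 ^+ N :> R.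
    elim: N => [|N IH]; first by rewrite big_geq // expr0 mulr1 subrr.
    by rewrite big_nat_recr //= IH exprS; field.
  by rewrite lerBlDr lerDl mulr_ge0 // exprn_ge0.
- move=> z zr; apply: af; apply: le_lt_trans zr _.
  by rewrite ltr_pdivrMr // ltr_pMr // ltr1n.
Qed.

Lemma ps_disk_analytic f z0 r M : ps_disk f z0 r M -> analytic_at f z0.
Proof. by move=> h; apply/analytic_atP; exists r, M. Qed.

Lemma ps_disk_analytic_in f z0 r M z : ps_disk f z0 r M -> cmod (z - z0) < r ->
  analytic_at f z.
Proof.
move=> h zr; apply: (@ps_disk_analytic _ _ (r - cmod (z - z0)) M).
by apply: ps_disk_recenter h _ _; rewrite ?subr_gt0 // addrC subrK.
Qed.

Lemma analytic_near f g z0 : (\forall z \near z0, f z = g z) ->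
  analytic_at f z0 -> analytic_at g z0.
Proof.
move=> fg [a ha]; exists a; apply: filterS2 fg ha => z e; rewrite e; exact: id.
Qed.

Lemma analytic_ext f g z0 : (forall z, f z = g z) -> analytic_at f z0 -> analytic_at g z0.
Proof. by move=> fg; apply: analytic_near; apply/nearC; exists 1 => // z _; exact: fg. Qed.

Lemma analytic_cst c z0 : analytic_at (fun=> c) z0.
Proof. by apply: ps_disk_analytic; exact: (ps_disk_cst c z0 ltr01). Qed.

Lemma ps_disk_common f g z0 : analytic_at f z0 -> analytic_at g z0 ->
  exists r M M', ps_disk f z0 r M /\ ps_disk g z0 r M'.
Proof.
move=> /analytic_atP [r [M h]] /analytic_atP [r' [M' h']].
have r0 : 0 < r by case: h => ? [].
have r0' : 0 < r' by case: h' => ? [].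
exists (Num.min r r'), M, M'; split.
- by apply: ps_disk_le h; rewrite ?lt_min ?r0 ?r0' // ge_min lexx.
- by apply: ps_disk_le h'; rewrite ?lt_min ?r0 ?r0' // ge_min lexx orbT.
Qed.

Lemma analytic_add f g z0 : analytic_at f z0 -> analytic_at g z0 ->
  analytic_at (fun z => f z + g z) z0.
Proof.
move=> /ps_disk_common hf /hf [r [M [M' [h h']]]].
exact: ps_disk_analytic (ps_disk_add h h').
Qed.

Lemma analytic_mul f g z0 : analytic_at f z0 -> analytic_at g z0 ->
  analytic_at (fun z => f z * g z) z0.
Proof.
move=> /ps_disk_common hf /hf [r [M [M' [h h']]]].
exact: ps_disk_analytic (ps_disk_mul h h').
Qed.

Lemma analytic_sub f g z0 : analytic_at f z0 -> analytic_at g z0 ->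
  analytic_at (fun z => f z - g z) z0.
Proof.
move=> hf hg; apply: (@analytic_ext (fun z => f z + (-1) * g z)).
  by move=> z; rewrite mulN1r.
apply: analytic_add; first exact: hf.
by apply: analytic_mul; [exact: analytic_cst | exact: hg].
Qed.

Lemma analytic_id z0 : analytic_at id z0.
Proof.
apply: (@analytic_ext (fun z => z - 0)); first by move=> z; rewrite subr0.
by apply: ps_disk_analytic; exact: ps_disk_id ltr01.
Qed.

Lemma analytic_inv p z0 : z0 != p -> analytic_at (fun z => (z - p)^-1) z0.
Proof.
move=> zp; have d0 : 0 < cmod (z0 - p) by rewrite cmod_gt0 subr_eq0.
apply: (@ps_disk_analytic _ _ (cmod (z0 - p) / 2)); apply: ps_disk_inv.
- by rewrite divr_gt0.
- by rewrite ltr_pdivrMr // ltr_pMr // ltr1n.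
Qed.

Lemma analytic_affine f c d z0 : analytic_at f (c * z0 + d) ->
  analytic_at (fun z => f (c * z + d)) z0.
Proof.
move=> [a /nearC [e e0 ha]]; exists (fun n => a n * c ^+ n).
(* The added 1 keeps the denominator positive when [c = 0]. *)
apply/nearC; exists (e / (cmod c + 1)); first by rewrite divr_gt0 // ltr_wpDl.
move=> z; rewrite ltr_pdivlMr ?ltr_wpDl // => zr.
have -> : (fun n => a n * c ^+ n * (z - z0) ^+ n) =
    (fun n => a n * (c * z + d - (c * z0 + d)) ^+ n).
  apply/funext => n; rewrite -mulrA -exprMn; congr (_ * _ ^+ _); ring.
apply: ha; have -> : c * z + d - (c * z0 + d) = (z - z0) * c by ring.
by apply: le_lt_trans zr; rewrite cmodM ler_wpM2l // lerDl.
Qed.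

Lemma analytic_cexp z0 : analytic_at (@cexp R) z0.
Proof.
have h := ps_coef_cexp z0 (ltr01 : 0 < (1 : R)).
by apply: ps_disk_analytic; exists (fun k => cexp z0 / k`!%:R); exact: h.
Qed.

Lemma analytic_csin z0 : analytic_at (@csin R) z0.
Proof.
apply: (@analytic_ext (fun z => (cexp (ci R * z + 0) - cexp (- ci R * z + 0)) * (2 * ci R)^-1)).
  by move=> z; rewrite csinE !addr0 !mulNr ![ci R * z]mulrC.
apply: analytic_mul; last exact: analytic_cst.
by apply: analytic_sub; apply: analytic_affine; exact: analytic_cexp.
Qed.

Lemma analytic_cpow (x : R) z0 : analytic_at (cpow x) z0.
Proof.
apply: (@analytic_ext (fun z => cexp (ofReal (ln x) * z + 0))).
  by move=> z; rewrite /cpow addr0 mulrC.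
by apply: analytic_affine; exact: analytic_cexp.
Qed.

Lemma analytic_factor f z0 : analytic_at f z0 -> exists g, analytic_at g z0 /\
  \forall z \near z0, f z = f z0 + (z - z0) * g z.
Proof.
move=> /analytic_atP [r [M [a af]]].
have r0 : 0 < r by case: af.
have [g [hg fg]] := ps_coef_tail 1 af.
exists g; split.
  by apply: ps_disk_analytic; exists (fun n => a (1 + n)%N); exact: hg.
have fz0 : f z0 = a 0%N.
  rewrite fg ?subrr ?cmod0 ?(ltW r0) //.
  by rewrite big_nat1 expr1 mul0r addr0 expr0 mulr1.
apply/nearC; exists r => // z /ltW zr.
by rewrite fg // big_nat1 expr1 expr0 mulr1 fz0.
Qed.

Lemma cvgC_nbhsP f z0 l : (forall e : R, 0 < e -> exists2 d : R, 0 < d &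
    forall z, cmod (z - z0) < d -> cmod (f z - l) < e) -> f z @[z --> z0] --> l.
Proof.
move=> H; have F0 : Filter (nbhs z0) by exact: nbhs_filter.
apply: (proj2 (@cvgCP _ _ _ F0 _ _)); apply/cvgrPdist_lt => e /H/nearC.
by apply: filterS => z; rewrite sub0r normrN (ger0_norm (cmod_ge0 _)).
Qed.

Lemma analytic_continuous f z0 : analytic_at f z0 -> f z @[z --> z0] --> f z0.
Proof.
move=> /analytic_factor [g [/analytic_atP[r [M hg]] fg]].
have r0 : 0 < r by case: hg => ? [].
have M0 : 0 <= M.
  by apply: le_trans (ps_disk_bound hg (_ : cmod (z0 - z0) <= r)); rewrite // subrr cmod0 ltW.
have M1 : 0 < M + 1 by rewrite ltr_wpDl.
have [d d0 hd] := (nearC _ _).1 fg.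
apply: cvgC_nbhsP => e e0.
exists (Num.min d (Num.min r (e / (M + 1)))); first by rewrite !lt_min d0 r0 divr_gt0.
move=> z; rewrite !lt_min => /andP[zd /andP[zr ze]].
rewrite hd // addrAC subrr add0r cmodM.
apply: le_lt_trans (_ : cmod (z - z0) * (M + 1) < e); last by rewrite -ltr_pdivlMr.
by rewrite ler_wpM2l // (le_trans (ps_disk_bound hg (ltW zr))) // lerDl.
Qed.

(** If [m] is the index of the first nonzero coefficient, then [h z = (z - z0) ^+ m * (a m + (z -
    z0) * g z)] with [g] bounded, and the second factor cannot vanish when [z - z0] is small
    compared with [a m]. *)
Lemma analytic_dichotomy h z0 : analytic_at h z0 ->
  (\forall z \near z0, h z = 0) \/ (\forall z \near z0, z != z0 -> h z != 0).
Proof.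
move=> /analytic_atP [r [M [a ah]]].
have r0 : 0 < r by case: ah.
have [a0|] := pselect (forall k, a k = 0).
  left; apply/nearC; exists r => // z /ltW zr.
  have [_ _ /(_ z zr)] := ah; have -> : (fun k => a k * (z - z0) ^+ k) = (fun=> 0).
    by apply/funext => k; rewrite a0 mul0r.
  move/limC_unique; apply; have -> : series (fun=> 0) = (fun=> 0) :> (nat -> C).
    by apply/funext => n; rewrite /series /= big1.
  exact: cvgC_cst.
move/existsNP => [k0 /eqP k0P]; right.
have exk : exists k, a k != 0 by exists k0.
pose m := ex_minn exk.
have am : a m != 0 by rewrite /m; case: ex_minnP.
have lt_m k : (k < m)%N -> a k = 0.
  rewrite /m; case: ex_minnP => n _ hn kn; apply/eqP; apply: contraTT kn => /hn.
  by rewrite -leqNgt.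
have [g [hg hE]] := ps_coef_tail m.+1 ah.
have hgd : ps_disk g z0 r (M / r ^+ m.+1) by exists (fun n => a (m.+1 + n)%N).
set B := M / r ^+ m.+1 in hgd.
have B0 : 0 <= B.
  by apply: le_trans (ps_disk_bound hgd (_ : cmod (z0 - z0) <= r)); rewrite // subrr cmod0 ltW.
have B1 : 0 < B + 1 by rewrite ltr_wpDl.
have am0 : 0 < cmod (a m) by rewrite cmod_gt0.
apply/nearC; exists (Num.min r (cmod (a m) / (B + 1))).
  by rewrite lt_min r0 divr_gt0.
move=> z; rewrite lt_min => /andP[/ltW zr zB] zz0.
rewrite (hE z zr) big_nat_recr //= big_nat_cond big1 ?add0r; last first.
  by move=> k /andP[/andP[_ km] _]; rewrite lt_m // mul0r.
have -> : a m * (z - z0) ^+ m + (z - z0) ^+ m.+1 * g z =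
    (z - z0) ^+ m * (a m + (z - z0) * g z) by rewrite exprSr; ring.
rewrite mulf_eq0 expf_eq0 negb_or subr_eq0 (negbTE zz0) andbF /=.
rewrite addr_eq0; apply/eqP => e.
move: zB; rewrite ltr_pdivlMr // e cmodN cmodM => zB.
have := ps_disk_bound hgd zr => gB.
have : cmod (z - z0) * cmod (g z) <= cmod (z - z0) * (B + 1).
  by rewrite ler_wpM2l // (le_trans gB) // lerDl.
by rewrite leNgt zB.
Qed.

(** The zeros of [f - g] on the real line accumulate at [ofReal x], which excludes an isolated
    zero. *)
Lemma analytic_real_ident f g (x d : R) : 0 < d ->
  analytic_at f (ofReal x) -> analytic_at g (ofReal x) ->
  (forall y, `|y - x| < d -> f (ofReal y) = g (ofReal y)) ->
  \forall z \near ofReal x, f z = g z.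
Proof.
move=> d0 hf hg fg.
have [|/nearC [e e0 he]] := analytic_dichotomy (analytic_sub hf hg).
  by apply: filterS => z /eqP; rewrite subr_eq0 => /eqP.
pose t := Num.min d e / 2.
have t0 : 0 < t by rewrite divr_gt0 // lt_min d0.
have tde : t < Num.min d e by rewrite /t ltr_pdivrMr // ltr_pMr ?ltr1n // lt_min d0.
move: tde; rewrite lt_min => /andP[td te].
have hh : x + t - x = t by rewrite addrAC subrr add0r.
have := he (ofReal (x + t)).
rewrite -ofRealB hh cmod_ofReal (ger0_norm (ltW t0)) => /(_ te).
have -> : ofReal (x + t) != ofReal x :> C.
  by rewrite (inj_eq (@ofReal_inj R)) addrC -subr_eq0 addrK gt_eqF.
by move/(_ isT); rewrite fg ?subrr ?eqxx // hh ger0_norm // ltW.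
Qed.

Definition seg p q (t : R) : C := p + ofReal t * (q - p).

(** Connectedness of the segment, by a supremum. [S] holds the parameters up to which [f] and [g]
    agree locally. At [T = sup S], zeros of [f - g] accumulate from the left, so by
    [analytic_dichotomy] they agree near that point as well, and [S] would extend beyond any
    [T < 1]. *)
Lemma analytic_segment_ident f g p q :
  (forall t, 0 <= t <= 1 -> analytic_at f (seg p q t) /\ analytic_at g (seg p q t)) ->
  (\forall z \near p, f z = g z) -> \forall z \near q, f z = g z.
Proof.
move=> fg_an fg_p.
have [<-//|pq] := eqVneq p q.
pose L := cmod (q - p).
have L0 : 0 < L by rewrite cmod_gt0 subr_eq0 eq_sym.
pose Z t := \forall z \near seg p q t, f z = g z.
have segB s t : cmod (seg p q s - seg p q t) = `|s - t| * L.
  have -> : seg p q s - seg p q t = ofReal (s - t) * (q - p).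
    by rewrite /seg ofRealB; ring.
  by rewrite cmodM cmod_ofReal.
pose S := [set t : R | 0 <= t <= 1 /\ forall s, 0 <= s <= t -> Z s].
have S0 : S 0.
  split=> [|s /andP[s0 s0']]; first by rewrite lexx ler01.
  have -> : s = 0 by apply/eqP; rewrite eq_le s0 s0'.
  by rewrite /Z /seg ofReal0 mul0r addr0.
have supS : has_sup S by split; [exists 0 | exists 1 => t [/andP[]]].
pose T := sup S.
have T0 : 0 <= T by apply: sup_upper_bound.
have T1 : T <= 1 by apply: ge_sup; [exists 0 | move=> t [/andP[]]].
have [an_f an_g] := fg_an T (introT andP (conj T0 T1)).
have dich := analytic_dichotomy (analytic_sub an_f an_g).
have ZT : Z T.
  case: dich => [|/nearC [d d0 hd]].
    by apply: filterS => z /eqP; rewrite subr_eq0 => /eqP.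
  have [s [/andP[s0 s1] Ss] sT] := sup_adherent (divr_gt0 d0 L0) supS.
  have sleT : s <= T by apply: sup_upper_bound => //; split; [rewrite s0|].
  have Zs : Z s by apply: Ss; rewrite s0 lexx.
  have [<-//|sneT] := eqVneq s T.
  exfalso; have /nearC [e e0 he] := Zs.
  have /hd : cmod (seg p q s - seg p q T) < d.
    rewrite segB -ltr_pdivlMr // distrC ger0_norm ?subr_ge0 //.
    by rewrite ltrBlDr addrC -ltrBlDr.
  have ne : seg p q s != seg p q T.
    by rewrite -subr_eq0 -cmod_eq0 segB mulf_eq0 (gt_eqF L0) orbF normr_eq0 subr_eq0.
  by move=> /(_ ne); rewrite he ?subrr ?eqxx // cmod0.
have /nearC [d d0 hd] := ZT.
have Znear s : `|s - T| * L < d -> Z s.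
  rewrite -segB => hs; apply/nearC.
  exists (d - cmod (seg p q s - seg p q T)); first by rewrite subr_gt0.
  move=> z; rewrite ltrBrDr => hz; apply: hd.
  have -> : z - seg p q T = (z - seg p q s) + (seg p q s - seg p q T) by ring.
  exact: le_lt_trans (cmodD _ _) hz.
(* A parameter step of [d / (2 * L)] moves the point by [d / 2], which stays in the disk of radius
   [d] where [f] and [g] agree. *)
pose T' := Num.min 1 (T + d / (2 * L)).
have dL : 0 < d / (2 * L) by rewrite divr_gt0 // mulr_gt0.
have ST' : S T'.
  split=> [|s /andP[s0]].
    rewrite ge_min lexx le_min ler01 /= andbT; apply: ltW; exact: ltr_wpDl.
  rewrite le_min => /andP[s1 sT'].
  have [sT|Ts] := ltrP s T; last first.
    apply: Znear; rewrite ger0_norm ?subr_ge0 //.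
    apply: le_lt_trans (_ : d / (2 * L) * L < d).
      by rewrite ler_wpM2r ?(ltW L0) // lerBlDr addrC.
    by rewrite invfM mulrA mulfVK ?gt_eqF // ltr_pdivrMr // ltr_pMr // ltr1n.
  have [u [_ Su] su] : exists2 u, S u & s < u.
    have eps : 0 < T - s by rewrite subr_gt0.
    have [u Su] := sup_adherent eps supS; rewrite -/T subKr => su; by exists u.
  by apply: Su; rewrite s0 ltW.
have T'T : T' <= T by apply: sup_upper_bound.
have le1T : 1 <= T.
  have [//|T1'] := lerP 1 T.
  have : T < T' by rewrite /T' lt_min T1' ltrDl dL.
  by move/lt_le_trans => /(_ _ T'T); rewrite ltxx.
have TE : T = 1 by apply/eqP; rewrite eq_le T1.
by move: ZT; rewrite /Z TE /seg ofReal1 mul1r addrC subrK.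
Qed.

Lemma nearP_eq f g q : (\forall z \near q, f z = g z) -> f q = g q.
Proof. by move=> /nbhs_singleton. Qed.

(** The path goes vertically from [x] to height 1 or -1, on the side of [q], and then straight to
    [q]. Apart from [x] and possibly [q] it avoids the real axis, and so all the points that [D] may
    omit. *)
Lemma analytic_nonreal_ident (D : set C) f g (x : R) :
  (forall z, cIm z != 0 -> D z) -> D (ofReal x) ->
  analytic_on D f -> analytic_on D g ->
  (\forall z \near ofReal x, f z = g z) -> forall q, D q -> \forall z \near q, f z = g z.
Proof.
move=> Dnr Dx hf hg fgx q Dq.
(* [e] is the sign of the half-plane containing [q]; for a real [q] either sign would do. On the
   second segment [e] times the imaginary part is [(1 - t) + t * (e * cIm q)], positive for
   [t < 1]. *)
wlog [e [ee eq]] : / exists e : R, `|e| = 1 /\ 0 <= e * cIm q.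
  move=> H; apply: H; have [q0|q0] := lerP 0 (cIm q).
    by exists 1; rewrite normr1 mul1r.
  by exists (-1); rewrite normrN normr1 mulN1r oppr_ge0 ltW.
have e0 : e != 0 by rewrite -normr_eq0 ee oner_eq0.
have e2 : e * e = 1 by rewrite -expr2 -real_normK ?num_real // ee expr1n.
pose p : C := Complex x e.
have fgp : \forall z \near p, f z = g z.
  apply: analytic_segment_ident fgx => t /andP[t0 t1].
  have Dt : D (seg (ofReal x) p t).
    have [->|tn] := eqVneq t 0; first by rewrite /seg ofReal0 mul0r addr0.
    apply: Dnr; rewrite /seg cImD cImM cImB /=.
    by rewrite mul0r addr0 subr0 add0r mulf_neq0.
  by split; [exact: hf | exact: hg].
apply: analytic_segment_ident fgp => t /andP[t0 t1].
have Dt : D (seg p q t).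
  have [->|tn] := eqVneq t 1; first by rewrite /seg ofReal1 mul1r addrC subrK.
  apply: Dnr; apply/eqP; rewrite /seg cImD cImM cImB /= mul0r addr0 => h.
  have : e * (e + t * (cIm q - e)) = (1 - t) * (e * e) + t * (e * cIm q) by ring.
  rewrite e2 mulr1.
  rewrite h mulr0 => h'.
  have t1' : 0 < 1 - t by rewrite subr_gt0 lt_neqAle tn.
  have := mulr_ge0 t0 eq; lra.
by split; [exact: hf | exact: hg].
Qed.

End Analytic.

(** * The cotangent and its partial fractions: poles, convergence and duplication *)

Section Herglotz.
Variable R : realType.
Local Notation C := (cplx R).
Implicit Types (t s : C) (Y : R).

Definition tpi : C := ofReal (2 * pi) * ci R.

Lemma tpiE : tpi = ofReal (2 * pi) * ci R.
Proof. by []. Qed.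

Lemma cRe_tpi : cRe tpi = 0.
Proof. by rewrite /tpi cReM /=; ring. Qed.
Lemma cIm_tpi : cIm tpi = 2 * pi.
Proof. by rewrite /tpi cImM /=; ring. Qed.

Lemma cexp_tpi : cexp tpi = 1.
Proof. by rewrite /tpi cexp_ci mulr_natl cos2pi sin2pi. Qed.

Lemma cexp_half_tpi : cexp (tpi / 2) = -1.
Proof.
have -> : tpi / 2 = ofReal pi * ci R.
  by apply: cplxP; rewrite /tpi ?(cReM, cImM) /= ; field.
by rewrite cexp_ci cospi sinpi; apply: cplxP; rewrite /= ?oppr0.
Qed.

(* With [t = 2 pi i z], [coth2 t] is [cot (pi z) / 2i] and [cothterm n t] pairs
   the poles at [z = n + 1] and [z = - (n + 1)]. *)
Definition coth2 t : C := 2^-1 + (cexp t - 1)^-1.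
Definition cothterm (n : nat) t : C :=
  (t + n.+1%:R * tpi)^-1 + (t - n.+1%:R * tpi)^-1.

Lemma coth2_add_tpi t : coth2 (t + tpi) = coth2 t.
Proof. by rewrite /coth2 cexpD cexp_tpi mulr1. Qed.

(** The two arguments have exponentials [u] and [- u], the square roots of [cexp t], and 1/(u - 1) -
    1/(u + 1) = 2/(u^2 - 1). *)
Lemma coth2_double t : cexp t != 1 -> coth2 (t / 2) + coth2 (t / 2 + tpi / 2) = 2 * coth2 t.
Proof.
move=> t1; rewrite /coth2 cexpD cexp_half_tpi mulrN1.
have -> : cexp t = cexp (t / 2) * cexp (t / 2) by rewrite -cexpD; congr cexp; field.
set u := cexp (t / 2) in t1 *.
have u2 : u * u - 1 = (u - 1) * (u + 1) by ring.
have : u * u - 1 != 0.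
  rewrite subr_eq0; have -> // : u * u = cexp t by rewrite -cexpD; congr cexp; field.
rewrite u2 mulf_eq0 negb_or => /andP[h1 h2].
have h3 : - u - 1 != 0 by rewrite -oppr_eq0 opprB opprK addrC.
by field; rewrite h1 h2 h3.
Qed.

(** Up to a factor 2, the poles on the left are the even multiples of [tpi] from [- 2N] to [2N] and
    the odd ones from [- (2N - 1)] to [2N + 1]. All pair up except the last, which is the extra term
    on the right. *)
Lemma cothterm_double N t :
  ((t / 2)^-1 + \sum_(0 <= n < N) cothterm n (t / 2)) +
  ((t / 2 + tpi / 2)^-1 + \sum_(0 <= n < N) cothterm n (t / 2 + tpi / 2)) =
  2 * (t^-1 + \sum_(0 <= n < N.*2) cothterm n t) + 2 * (t + N.*2.+1%:R * tpi)^-1.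
Proof.
have half (x y : C) : x = y / 2 -> x^-1 = 2 * y^-1.
  by move=> ->; rewrite invfM invrK mulrC.
elim: N => [|N IH].
  rewrite !big_geq // !addr0 (half (t / 2) t) //.
  rewrite (half (t / 2 + tpi / 2) (t + 1%:R * tpi)); last by field.
  by [].
rewrite doubleS !big_nat_recr //=.
set A := \sum_(_ <= _ < _) _ in IH *; set B := \sum_(_ <= _ < _) _ in IH *.
set D := \sum_(_ <= _ < _) _ in IH *.
rewrite /cothterm.
rewrite (half (t / 2 + N.+1%:R * tpi) (t + N.*2.+2%:R * tpi)); last first.
  by rewrite -addnn -addSn -addnS natrD; field.
rewrite (half (t / 2 - N.+1%:R * tpi) (t - N.*2.+2%:R * tpi)); last first.
  by rewrite -addnn -addSn -addnS natrD; field.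
rewrite (half (t / 2 + tpi / 2 + N.+1%:R * tpi) (t + N.*2.+3%:R * tpi)); last first.
  by rewrite -addnn -addSn -addnS -[(_ + _).+1%:R]natr1 natrD; field.
rewrite (half (t / 2 + tpi / 2 - N.+1%:R * tpi) (t - N.*2.+1%:R * tpi)); last first.
  by rewrite -addnn -[N.+1%:R]natr1 -[(_ + _).+1%:R]natr1 natrD; field.
transitivity ((t / 2)^-1 + A + ((t / 2 + tpi / 2)^-1 + B) +
  2 * (t + N.*2.+2%:R * tpi)^-1 + 2 * (t - N.*2.+2%:R * tpi)^-1 +
  2 * (t + N.*2.+3%:R * tpi)^-1 + 2 * (t - N.*2.+1%:R * tpi)^-1); first by ring.
by rewrite IH; ring.
Qed.

(** Over the common denominator [2 * t * (cexp t - 1)], of order two, the numerator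
    [t * (cexp t + 1) - 2 * (cexp t - 1)] vanishes to order three. *)
Lemma coth2_near0 : exists A d : R, [/\ 0 < A, 0 < d, d <= 1 &
  forall t, 0 < cmod t <= d -> cexp t != 1 /\ cmod (coth2 t - t^-1) <= A * cmod t].
Proof.
have ps := ps_coef_cexp (0 : C) (ltr01 : 0 < (1 : R)).
have [g1 [g1P g1E]] := ps_coef_tail 1 ps.
have [g3 [g3P g3E]] := ps_coef_tail 3 ps.
pose M : R := expR (cmod (0 : C) + 1).
have M1 : 1 <= M by rewrite /M cmod0 add0r; apply: le_trans (expR_ge1Dx 1); rewrite lerDr.
have g1b t : cmod t <= 1 -> cmod (g1 t) <= M.
  move=> t1; have : ps_disk g1 0 1 (M / 1 ^+ 1) by eexists; exact: g1P.
  by rewrite expr1n divr1 => /ps_disk_bound; apply; rewrite subr0.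
have g3b t : cmod t <= 1 -> cmod (g3 t) <= M.
  move=> t1; have : ps_disk g3 0 1 (M / 1 ^+ 3) by eexists; exact: g3P.
  by rewrite expr1n divr1 => /ps_disk_bound; apply; rewrite subr0.
have M2 : 2 <= 2 * M + 2 by lra.
(* On this radius the terms of order at least two in [cexp t - 1] have modulus at most half of that
   of [t], whence the lower bound [lowb]. *)
exists (8 * M), (2 * M + 2)^-1; split; [lra|by rewrite invr_gt0; lra| |].
  by rewrite invf_le1; lra.
move=> t /andP[t0 td].
have tn0 : t != 0 by rewrite -cmod_gt0.
have tM : cmod t * (2 * M + 2) <= 1.
  by rewrite -ler_pdivlMr ?div1r //; lra.
have t1 : cmod t <= 1 by nra.
have e3 := g3E t; rewrite !subr0 in e3; have {}e3 := e3 t1.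
rewrite !big_nat_recr //= big_geq // add0r cexp0 expr0 expr1 in e3.
have e3' : cexp t = 1 + t + t ^+ 2 / 2 + t ^+ 3 * g3 t.
  by rewrite e3 (_ : 0`! = 1%N) // (_ : 1`! = 1%N) // (_ : 2`! = 2%N) //; field.
have lowb : cmod t / 2 <= cmod (cexp t - 1).
  pose k := 1 / 2 + t * g3 t.
  have kb : cmod k <= 1 / 2 + cmod t * M.
    apply: le_trans (cmodD _ _) _; apply: lerD.
      by rewrite cmodM cmod1 cmodV cmod_nat.
    by rewrite cmodM ler_wpM2l // g3b.
  have -> : cexp t - 1 = t * (1 - - (t * k)) by rewrite e3' /k; field.
  rewrite cmodM ler_wpM2l //.
  have := cmod_leB 1 (- (t * k)); rewrite cmod1 cmodN cmodM => h.
  have : cmod t * cmod k <= 1 / 2; last by lra.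
  apply: le_trans (ler_wpM2l (cmod_ge0 t) kb) _.
  have : 0 <= cmod t * (cmod t * M) by rewrite !mulr_ge0 //; lra.
  have : cmod t * (cmod t * M) <= 1 * (cmod t * M) by rewrite ler_wpM2r // mulr_ge0 //; lra.
  lra.
have e0 : cexp t - 1 != 0.
  by rewrite -cmod_gt0 (lt_le_trans _ lowb) // divr_gt0.
split; first by rewrite -subr_eq0.
have -> : coth2 t - t^-1 = t ^+ 2 * (1 / 2 + t * g3 t - 2 * g3 t) / (2 * (cexp t - 1)).
  have num : t * (cexp t + 1) - 2 * (cexp t - 1) = t ^+ 3 * (1 / 2 + t * g3 t - 2 * g3 t).
    by rewrite e3'; field.
  rewrite /coth2; apply: (mulIf tn0); apply: (mulIf e0).
  have -> : t ^+ 2 * (1 / 2 + t * g3 t - 2 * g3 t) / (2 * (cexp t - 1)) * t * (cexp t - 1) =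
     t ^+ 3 * (1 / 2 + t * g3 t - 2 * g3 t) / 2 by field; exact: e0.
  by rewrite -num; field; rewrite tn0 e0.
rewrite cmodM cmodV ler_pdivrMr; last first.
  by rewrite cmod_gt0 mulf_neq0 // pnatr_eq0.
rewrite !cmodM cmod_nat.
have kb : cmod (1 / 2 + t * g3 t - 2 * g3 t) <= 4 * M.
  apply: le_trans (cmodD _ _) _; rewrite cmodN.
  have := cmodD (1 / 2) (t * g3 t); rewrite !cmodM cmod1 cmodV cmod_nat => h.
  have := g3b t t1 => h3.
  have : cmod t * cmod (g3 t) <= 1 * M by apply: ler_pM.
  lra.
have -> : 8 * M * cmod t * (2 * cmod (cexp t - 1)) = (4 * M * cmod t) * (4 * cmod (cexp t - 1)) by ring.
have -> : cmod t * cmod t * cmod (1 / 2 + t * g3 t - 2 * g3 t) =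
   (cmod (1 / 2 + t * g3 t - 2 * g3 t) * cmod t) * cmod t by ring.
apply: ler_pM => //; first by rewrite mulr_ge0.
  by rewrite ler_wpM2r.
lra.
Qed.

(** One period of [coth2], cut at [Y] in the real direction. Both maps [t / 2] and [t / 2 + tpi / 2]
    of the duplication formula send it into itself. *)
Definition hstrip Y : set C := [set t | `|cRe t| <= Y /\ 0 <= cIm t <= 2 * pi].

(** The term of index 0 is left out because its pole [tpi] lies on the strip. For the others the
    imaginary parts keep both denominators away from 0, and the majorants telescope. *)
Lemma cothterm_bound Y n t : hstrip Y t ->
  cmod (cothterm n.+1 t) <= cmod t * (n.+1%:R^-1 - n.+2%:R^-1).
Proof.
move=> [_ /andP[t0 t1]].
have pi2 := pi_ge2 R.
have a1 : 2 * n.+2%:R <= cmod (t + n.+2%:R * tpi).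
  apply: le_trans (ler_cIm _); rewrite cImD cImM cIm_tpi cRe_tpi mulr0 addr0.
  rewrite -ofReal_nat /=; apply: le_trans (ler_norm _).
  have : n.+2%:R * 2 <= n.+2%:R * pi :> R by rewrite ler_wpM2l.
  by move: (ler0n R n.+2); lra.
have a2 : 2 * n.+1%:R <= cmod (t - n.+2%:R * tpi).
  rewrite cmodB; apply: le_trans (ler_cIm _); rewrite cImB cImM cIm_tpi cRe_tpi mulr0 addr0.
  rewrite -ofReal_nat /=; apply: le_trans (ler_norm _).
  have : n.+1%:R * 2 <= n.+1%:R * pi :> R by rewrite ler_wpM2l.
  by rewrite -[n.+2%:R]natr1 mulrDl mul1r; move: (ler0n R n.+1); lra.
have n1 : 0 < n.+1%:R :> R by [].
have n2 : 0 < n.+2%:R :> R by [].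
have b1 : t + n.+2%:R * tpi != 0 by rewrite -cmod_gt0 (lt_le_trans _ a1) // mulr_gt0.
have b2 : t - n.+2%:R * tpi != 0 by rewrite -cmod_gt0 (lt_le_trans _ a2) // mulr_gt0.
have -> : cothterm n.+1 t = 2 * t / ((t + n.+2%:R * tpi) * (t - n.+2%:R * tpi)).
  by rewrite /cothterm; move: (n.+2%:R : C) b1 b2 => k b1 b2; field; rewrite b1 b2.
have -> : n.+1%:R^-1 - n.+2%:R^-1 = (n.+2%:R * n.+1%:R)^-1 :> R.
  move: (gt_eqF n1) (gt_eqF n2); rewrite -[n.+2%:R]natr1; move: (n.+1%:R : R) => k k0 k1.
  by field; rewrite k0 k1.
rewrite cmodM cmodV !cmodM cmod_nat ler_pdivrMr; last by rewrite mulr_gt0 // cmod_gt0.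
rewrite mulrAC ler_pdivlMr ?mulr_gt0 //.
have : (2 * n.+2%:R) * (2 * n.+1%:R) <= cmod (t + n.+2%:R * tpi) * cmod (t - n.+2%:R * tpi).
  by apply: ler_pM => //; rewrite mulr_ge0.
set P := _ * cmod (t - _) => hP.
have : cmod t * ((2 * n.+2%:R) * (2 * n.+1%:R)) <= cmod t * P by rewrite ler_wpM2l.
have : 0 <= cmod t * (n.+2%:R * n.+1%:R) by rewrite !mulr_ge0.
lra.
Qed.

Lemma cothterm_series Y t : hstrip Y t -> exists2 l, series (cothterm^~ t) @ \oo --> l &
  cmod (l - cothterm 0 t) <= cmod t.
Proof.
move=> Yt.
have tel N : \sum_(0 <= n < N) (n.+1%:R^-1 - n.+2%:R^-1) = 1 - N.+1%:R^-1 :> R.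
  elim: N => [|N IH]; first by rewrite big_geq // invr1 subrr.
  by rewrite big_nat_recr //= IH addrA subrK.
have [N|l hl lb] := @csum_bound_cvg _ (fun n => cothterm n.+1 t) (cmod t).
  apply: (@le_trans _ _ (cmod t * \sum_(0 <= n < N) (n.+1%:R^-1 - n.+2%:R^-1))).
    by rewrite mulr_sumr; apply: ler_sum => n _; exact: cothterm_bound Yt.
  by rewrite tel ler_piMr // lerBlDr lerDl invr_ge0.
exists (cothterm 0 t + l); last by rewrite addrAC subrr add0r.
rewrite -(cvg_shiftn 1).
set v := (X in X @ _ --> _).
have -> : v = (fun n => cothterm 0 t + series (fun n => cothterm n.+1 t) n).
  by apply/funext => n; rewrite /v /series /= addn1 big_nat_recl.
by apply: cvgC_add; [exact: cvgC_cst | exact: hl].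
Qed.

Definition cothsum t : C := t^-1 + limn (series (cothterm^~ t)).

Lemma cothsum_cvg Y t : hstrip Y t ->
  (fun N => t^-1 + \sum_(0 <= n < N) cothterm n t) @ \oo --> cothsum t.
Proof.
move=> /cothterm_series [l hl _]; apply: cvgC_add; first exact: cvgC_cst.
by rewrite (limCE hl); exact: hl.
Qed.

Lemma cothsum_bound Y t : hstrip Y t ->
  cmod (cothsum t - t^-1 - cothterm 0 t) <= cmod t.
Proof.
move=> /cothterm_series [l hl lb].
by rewrite /cothsum (limCE hl) [_ + l]addrC addrK.
Qed.

Lemma hstrip_half Y t : hstrip Y t -> hstrip Y (t / 2) /\ hstrip Y (t / 2 + tpi / 2).
Proof.
have half s : cRe (s / 2) = cRe s / 2 /\ cIm (s / 2) = cIm s / 2.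
  have -> : (2^-1 : C) = ofReal 2^-1 by rewrite ofRealV ofReal_nat.
  by rewrite cReM cImM /= !mulr0 subr0 add0r [cIm s * _]mulrC mulrC.
rewrite /hstrip /= !(cReD, cImD) !(half _).1 !(half _).2 cRe_tpi cIm_tpi mul0r addr0.
move=> [tY /andP[t0 t1]]; have pi0 := pi_gt0 R.
have h : `|cRe t / 2| <= Y.
  by rewrite normrM [`|2^-1|]ger0_norm // ; have := normr_ge0 (cRe t); lra.
by split; split => //; apply/andP; split; lra.
Qed.

(** The limit of [cothterm_double], whose unpaired pole recedes to infinity. *)
Lemma cothsum_double Y t : hstrip Y t ->
  cothsum (t / 2) + cothsum (t / 2 + tpi / 2) = 2 * cothsum t.
Proof.
move=> Yt; have [Y1 Y2] := hstrip_half Yt.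
apply: limC_unique (cvgC_add (cothsum_cvg Y1) (cothsum_cvg Y2)) _.
have -> : (fun N => ((t / 2)^-1 + \sum_(0 <= n < N) cothterm n (t / 2)) +
  ((t / 2 + tpi / 2)^-1 + \sum_(0 <= n < N) cothterm n (t / 2 + tpi / 2))) =
  (fun N => 2 * (t^-1 + \sum_(0 <= n < N.*2) cothterm n t) + 2 * (t + N.*2.+1%:R * tpi)^-1).
  by apply/funext => N; rewrite cothterm_double.
rewrite -[X in _ --> X]addr0; apply: cvgC_add.
  apply: cvgC_mull; have h := cothsum_cvg Yt; apply: cvg_comp h.
  by apply/cvgnyPge => A; exists A => // n /= An; rewrite -addnn (leq_trans An) // leq_addl.
rewrite -[X in _ --> X](mulr0 2); apply: cvgC_mull.
have h0 : (fun N => cmod (t + N.*2.+1%:R * tpi)^-1) @ \oo --> (0 : R).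
  have hN : (fun N : nat => N.+1%:R^-1) @ \oo --> (0 : R) by exact: cvg_harmonic.
  apply: (squeeze_cvgr _ (cvg_cst 0) hN); apply: nearW => N; rewrite cmod_ge0 /= cmodV.
  have : N.+1%:R <= cmod (t + N.*2.+1%:R * tpi).
    apply: le_trans (ler_cIm _); rewrite cImD cImM cIm_tpi cRe_tpi mulr0 addr0.
    rewrite -ofReal_nat /=; apply: le_trans (ler_norm _).
    have [_ /andP[t0 _]] := Yt.
    have : N.+1%:R <= N.*2.+1%:R :> R by rewrite ler_nat ltnS -addnn leq_addl.
    have : N.*2.+1%:R * 2 <= N.*2.+1%:R * pi :> R by rewrite ler_wpM2l // pi_ge2.
    have : 0 <= N.*2.+1%:R :> R by [].
    lra.
  by move=> h; rewrite lef_pV2 // posrE ?ltr0Sn // (lt_le_trans _ h).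
apply: (proj2 (cvgCP _ _)); under eq_fun do rewrite subr0; exact: h0.
Qed.

End Herglotz.
Arguments coth2 {R} t.
Arguments cothterm {R} n t.
Arguments cothsum {R} t.

(** * The Herglotz trick, and the expansions of coth, cot and 1 / sin *)

Section HerglotzTrick.
Variable R : realType.
Local Notation C := (cplx R).
Local Notation tpi := (tpi R).
Implicit Types (t s : C) (Y d : R).

(** Put [t = x + i y]. If [x] is at least [d / 2] in absolute value, the modulus of [cexp t] is away
    from 1. Otherwise [y] is at distance at least [d / 2] from 0 and from 2 pi, and the squared
    modulus of [cexp t - 1] is (e^x - 1)^2 + 2 e^x (1 - cos y). *)
Lemma cexp_sub1_lower Y d : 0 < d -> d <= 1 -> exists2 m, 0 < m & forall t,
  hstrip Y t -> d <= cmod t -> d <= cmod (t - tpi) -> m <= cmod (cexp t - 1).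
Proof.
move=> d0 d1; have pi2 := pi_ge2 R.
pose k := 1 - cos (d / 2).
have k0 : 0 < k.
  rewrite subr_gt0 -[ltRHS]cos0 ltr_cos ?in_itv /= ?lexx ?pi_ge0 //; first lra.
  by apply/andP; split; lra.
have k2 : k <= 2 by have := cos_geN1 (d / 2); rewrite /k; lra.
exists (Num.min (d / 4) (k / 2)); first by rewrite lt_min !divr_gt0.
move=> t [_ /andP[t0 t1]] dt dt'; rewrite ge_min.
set x := cRe t; set y := cIm t in t0 t1 *.
have [xd|xd] := lerP (d / 2) `|x|.
  apply/orP; left.
  have b1 : expR x - 1 <= cmod (cexp t - 1).
    by have := cmod_leB (cexp t) 1; rewrite cmod1 cmod_cexp.
  have b2 : 1 - expR x <= cmod (cexp t - 1).
    by rewrite cmodB; have := cmod_leB 1 (cexp t); rewrite cmod1 cmod_cexp.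
  have [x0|x0] := lerP 0 x.
    by rewrite (ger0_norm x0) in xd; have := expR_ge1Dx x; lra.
  rewrite (ltr0_norm x0) in xd.
  have : expR x * (1 + d / 2) <= 1.
    have h := expR_ge1Dx (- x).
    have e1 : expR x * expR (- x) = 1 by rewrite -expRD subrr expR0.
    rewrite -[leRHS]e1 ler_wpM2l ?expR_ge0 //; lra.
  have := expR_ge0 x; nra.
apply/orP; right.
have yd : d / 2 <= y.
  by have := ler_cmod t; rewrite -/x -/y (ger0_norm t0); lra.
have yd' : d / 2 <= 2 * pi - y.
  have := ler_cmod (t - tpi); rewrite cReB cImB cRe_tpi cIm_tpi subr0 -/x -/y.
  by rewrite [`|y - _|]ler0_norm ?subr_le0 //; lra.
have cosy : cos y <= cos (d / 2).
  have mono z : d / 2 <= z -> z <= pi -> cos z <= cos (d / 2).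
    move=> z0 z1; have [<-//|/eqP ne] := eqVneq (d / 2) z.
    have zz : d / 2 < z by rewrite lt_neqAle; apply/andP; split => //; exact/eqP.
    by apply: ltW; rewrite ltr_cos // in_itv /=; apply/andP; split; lra.
  have [ypi|ypi] := lerP y pi; first exact: mono.
  have -> : cos y = cos (2 * pi - y).
    by rewrite mulr_natl cosB cos2pi sin2pi mul1r mul0r addr0.
  by apply: mono => //; lra.
have ex : 1 / 2 <= expR x.
  apply: le_trans (expR_ge1Dx x); have := ler_norm (- x); rewrite normrN; lra.
have sq : k <= cmod (cexp t - 1) ^+ 2.
  rewrite cplx_sq cReB cImB cRe_cexp cIm_cexp -/x -/y /= subr0.
  have -> : (expR x * cos y - 1) ^+ 2 + (expR x * sin y) ^+ 2 =
    (expR x - 1) ^+ 2 + 2 * expR x * (1 - cos y) + expR x ^+ 2 * (cos y ^+ 2 + sin y ^+ 2 - 1) by ring.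
  rewrite cos2Dsin2 subrr mulr0 addr0.
  have : 0 <= (expR x - 1) ^+ 2 by rewrite sqr_ge0.
  have : k <= 1 - cos y by rewrite /k; lra.
  nra.
rewrite leNgt; apply/negP => lt; have := cmod_ge0 (cexp t - 1) => g0.
have : cmod (cexp t - 1) ^+ 2 <= (k / 2) ^+ 2 by apply: ler_pow => //; exact: ltW.
nra.
Qed.

Lemma cexp_neq1 Y t : hstrip Y t -> t != 0 -> t != tpi -> cexp t != 1.
Proof.
move=> Yt t0 t1.
pose d := Num.min 1 (Num.min (cmod t) (cmod (t - tpi))).
have d0 : 0 < d by rewrite !lt_min ltr01 !cmod_gt0 t0 subr_eq0 t1.
have d1 : d <= 1 by rewrite ge_min lexx.
have [m m0 hm] := cexp_sub1_lower Y d0 d1.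
rewrite -subr_eq0 -cmod_gt0; apply: lt_le_trans m0 (hm t Yt _ _).
  by rewrite !ge_min lexx /= orbT.
by rewrite !ge_min lexx !orbT.
Qed.

(** The poles of both sides on the strip are 0 and [tpi]. The value 0 put there is the limit at 0 by
    [hfun_near0], and it makes [hfun_double] hold at these points too. *)
Definition hfun t : C :=
  if (t == 0) || (t == tpi) then 0 else coth2 t - cothsum t.

Lemma hstrip_cmod Y t : hstrip Y t -> cmod t <= Y + 2 * pi.
Proof.
move=> [tY /andP[t0 t1]]; apply: le_trans (ler_cmod t) _.
by rewrite (ger0_norm t0) lerD.
Qed.

Lemma cmod_tpi : 4 <= cmod tpi.
Proof.
apply: le_trans (ler_cIm _); rewrite cIm_tpi; apply: le_trans (ler_norm _).
have := pi_ge2 R; lra.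
Qed.

Lemma cmodV_le s (d : R) : 0 < d -> d <= cmod s -> cmod s^-1 <= d^-1.
Proof. by move=> d0 ds; rewrite cmodV lef_pV2 // posrE (lt_le_trans d0). Qed.

Lemma cothterm0_bound t : cmod t <= 1 -> cmod (cothterm 0 t) <= cmod t.
Proof.
move=> t1; have t4 := cmod_tpi.
have a1 : 3 <= cmod (t + tpi).
  by rewrite addrC; have := cmod_leB tpi (- t); rewrite opprK cmodN; lra.
have a2 : 3 <= cmod (t - tpi) by rewrite cmodB; have := cmod_leB tpi t; lra.
have b1 : t + tpi != 0 by rewrite -cmod_gt0; lra.
have b2 : t - tpi != 0 by rewrite -cmod_gt0; lra.
rewrite /cothterm !mul1r.
have -> : (t + tpi)^-1 + (t - tpi)^-1 = 2 * t * ((t + tpi)^-1 * (t - tpi)^-1).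
  by field; rewrite b1 b2.
rewrite !cmodM cmod_nat.
have c1 := cmodV_le (ltr0n R 3 : 0 < 3 :> R) a1.
have c2 := cmodV_le (ltr0n R 3 : 0 < 3 :> R) a2.
have : cmod (t + tpi)^-1 * cmod (t - tpi)^-1 <= 3^-1 * 3^-1 by apply: ler_pM.
set P := _ * _ => hP.
have : cmod t * P <= cmod t * (3^-1 * 3^-1) by rewrite ler_wpM2l.
by have := cmod_ge0 t; lra.
Qed.

Lemma hfun_near0 Y : exists A d : R, [/\ 0 < A, 0 < d, d <= 1 &
  forall t, hstrip Y t -> cmod t <= d -> cmod (hfun t) <= A * cmod t].
Proof.
have [A [d [A0 d0 d1 H]]] := coth2_near0 R.
exists (A + 2), d; split=> //; first lra.
move=> t Yt td; rewrite /hfun; case: ifPn => [_|].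
  by rewrite cmod0 mulr_ge0 //; lra.
rewrite negb_or => /andP[t0 _].
have [_ h1] : cexp t != 1 /\ cmod (coth2 t - t^-1) <= A * cmod t.
  by apply: H; rewrite cmod_gt0 t0.
have h2 := cothsum_bound Yt.
have h3 : cmod (cothterm 0 t) <= cmod t by apply: cothterm0_bound; lra.
have -> : coth2 t - cothsum t = (coth2 t - t^-1) -
  ((cothsum t - t^-1 - cothterm 0 t) + cothterm 0 t) by ring.
apply: le_trans (cmodD _ _) _; rewrite cmodN.
by have := cmodD (cothsum t - t^-1 - cothterm 0 t) (cothterm 0 t); lra.
Qed.

(** Near [tpi] the periodicity of [coth2] brings the question back to 0, and the pole cancels with
    one half of [cothterm 0]. Near 0 it cancels with [t^-1]. Elsewhere [cexp_sub1_lower] bounds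
    [coth2]. *)
Lemma hfun_bounded Y : exists B, forall t, hstrip Y t -> cmod (hfun t) <= B.
Proof.
have [A [d [A0 d0 d1 H]]] := coth2_near0 R.
have [m m0 hm] := cexp_sub1_lower Y d0 d1.
exists (A + (Y + 2 * pi) + 2 + m^-1 + d^-1 + d^-1).
move=> t Yt; have tY := hstrip_cmod Yt; have t4 := cmod_tpi.
have mi : 0 < m^-1 by rewrite invr_gt0.
have di : 0 < d^-1 by rewrite invr_gt0.
have tge0 := cmod_ge0 t.
rewrite /hfun; case: ifPn => [_|]; first by rewrite cmod0; lra.
rewrite negb_or => /andP[t0 tpi0].
have hc := cothsum_bound Yt.
have tIm : 0 <= cIm t by case: Yt => _ /andP[].
have tp : 4 <= cmod (t + tpi).
  apply: le_trans (ler_cIm _); rewrite cImD cIm_tpi; apply: le_trans (ler_norm _).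
  have := pi_ge2 R; lra.
have tp1 := cmodV_le (ltr0n R 4 : 0 < 4 :> R) tp.
have c0E : cothterm 0 t = (t + tpi)^-1 + (t - tpi)^-1 by rewrite /cothterm !mul1r.
have [td|td] := lerP (cmod (t - tpi)) d.
  have [_ h1] : cexp (t - tpi) != 1 /\
      cmod (coth2 (t - tpi) - (t - tpi)^-1) <= A * cmod (t - tpi).
    by apply: H; rewrite cmod_gt0 subr_eq0 tpi0.
  have h1' : A * cmod (t - tpi) <= A.
    by rewrite -[leRHS]mulr1 ler_wpM2l ?(ltW A0) //; lra.
  have t1 : 1 <= cmod t.
    have e : tpi - - (t - tpi) = t by ring.
    by have := cmod_leB tpi (- (t - tpi)); rewrite cmodN e; lra.
  have t1' := cmodV_le (ltr01 : 0 < 1 :> R) t1; rewrite invr1 in t1'.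
  have -> : coth2 t - cothsum t = (coth2 (t - tpi) - (t - tpi)^-1) -
    ((cothsum t - t^-1 - cothterm 0 t) + (t^-1 + (t + tpi)^-1)).
    by rewrite -(coth2_add_tpi (t - tpi)) subrK c0E; ring.
  apply: le_trans (cmodD _ _) _; rewrite cmodN.
  have := cmodD (cothsum t - t^-1 - cothterm 0 t) (t^-1 + (t + tpi)^-1).
  have := cmodD t^-1 (t + tpi)^-1; lra.
have c1 := cmodV_le d0 (ltW td).
have [td'|td'] := lerP (cmod t) d.
  have [_ h1] : cexp t != 1 /\ cmod (coth2 t - t^-1) <= A * cmod t.
    by apply: H; rewrite cmod_gt0 t0.
  have h1' : A * cmod t <= A.
    by rewrite -[leRHS]mulr1 ler_wpM2l ?(ltW A0) //; lra.
  have -> : coth2 t - cothsum t = (coth2 t - t^-1) -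
    ((cothsum t - t^-1 - cothterm 0 t) + ((t + tpi)^-1 + (t - tpi)^-1)).
    by rewrite -c0E; ring.
  apply: le_trans (cmodD _ _) _; rewrite cmodN.
  have := cmodD (cothsum t - t^-1 - cothterm 0 t) ((t + tpi)^-1 + (t - tpi)^-1).
  have := cmodD (t + tpi)^-1 (t - tpi)^-1; lra.
have c2 := cmodV_le d0 (ltW td').
have c3 := cmodV_le m0 (hm t Yt (ltW td') (ltW td)).
have -> : coth2 t - cothsum t = 2^-1 + (cexp t - 1)^-1 -
   ((cothsum t - t^-1 - cothterm 0 t) + (t^-1 + ((t + tpi)^-1 + (t - tpi)^-1))).
  by rewrite -c0E /coth2; ring.
apply: le_trans (cmodD _ _) _; rewrite cmodN.
have := cmodD (cothsum t - t^-1 - cothterm 0 t) (t^-1 + ((t + tpi)^-1 + (t - tpi)^-1)).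
have := cmodD t^-1 ((t + tpi)^-1 + (t - tpi)^-1).
have := cmodD (t + tpi)^-1 (t - tpi)^-1.
have := cmodD 2^-1 (cexp t - 1)^-1; rewrite [cmod 2^-1]cmodV cmod_nat.
by lra.
Qed.

(** Away from the poles, [hfun t] is the mean of its values at the two halved points. Those are not
    poles either, since their imaginary parts would force [cIm t] out of the strip or [t] to be a
    pole. *)
Lemma hfun_double Y t : hstrip Y t ->
  cmod (hfun t) <= (cmod (hfun (t / 2)) + cmod (hfun (t / 2 + tpi / 2))) / 2.
Proof.
move=> Yt; have [t01|] := boolP ((t == 0) || (t == tpi)).
  by rewrite {1}/hfun t01 cmod0 divr_ge0 // addr_ge0.
rewrite negb_or => /andP[t0 t1].
have tpi_n0 : tpi != 0 by rewrite -cmod_gt0; have := cmod_tpi; lra.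
have [tY /andP[i0 i1]] := Yt; have pi0 := pi_gt0 R.
have cancel2 (x y : C) : (x / 2 == y) = (x == 2 * y).
  apply/eqP/eqP => [<-|->]; [by field | by field].
have h1 : hfun (t / 2) = coth2 (t / 2) - cothsum (t / 2).
  rewrite /hfun !cancel2 mulr0 (negbTE t0) /=; case: eqP => // e.
  have e2 : cIm t = 4 * pi by rewrite e mulr_natl mulr2n cImD cIm_tpi; ring.
  by exfalso; move: i1; rewrite e2; lra.
have h2 : hfun (t / 2 + tpi / 2) = coth2 (t / 2 + tpi / 2) - cothsum (t / 2 + tpi / 2).
  rewrite /hfun -mulrDl !cancel2 mulr0.
  have -> : (t + tpi == 2 * tpi) = (t == tpi).
    by rewrite mulr_natl mulr2n (inj_eq (addIr tpi)).
  rewrite (negbTE t1) orbF; case: eqP => // e; exfalso.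
  by have : cIm (t + tpi) = 0; [rewrite e | rewrite cImD cIm_tpi; lra].
have h : hfun (t / 2) + hfun (t / 2 + tpi / 2) = 2 * hfun t.
  have h0 : hfun t = coth2 t - cothsum t by rewrite /hfun (negbTE t0) (negbTE t1).
  rewrite h1 h2 h0; move: (coth2_double (cexp_neq1 Yt t0 t1)) (cothsum_double Yt).
  move: (coth2 _) (coth2 _) (coth2 _) (cothsum _) (cothsum _) (cothsum _).
  by move=> x y z u v w e1 e2; rewrite addrACA -opprD e1 e2 mulrBr.
rewrite ler_pdivlMr // mulrC -[2]/(2%:R) -(cmod_nat R 2) -cmodM -h.
exact: cmodD.
Qed.

(** Let [M] be the supremum of [cmod (hfun s)] on the strip. Iterating [hfun_double] along
    [s / 2 ^+ n] and bounding the other branch by [M] each time gives a weight of 2^-n to the value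
    at [s / 2 ^+ n]. That point is near 0 uniformly in [s], where [hfun] is small, so
    [M <= A * (D * 2^-1 ^+ n)] for all large [n]. *)
Lemma hfun0 Y t : 0 <= Y -> hstrip Y t -> hfun t = 0.
Proof.
move=> Y0 Yt; have [B hB] := hfun_bounded Y.
have [A [d [A0 d0 d1 hA]]] := hfun_near0 Y.
pose S := [set x : R | exists2 s, hstrip Y s & x = cmod (hfun s)].
have supS : has_sup S.
  by split; [exists (cmod (hfun t)), t | exists B => _ [s Ys ->]; exact: hB].
pose M := sup S.
have hM s : hstrip Y s -> cmod (hfun s) <= M.
  by move=> Ys; apply: sup_upper_bound => //; exists s.
pose D := Y + 2 * pi.
have D0 : 0 < D by have := pi_gt0 R; rewrite /D; lra.
have iter n s : hstrip Y s -> hstrip Y (s / 2 ^+ n) /\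
    cmod (hfun s) <= (1 - 2^-1 ^+ n) * M + 2^-1 ^+ n * cmod (hfun (s / 2 ^+ n)).
  move=> Ys; elim: n => [|n [Yn IH]].
    by rewrite !expr0 subrr mul0r add0r divr1 mul1r.
  have [Yh Yh'] := hstrip_half Yn.
  have e : s / 2 ^+ n.+1 = s / 2 ^+ n / 2 by rewrite exprSr invfM mulrA.
  rewrite e; split=> //; apply: le_trans IH _.
  have := hfun_double Yn; have := hM _ Yh'.
  set a := cmod (hfun (s / 2 ^+ n)); set b := cmod (hfun (s / 2 ^+ n / 2)).
  move=> h1 h2.
  have a_le : a <= (b + M) / 2 by lra.
  have p0 : 0 <= 2^-1 ^+ n :> R by rewrite exprn_ge0.
  have : 2^-1 ^+ n * a <= 2^-1 ^+ n * ((b + M) / 2) by rewrite ler_wpM2l.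
  rewrite exprS; lra.
have key n : D * 2^-1 ^+ n <= d -> M <= A * (D * 2^-1 ^+ n).
  move=> hn; have p0 : 0 < 2^-1 ^+ n :> R by rewrite exprn_gt0.
  have : M <= (1 - 2^-1 ^+ n) * M + 2^-1 ^+ n * (A * (D * 2^-1 ^+ n)).
    apply: ge_sup; first by exists (cmod (hfun t)), t.
    move=> _ [s Ys ->]; have [Yn h] := iter n s Ys.
    apply: le_trans h _; rewrite lerD2l ler_wpM2l ?(ltW p0) //.
    have sn : cmod (s / 2 ^+ n) <= D * 2^-1 ^+ n.
      rewrite cmodM cmodV cmodX cmod_nat exprVn ler_wpM2r ?invr_ge0 ?exprn_ge0 //.
      exact: hstrip_cmod.
    apply: le_trans (hA _ Yn (le_trans sn hn)) _.
    by rewrite ler_wpM2l // ltW.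
  have -> : (1 - 2^-1 ^+ n) * M + 2^-1 ^+ n * (A * (D * 2^-1 ^+ n)) =
     M + 2^-1 ^+ n * (A * (D * 2^-1 ^+ n) - M) by ring.
  by rewrite lerDl pmulr_rge0 // subr_ge0.
have M0 : M <= 0.
  apply/ler_addgt0Pr => e e0; rewrite add0r.
  have cv : (fun n => D * 2^-1 ^+ n) @ \oo --> (0 : R).
    rewrite -(mulr0 D); apply: cvgM; first exact: cvg_cst.
    by apply: cvg_expr; rewrite ger0_norm // invf_lt1 // ltr1n.
  have ed : 0 < Num.min d (e / A) by rewrite lt_min d0 divr_gt0.
  have /cvgrPdist_lt /(_ _ ed) [N _ /(_ N (leqnn _))] := cv.
  rewrite /= sub0r normrN ger0_norm ?mulr_ge0 ?exprn_ge0 ?(ltW D0) //.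
  rewrite lt_min => /andP[/ltW hd he]; apply: le_trans (key N hd) _.
  by rewrite mulrC -ler_pdivlMr // ltW.
apply/eqP; rewrite -cmod_eq0 eq_le cmod_ge0 andbT.
exact: le_trans (hM t Yt) M0.
Qed.

Lemma coth2_expansion t : 0 <= cIm t <= 2 * pi -> t != 0 -> t != tpi ->
  series (cothterm^~ t) @ \oo --> coth2 t - t^-1.
Proof.
move=> ht t0 t1.
have Yt : hstrip `|cRe t| t by split.
have := hfun0 (normr_ge0 _) Yt; rewrite /hfun (negbTE t0) (negbTE t1) /=.
move/eqP; rewrite subr_eq0 => /eqP ->.
have [l hl _] := cothterm_series Yt.
by rewrite /cothsum (limCE hl) [_ + l]addrC addrK.
Qed.

Lemma coth_expansion_real (x : R) : 0 < x ->
  series (fun n : nat => 2 * x / (x ^+ 2 + (2 * pi * n.+1%:R) ^+ 2)) @ \oo -->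
    (expR x - 1)^-1 - x^-1 + 2^-1.
Proof.
move=> x0; have pi0 := pi_gt0 R.
have tn0 : ofReal x != 0 :> C by rewrite ofReal_eq0 gt_eqF.
have tn1 : ofReal x != tpi.
  apply/eqP => e; have : cIm (ofReal x) = cIm tpi by rewrite e.
  rewrite cIm_tpi /=; lra.
have ht : 0 <= cIm (ofReal x) <= 2 * pi by rewrite /= lexx /=; lra.
have cv : cRe (series (cothterm^~ (ofReal x)) N) @[N --> \oo] -->
    cRe (coth2 (ofReal x) - (ofReal x)^-1).
  by apply: cvgC_cRe; exact: coth2_expansion.
have e : cRe (coth2 (ofReal x) - (ofReal x)^-1) = (expR x - 1)^-1 - x^-1 + 2^-1.
  rewrite /coth2 cexp_ofReal -ofReal1 -ofReal_nat -ofRealB -!ofRealV -ofRealD -ofRealB /=.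
  by ring.
rewrite -e.
set v := (X in X @ _ --> _).
have -> // : v = (fun N => cRe (series (cothterm^~ (ofReal x)) N)).
apply/funext => N; rewrite /v /series /= cRe_sum.
apply: eq_bigr => n _; rewrite /cothterm.
set k : R := 2 * pi * n.+1%:R.
have k0 : 0 < k by rewrite !mulr_gt0.
have -> : n.+1%:R * tpi = ofReal k * ci R.
  by rewrite tpiE /k !ofRealM !ofReal_nat; ring.
have nz (y : R) : ofReal x + ofReal y * ci R != 0.
  apply/eqP => e0; have : cRe (ofReal x + ofReal y * ci R) = 0 by rewrite e0.
  rewrite cReD cReM /=; lra.
have nz2 : x ^+ 2 + k ^+ 2 != 0 by rewrite gt_eqF // ltr_pwDl ?sqr_ge0 ?exprn_gt0.
have -> : (ofReal x + ofReal k * ci R)^-1 + (ofReal x - ofReal k * ci R)^-1 =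
    ofReal (2 * x / (x ^+ 2 + k ^+ 2)).
  have nzk := nz k; have := nz (- k); rewrite ofRealN mulNr => nzk'.
  have nz2' : ofReal (x ^+ 2 + k ^+ 2) != 0 :> C by rewrite ofReal_eq0.
  rewrite ofRealM ofRealV.
  have -> : ofReal (x ^+ 2 + k ^+ 2) =
     (ofReal x + ofReal k * ci R) * (ofReal x - ofReal k * ci R).
    have -> : (ofReal x + ofReal k * ci R) * (ofReal x - ofReal k * ci R) =
      ofReal x * ofReal x - ofReal k * ofReal k * (ci R * ci R) by ring.
    by rewrite ci2 ofRealD !expr2 !ofRealM mulrN1 opprK.
  by rewrite ofRealM ofReal_nat; field; rewrite nzk nzk'.
by [].
Qed.

Lemma cot_expansion (a : R) : 0 < a < 1 ->
  series (fun n : nat => (a + n.+1%:R)^-1 + (a - n.+1%:R)^-1) @ \oo -->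
    pi * cos (pi * a) / sin (pi * a) - a^-1.
Proof.
move=> /andP[a0 a1]; have pi0 := pi_gt0 R.
have tpi_n0 : tpi != 0 by rewrite -cmod_gt0; have := cmod_tpi; lra.
pose t : C := ofReal a * tpi.
have t0 : t != 0 by rewrite mulf_neq0 // ofReal_eq0 gt_eqF.
have t1 : t != tpi.
  rewrite -subr_eq0 (_ : t - tpi = ofReal (a - 1) * tpi); last by rewrite ofRealB ofReal1 /t; ring.
  by rewrite mulf_neq0 // ofReal_eq0 subr_eq0 lt_eqF.
have tIm : cIm t = a * (2 * pi) by rewrite /t cImM cIm_tpi cRe_tpi /=; ring.
have ht : 0 <= cIm t <= 2 * pi.
  by rewrite tIm; apply/andP; split; nra.
have cv : cRe (tpi * series (cothterm^~ t) N) @[N --> \oo] -->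
    cRe (tpi * (coth2 t - t^-1)).
  by apply: cvgC_cRe; apply: cvgC_mull; exact: coth2_expansion.
have si0 : 0 < sin (pi * a).
  by apply: sin_gt0_pi; apply/andP; split; nra.
have h (b : R) : tpi * (ofReal b * tpi)^-1 = ofReal b^-1.
  by rewrite invfM ofRealV mulrCA mulfV // mulr1.
have e : cRe (tpi * (coth2 t - t^-1)) = pi * cos (pi * a) / sin (pi * a) - a^-1.
  have -> : tpi * (coth2 t - t^-1) = tpi * coth2 t - ofReal a^-1.
    by rewrite mulrBr {2}/t h.
  have two : cexp t = cexp (ofReal (pi * a) * ci R) * cexp (ofReal (pi * a) * ci R).
    by rewrite -cexpD; congr cexp; rewrite /t tpiE !ofRealM ofReal_nat; ring.
  set c := cos (pi * a); set s := sin (pi * a) in si0 *.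
  have cs : c ^+ 2 + s ^+ 2 = 1 by exact: cos2Dsin2.
  have cotE : coth2 t = ofReal (c / (2 * s)) * - ci R.
    have em : cexp t - 1 = ofReal (2 * s) * Complex (- s) c.
      rewrite two cexp_ci -/c -/s.
      apply: cplxP; rewrite ?(cReB, cImB, cReM, cImM) /=; last by ring.
      by move: cs; lra.
    have inv : (Complex (- s) c : C)^-1 = Complex (- s) (- c).
      have hh : (Complex (- s) c : C) * Complex (- s) (- c) = 1.
        apply: cplxP; rewrite ?(cReM, cImM) /=; last by ring.
        by move: cs; lra.
      have nz : (Complex (- s) c : C) != 0.
        by apply/eqP => z; move: hh; rewrite z mul0r => /esym/eqP; rewrite oner_eq0.
      by apply: (mulfI nz); rewrite mulfV.
    rewrite /coth2 em invfM inv -ofRealV -[2^-1]/(2%:R^-1) -[2%:R]ofReal_nat -ofRealV.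
    have sn0 : s != 0 by rewrite gt_eqF.
    by apply: cplxP; rewrite ?(cReD, cImD, cReM, cImM, cReN, cImN) /=; field.
  rewrite cotE cReB cReM cRe_tpi cIm_tpi ?(cReM, cImM, cReN, cImN) /=.
  by field; rewrite !gt_eqF.
rewrite -e.
set v := (X in X @ _ --> _).
have -> // : v = (fun N => cRe (tpi * series (cothterm^~ t) N)).
apply/funext => N; rewrite /v /series /= mulr_sumr cRe_sum.
apply: eq_bigr => n _; rewrite /cothterm /t.
rewrite -(ofReal_nat R n.+1) -mulrDl -mulrBl mulrDr -ofRealD -ofRealB !h.
by rewrite -ofRealD.
Qed.

(** Four consecutive poles, grouped as two positive differences: the first is what the integral of
    [v ^ (a - 1) / (1 + v)] over []0, 1]] contributes, the second what the part over [[1, +oo[]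
    contributes. *)
Definition csc_term (a : R) (n : nat) : R :=
  (n.*2%:R + a)^-1 - (n.*2.+1%:R + a)^-1 + ((n.*2.+1%:R - a)^-1 - (n.*2.+2%:R - a)^-1).

(* From [1 / sin x = cot (x / 2) - cot x]. *)
Lemma csc_expansion (a : R) : 0 < a < 1 ->
  series (csc_term a) @ \oo --> pi / sin (pi * a).
Proof.
move=> /andP[a0 a1]; have pi0 := pi_gt0 R.
have h1 := @cot_expansion a (introT andP (conj a0 a1)).
have h2 : series (fun n : nat => (a / 2 + n.+1%:R)^-1 + (a / 2 - n.+1%:R)^-1) @ \oo -->
    pi * cos (pi * (a / 2)) / sin (pi * (a / 2)) - (a / 2)^-1.
  by apply: cot_expansion; apply/andP; split; lra.
have h1' : (fun N => series (fun n : nat => (a + n.+1%:R)^-1 + (a - n.+1%:R)^-1) N.*2) @ \oo -->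
    pi * cos (pi * a) / sin (pi * a) - a^-1.
  apply: cvg_comp h1.
  by apply/cvgnyPge => A; exists A => // n /= An; rewrite -addnn (leq_trans An) // leq_addl.
(* Cutting the cotangent series of [a / 2] at [N] and that of [a] at [N.*2] leaves this one
   unmatched term. *)
have h3 : (fun N : nat => (N.*2%:R + a)^-1) @ \oo --> (0 : R).
  rewrite -(cvg_shiftn 1).
  have hN : (fun N : nat => N.+1%:R^-1) @ \oo --> (0 : R) by exact: cvg_harmonic.
  apply: (squeeze_cvgr _ (cvg_cst 0) hN); apply: nearW => N.
  have h : N.+1%:R <= (N + 1).*2%:R + a.
    have : N.+1%:R <= (N + 1).*2%:R :> R by rewrite ler_nat addn1 -addnn leq_addl.
    lra.
  have N0 : 0 < N.+1%:R :> R by [].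
  by rewrite invr_ge0 (le_trans (ltW N0) h) /= lef_pV2 // posrE (lt_le_trans N0 h).
have e : a^-1 + (pi * cos (pi * (a / 2)) / sin (pi * (a / 2)) - (a / 2)^-1) -
   (pi * cos (pi * a) / sin (pi * a) - a^-1) - 0 = pi / sin (pi * a).
  have -> : pi * a = (pi * (a / 2)) *+ 2 by rewrite -mulr_natl; field.
  set x := pi * (a / 2).
  have x0 : 0 < sin x by apply: sin_gt0_pi; apply/andP; split; rewrite /x; nra.
  have c0 : 0 < cos x by apply: cos_gt0_pihalf; apply/andP; split; rewrite /x; nra.
  rewrite cos_mulr2n sin_mulr2n; move: (cos x) (sin x) c0 x0 => c s c0 s0.
  by field; rewrite !gt_eqF.
have cv : (fun N : nat => a^-1 +
     series (fun n : nat => (a / 2 + n.+1%:R)^-1 + (a / 2 - n.+1%:R)^-1) N -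
     series (fun n : nat => (a + n.+1%:R)^-1 + (a - n.+1%:R)^-1) N.*2 -
     (N.*2%:R + a)^-1) @ \oo --> pi / sin (pi * a).
  rewrite -e; apply: cvgB h3; apply: cvgB h1'; apply: cvgD h2; exact: cvg_cst.
set u := (X in X @ _ --> _) in cv.
have <- // : u = series (csc_term a).
apply/funext => N; rewrite /u /= /series /=.
elim: N => [|N IH]; first by rewrite !big_geq // add0r addr0 subr0 subrr.
rewrite doubleS !big_nat_recr //= -IH /csc_term.
set A := \sum_(_ <= _ < _) _; set B := \sum_(_ <= _ < _) _.
have e1 (x : R) : (a / 2 + x)^-1 = 2 * (a + 2 * x)^-1.
  by rewrite -[2 in LHS]/2 (_ : a / 2 + x = (a + 2 * x) / 2) ?invfM ?invrK 1?mulrC //; field.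
have e2 (x : R) : (a / 2 - x)^-1 = 2 * (a - 2 * x)^-1 by rewrite e1 mulrN.
rewrite e1 e2.
have -> : 2 * N.+1%:R = N.*2.+2%:R :> R by rewrite -natrM mul2n doubleS.
have e3 (x : R) : (a - x)^-1 = - (x - a)^-1 by rewrite -invrN opprB.
rewrite !e3 ![_ + a]addrC; ring.
Qed.

End HerglotzTrick.

(** * Integrals of powers and exponentials *)

Section RealIntegrals.
Variable R : realType.
Local Notation mu := (@lebesgue_measure R).
Local Notation Rp := (`]0, +oo[%classic : set R).
Implicit Types (f : R -> R) (x y a b p c : R).

Lemma is_derive_powR a p : 0 < a -> is_derive a 1 (@powR R ^~ p) (p * a `^ (p - 1)).
Proof.
move=> a0; have ain : a \in `]0, +oo[ by rewrite in_itv /= a0.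
apply: DeriveDef; first exact: derivable_powR.
by rewrite -derive1E powR_derive1.
Qed.

Lemma integral_powR_segment a b p : 0 < a -> a < b -> p + 1 != 0 ->
  (\int[mu]_(x in `[a, b]) (x `^ p)%:E = ((b `^ (p + 1) - a `^ (p + 1)) / (p + 1))%:E)%E.
Proof.
move=> a0 ab p1.
pose F x : R := x `^ (p + 1) / (p + 1).
have dF x : 0 < x -> is_derive x 1 F (x `^ p).
  move=> x0; have h := is_derive_powR (p + 1) x0.
  have -> : F = (p + 1)^-1 \*: (@powR R ^~ (p + 1)).
    by apply/funext => y; rewrite /F /= mulrC.
  have -> : x `^ p = (p + 1)^-1 *: ((p + 1) * x `^ (p + 1 - 1)).
    by rewrite addrK /GRing.scale /= mulKf.
  exact: is_deriveZ.
have cF x : 0 < x -> {for x, continuous F}.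
  move=> x0; apply: differentiable_continuous; apply/derivable1_diffP.
  by have [] := dF x x0.
rewrite (@continuous_FTC2 _ _ F) //.
- by rewrite -EFinB /F mulrBl.
- apply: derivable_within_continuous => x; rewrite in_itv /= => /andP[ax _].
  by have [] := is_derive_powR p (lt_le_trans a0 ax).
- split=> /=.
  + by move=> x; rewrite in_itv /= => /andP[ax _]; have [] := dF x (lt_trans a0 ax).
  + by apply: cvg_at_right_filter; exact: cF.
  + by apply: cvg_at_left_filter; apply: cF; exact: lt_trans ab.
- move=> x; rewrite in_itv /= => /andP[ax _].
  by rewrite derive1E; have [_] := dF x (lt_trans a0 ax).
Qed.

Lemma measurable_powRD (D : set R) p : measurable D ->
  measurable_fun D (fun x : R => x `^ p).
Proof.
move=> mD; apply: (measurable_funS measurableT) => //; exact: measurable_powR.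
Qed.

Lemma powRB1_cvg0 p : p < 0 -> (fun n : nat => (n.+2%:R : R) `^ p) @ \oo --> (0 : R).
Proof.
move=> p0; have h : (fun n : nat => expR (p * ln (n.+2%:R : R))) @ \oo --> (0 : R).
  apply/cvgrPdist_lt => e e0.
  near=> n; rewrite sub0r normrN ger0_norm ?expR_ge0 //.
  rewrite -[ltRHS](lnK e0) ltr_expR.
  have : expR (ln e / p) < n.+2%:R.
    apply: lt_le_trans (_ : n%:R <= _); last by rewrite ler_nat -addn2 leq_addr.
    near: n; exact: nbhs_infty_gtr.
  rewrite -[X in _ < X -> _](@lnK R) ?posrE // ltr_expR => h.
  by rewrite mulrC -ltr_ndivrMr //.
by under eq_fun do rewrite /powR pnatr_eq0 /=.
Unshelve. all: end_near. Qed.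

Lemma integral_powR_0_1 p : -1 < p ->
  (\int[mu]_(x in `]0%R, 1%R]) (x `^ p)%:E = ((p + 1)^-1)%:E)%E.
Proof.
move=> p1; have p1' : 0 < p + 1 by rewrite -ltrBlDr sub0r.
(* The shift by 2 keeps the left endpoint strictly below 1, as [integral_powR_segment] demands. *)
pose S (n : nat) := (`[(n.+2%:R)^-1, 1]%classic : set R).
have SE : \bigcup_n S n = `]0, 1]%classic.
  apply/seteqP; split=> x /=.
    move=> [n _]; rewrite /S /= !in_itv /= => /andP[h ->].
    by rewrite andbT (lt_le_trans _ h) // invr_gt0.
  rewrite in_itv /= => /andP[x0 x1].
  have [n _ hn] := near_infty_natSinv_lt (PosNum x0).
  exists n => //; rewrite /S /= in_itv /= x1 andbT.
  apply: le_trans (ltW (hn n (leqnn n))).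
  by rewrite lef_pV2 ?posrE // ler_nat.
have cv : (\int[mu]_(x in S n) (x `^ p)%:E)%E @[n --> \oo] --> (\int[mu]_(x in \bigcup_n S n) (x `^ p)%:E)%E.
  apply: ge0_nondecreasing_set_cvg_integral => //.
  - move=> n m nm; apply/subsetPset => x; rewrite /S /= !in_itv /= => /andP[h ->].
    by rewrite andbT (le_trans _ h) // lef_pV2 ?posrE // ler_nat.
  - by move=> n; exact: measurable_itv.
  - by move=> n; apply/measurable_EFinP; apply: measurable_powRD; exact: measurable_itv.
  - by move=> n x _; rewrite lee_fin powR_ge0.
rewrite -SE; apply: (cvg_unique _ cv) => //.
have -> : (fun n => (\int[mu]_(x in S n) (x `^ p)%:E)%E) =
    (fun n => ((1 - (n.+2%:R) `^ (- (p + 1))) / (p + 1))%:E).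
  apply/funext => n; rewrite integral_powR_segment ?invr_gt0 ?gt_eqF //.
    have -> : (n.+2%:R^-1 : R) `^ (p + 1) = n.+2%:R `^ (- (p + 1)).
      by rewrite -(powR_inv1 (ler0n R n.+2)) -powRrM mulN1r.
    by rewrite powR1.
  by rewrite invf_lt1 // ltr1n.
apply: cvg_EFin; first exact: nearW.
have : (fun n : nat => (1 - (n.+2%:R : R) `^ (- (p + 1))) / (p + 1)) @ \oo --> (1 - 0) / (p + 1).
  apply: cvgM; last exact: cvg_cst.
  apply: cvgB; first exact: cvg_cst.
  by apply: powRB1_cvg0; rewrite oppr_lt0.
by rewrite subr0 div1r.
Qed.

Lemma integral_powR_1_y p : p < -1 ->
  (\int[mu]_(x in `[1%R, +oo[) (x `^ p)%:E = (- (p + 1)^-1)%:E)%E.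
Proof.
move=> p1; have p1' : p + 1 < 0 by rewrite -ltrBrDr sub0r.
pose S (n : nat) := (`[1, n.+2%:R]%classic : set R).
have SE : \bigcup_n S n = `[1, +oo[%classic.
  apply/seteqP; split=> x /=.
    by move=> [n _]; rewrite /S /= !in_itv /= => /andP[-> _].
  rewrite in_itv /= andbT => x1.
  have [n _ hn] := nbhs_infty_ger x.
  exists n => //; rewrite /S /= in_itv /= x1 /=.
  by apply: le_trans (hn n (leqnn n)) _; rewrite ler_nat -addn2 leq_addr.
have cv : (\int[mu]_(x in S n) (x `^ p)%:E)%E @[n --> \oo] --> (\int[mu]_(x in \bigcup_n S n) (x `^ p)%:E)%E.
  apply: ge0_nondecreasing_set_cvg_integral => //.
  - move=> n m nm; apply/subsetPset => x; rewrite /S /= !in_itv /= => /andP[-> h] /=.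
    by rewrite (le_trans h) // ler_nat.
  - by move=> n; exact: measurable_itv.
  - by move=> n; apply/measurable_EFinP; apply: measurable_powRD; exact: measurable_itv.
  - by move=> n x _; rewrite lee_fin powR_ge0.
rewrite -SE; apply: (cvg_unique _ cv) => //.
have -> : (fun n => (\int[mu]_(x in S n) (x `^ p)%:E)%E) =
    (fun n => (((n.+2%:R) `^ (p + 1) - 1) / (p + 1))%:E).
  apply/funext => n; rewrite integral_powR_segment ?lt_eqF ?ltr1n //.
  by rewrite powR1.
apply: cvg_EFin; first exact: nearW.
have : (fun n : nat => ((n.+2%:R : R) `^ (p + 1) - 1) / (p + 1)) @ \oo --> (0 - 1) / (p + 1).
  apply: cvgM; last exact: cvg_cst.
  apply: cvgB; last exact: cvg_cst.
  exact: powRB1_cvg0.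
by rewrite sub0r mulN1r.
Qed.

Lemma measurable_expRN c : measurable_fun setT (fun x : R => expR (- (c * x))).
Proof.
apply: measurableT_comp; first exact: measurable_expR.
apply: measurableT_comp; first exact: oppr_measurable.
by apply: measurable_funM; [exact: measurable_cst | exact: measurable_id].
Qed.

Lemma integral_expR_cy a c : 0 < c ->
  (\int[mu]_(x in `[a, +oo[) (expR (- (c * x)))%:E = (expR (- (c * a)) / c)%:E)%E.
Proof.
move=> c0.
pose F x : R := - c^-1 * expR (- (c * x)).
have dF x : is_derive x 1 F (expR (- (c * x))).
  rewrite /F; apply: is_derive_eq; rewrite /GRing.scale /=.
  by rewrite ?mulr0 ?addr0 ?add0r ?mulr1; field; rewrite gt_eqF.
rewrite (@ge0_continuous_FTC2y _ _ F a 0) //.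
- by rewrite -EFinB /F sub0r mulNr opprK mulrC.
- apply: continuous_subspaceT => x.
  apply: continuous_comp; last exact: continuous_expR.
  apply: continuousN; apply: continuousM => //; exact: cst_continuous.
- rewrite -[X in _ --> X](mulr0 (- c^-1)); apply: cvgM; first exact: cvg_cst.
  have h : (c * x) @[x --> +oo] --> +oo by apply: gt0_cvgMry => //; exact: cvg_id.
  exact: (cvg_comp _ _ h (@cvgr_expR R)).
- apply: cvg_at_right_filter; apply: differentiable_continuous; apply/derivable1_diffP.
  by have [] := dF a.
- by move=> x _; rewrite derive1E; have [_] := dF x.
Qed.

Lemma integral_expR_0y c : 0 < c ->
  (\int[mu]_(x in Rp) (expR (- (c * x)))%:E = (c^-1)%:E)%E.
Proof.
move=> c0; rewrite integral_itv_obnd_cbnd ?integral_expR_cy ?mulr0 ?oppr0 ?expR0 ?mul1r //.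
by apply/measurable_EFinP; apply: (measurable_funS measurableT) => //; exact: measurable_expRN.
Qed.

End RealIntegrals.

(** * Scaling of Lebesgue measure and Tonelli's theorem on subsets *)

Section Transformations.
Variable R : realType.
Local Notation mu := (@lebesgue_measure R).
Local Notation Rp := (`]0, +oo[%classic : set R).
Implicit Types (c : R).

(** By uniqueness of Lebesgue measure: [c] times its image under multiplication by [c] gives
    half-open intervals their length. *)
Lemma lebesgue_measure_scale c (A : set R) : 0 < c -> measurable A ->
  mu ( *%R c @^-1` A) = (c^-1%:E * mu A)%E.
Proof.
move=> c0 mA.
pose phi : measurableTypeR R -> measurableTypeR R := *%R c.
have mphi : measurable_fun [set: measurableTypeR R] phi.
  by apply: measurable_funM; [exact: measurable_cst | exact: measurable_id].
pose m1 : {measure set (measurableTypeR R) -> \bar R} :=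
  measure_function_pushforward__canonical__measure_function_Measure mu mphi.
pose nu : {measure set (measurableTypeR R) -> \bar R} := mscale (NngNum (ltW c0)) m1.
have -> : mu A = nu A.
  apply: lebesgue_measure_unique => // X /ocitvP[->|[[a b] /= ab ->]]; first by rewrite !measure0.
  rewrite lebesgue_measure_itv /= lte_fin ab /nu /mscale /= /pushforward /=.
  have -> : ( *%R c) @^-1` `]a, b]%classic = `](a / c), (b / c)]%classic.
    apply/seteqP; split=> x /=; rewrite !in_itv /= ![c * x]mulrC.
      by rewrite ltr_pdivrMr // ler_pdivlMr.
    by rewrite ltr_pdivrMr // ler_pdivlMr.
  rewrite lebesgue_measure_itv /= lte_fin ltr_pM2r ?invr_gt0 // ab -!EFinB -EFinM.
  by rewrite -mulrBl mulrCA mulfV ?mulr1 // gt_eqF.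
rewrite /nu /mscale /= muleA -EFinM mulVf ?mul1e // gt_eqF //.
Qed.

Lemma ge0_integral_scale c (f : R -> \bar R) : 0 < c -> measurable_fun Rp f ->
  (forall x, 0 < x -> (0 <= f x)%E) ->
  (\int[mu]_(x in Rp) f (c * x)%R = c^-1%:E * \int[mu]_(x in Rp) f x)%E.
Proof.
move=> c0 mf f0.
pose phi : measurableTypeR R -> measurableTypeR R := *%R c.
have mphi : measurable_fun [set: measurableTypeR R] phi.
  by apply: measurable_funM; [exact: measurable_cst | exact: measurable_id].
have ci0 : 0 <= c^-1 by rewrite invr_ge0 ltW.
have := @ge0_integral_pushforward _ _ _ _ R phi mphi mu Rp f (measurable_itv _) mf.
have -> : phi @^-1` Rp = Rp.
  by apply/seteqP; split=> x /=; rewrite !in_itv /= !andbT pmulr_rgt0.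
move=> <-; last by move=> x; rewrite inE /= in_itv /= andbT => /f0.
have -> : (\int[measure_function_pushforward__canonical__measure_function_Measure mu mphi]_(y in Rp) f y =
    \int[mscale (NngNum ci0) mu]_(y in Rp) f y)%E.
  apply: eq_measure_integral => A mA _.
  exact: lebesgue_measure_scale.
by rewrite ge0_integral_mscale //= => x; rewrite in_itv /= andbT => /f0.
Qed.

(** The two domains become indicator factors of the integrand on the whole plane. *)
Lemma tonelli_on (A B : set R) (f : R -> R -> R) : measurable A -> measurable B ->
  measurable_fun setT (fun z : R * R => f z.1 z.2) ->
  (forall x y, A x -> B y -> 0 <= f x y) ->
  (\int[mu]_(x in A) \int[mu]_(y in B) (f x y)%:E =
   \int[mu]_(y in B) \int[mu]_(x in A) (f x y)%:E)%E.
Proof.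
move=> mA mB mf f0.
pose F (z : R * R) : R := f z.1 z.2 * (\1_A z.1 * \1_B z.2).
have mF : measurable_fun setT (EFin \o F).
  apply/measurable_EFinP; apply: measurable_funM => //.
  apply: measurable_funM.
    apply: (@measurableT_comp _ _ _ _ _ _ (\1_A : R -> R) _ (fst : R * R -> R)).
      exact: measurable_indic.
    exact: measurable_fst.
  apply: (@measurableT_comp _ _ _ _ _ _ (\1_B : R -> R) _ (snd : R * R -> R)).
    exact: measurable_indic.
  exact: measurable_snd.
have F0 z : (0 <= (EFin \o F) z)%E.
  rewrite /= lee_fin /F !indicE.
  have [zA|] := boolP (z.1 \in A); last by rewrite mul0r mulr0.
  have [zB|] := boolP (z.2 \in B); last by rewrite !mulr0.
  by rewrite !mulr1 f0 //; exact: set_mem.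
have := fubini_tonelli (m1 := mu) (m2 := mu) _ mF F0.
have inner (D E : set R) (g : R -> R -> R) :
  (\int[mu]_(x in D) \int[mu]_(y in E) (g x y)%:E =
   \int[mu]_x \int[mu]_y (g x y * (\1_D x * \1_E y))%:E)%E.
  rewrite integral_mkcond; apply: eq_integral => x _; rewrite /patch.
  have [xD|xD] := boolP (x \in D).
    rewrite integral_mkcond; apply: eq_integral => y _; rewrite /patch !indicE xD.
    by case: (y \in E); rewrite ?mul1r ?mulr1 ?mulr0.
  by apply/esym; apply: integral0_eq => y _; rewrite indicE (negbTE xD) mul0r mulr0.
move=> e; rewrite (inner A B f) (inner B A (fun y x => f x y)).
by rewrite [LHS]e; apply: eq_integral => y _; apply: eq_integral => x _; rewrite /= /F /= [X in _ * X]mulrC.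
Qed.

Lemma nneseries_EFin (u : nat -> R) (l : R) : series u @ \oo --> l ->
  (\sum_(0 <= n <oo) (u n)%:E = l%:E)%E.
Proof.
move=> h; apply/cvg_lim => //.
have -> : (fun n => \sum_(0 <= i < n) (u i)%:E)%E = EFin \o series u.
  by apply/funext => n; rewrite /series /= sumEFin.
by apply: cvg_EFin => //; exact: nearW.
Qed.

End Transformations.

(** * Euler's integral on the positive reals *)

Section RealGamma.
Variable R : realType.
Local Notation mu := (@lebesgue_measure R).
Local Notation Rp := (`]0, +oo[%classic : set R).
Implicit Types (c x p : R).

Lemma measurable_exp_powR (D : set R) c p : measurable D ->
  measurable_fun D (fun t : R => expR (- (c * t)) * t `^ p).
Proof.
move=> mD; apply: (measurable_funS measurableT) => //.
by apply: measurable_funM; [exact: measurable_expRN | exact: measurable_powR].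
Qed.

Lemma measurable_expR_mul2 :
  measurable_fun setT (fun z : R * R => expR (- (z.1 * z.2))).
Proof.
apply: measurableT_comp; first exact: measurable_expR.
apply: measurableT_comp; first exact: oppr_measurable.
by apply: measurable_funM; [exact: measurable_fst | exact: measurable_snd].
Qed.

Lemma measurable_powR_fst p : measurable_fun setT (fun z : R * R => z.1 `^ p).
Proof.
apply: (@measurableT_comp _ _ _ _ _ _ (@powR R ^~ p) _ (fst : R * R -> R)).
  exact: measurable_powR.
exact: measurable_fst.
Qed.

Lemma measurable_powR_snd p : measurable_fun setT (fun z : R * R => z.2 `^ p).
Proof.
apply: (@measurableT_comp _ _ _ _ _ _ (@powR R ^~ p) _ (snd : R * R -> R)).
  exact: measurable_powR.
exact: measurable_snd.
Qed.

Lemma measurable_expN_powR (D : set R) p : measurable D ->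
  measurable_fun D (fun t : R => expR (- t) * t `^ p).
Proof.
move=> mD; have -> : (fun t : R => expR (- t) * t `^ p) = (fun t => expR (- (1 * t)) * t `^ p).
  by apply/funext => t; rewrite mul1r.
exact: measurable_exp_powR.
Qed.

Lemma ge0_integral_split1 (f : R -> \bar R) : measurable_fun Rp f ->
  (forall t, 0 < t -> (0 <= f t)%E) ->
  (\int[mu]_(t in Rp) f t =
   \int[mu]_(t in `]0%R, 1%R]) f t + \int[mu]_(t in `[1%R, +oo[) f t)%E.
Proof.
move=> mf f0.
have Rp01 : Rp = `]0, 1]%classic `|` `]1, +oo[%classic.
  apply/seteqP; split=> t /=; rewrite !in_itv /= !andbT.
    by move=> t0; have [t1|t1] := lerP t 1; [left; rewrite t0 | right].
  by move=> [/andP[]//|]; exact: lt_trans.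
have mf1 : measurable_fun (`]1, +oo[%classic : set R) f.
  by apply: measurable_funS mf => // t; rewrite Rp01; right.
rewrite -integral_itv_obnd_cbnd // {1}Rp01 ge0_integral_setU //.
- by rewrite -Rp01.
- by rewrite -Rp01 => t /=; rewrite in_itv /= andbT => /f0.
- apply/disj_setPS => t /= []; rewrite !in_itv /= andbT => /andP[_].
  by rewrite leNgt => /negP.
Qed.

(** Extended-valued, the form in which Tonelli's theorem handles it; [Gam] is the real value used
    where it is finite. *)
Definition Gint x : \bar R := \int[mu]_(t in Rp) (expR (- t) * t `^ (x - 1))%:E.
Definition Gam x : R := fine (Gint x).

Lemma Gint_ge0 x : (0 <= Gint x)%E.
Proof. by apply: integral_ge0 => t _; rewrite lee_fin mulr_ge0 ?expR_ge0 ?powR_ge0. Qed.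

Lemma Gint_scale c x : 0 < c ->
  (\int[mu]_(t in Rp) (expR (- (c * t)) * t `^ (x - 1))%:E = (c `^ (- x))%:E * Gint x)%E.
Proof.
move=> c0.
have mf : measurable_fun Rp (fun t : R => expR (- t) * t `^ (x - 1)).
  by apply: measurable_expN_powR; exact: measurable_itv.
pose f (t : R) := ((c `^ (- (x - 1)))%:E * (expR (- t) * t `^ (x - 1))%:E)%E.
have f0 (t : R) : (0 <= (expR (- t) * t `^ (x - 1))%:E)%E.
  by rewrite lee_fin mulr_ge0 ?expR_ge0 ?powR_ge0.
have mfe : measurable_fun Rp (fun t : R => (expR (- t) * t `^ (x - 1))%:E).
  exact/measurable_EFinP.
transitivity (\int[mu]_(t in Rp) f (c * t)%R)%E.
  apply: eq_integral => t; rewrite inE /= in_itv /= andbT => t0.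
  rewrite /f -EFinM; congr EFin.
  rewrite powRM ?(ltW c0) ?(ltW t0) // mulrCA; congr (_ * _).
  by rewrite mulrA -powRD ?addNr ?powRr0 ?mul1r ?(gt_eqF c0) ?implybT //.
rewrite ge0_integral_scale //.
- rewrite /f ge0_integralZl_EFin //; last by rewrite powR_ge0.
  rewrite muleA -EFinM; congr (_%:E * _)%E.
  rewrite -powR_inv1 ?(ltW c0) // -powRD; last by rewrite (gt_eqF c0) implybT.
  by congr (_ `^ _); ring.
- apply: measurable_funeM; exact: mfe.
- by move=> t _; apply: mule_ge0 => //; rewrite lee_fin powR_ge0.
Qed.

(** The series of [expR t] is at least its term of degree [n.+1]. *)
Lemma expR_powR_le (n : nat) (t : R) : 0 < t -> expR (- t) <= n.+1`!%:R * t `^ (- n.+1%:R).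
Proof.
move=> t0; rewrite expRN powR_invn ?(ltW t0) //.
have h : t ^+ n.+1 / n.+1`!%:R <= expR t.
  have := exp_coeff_bound n.+2 (ltW t0); rewrite big_nat_recr //=.
  apply: le_trans; rewrite lerDr sumr_ge0 // => i _.
  by rewrite divr_ge0 // exprn_ge0 // ltW.
rewrite -[leLHS]div1r ler_pdivrMr ?expR_gt0 //.
have h1 : n.+1`!%:R / t ^+ n.+1 * (t ^+ n.+1 / n.+1`!%:R) = 1.
  by field; rewrite fact_neq0 expf_neq0 // gt_eqF.
by rewrite -[leLHS]h1 ler_wpM2l // divr_ge0 // exprn_ge0 // ltW.
Qed.

Lemma Gint_lty x : 0 < x -> (Gint x < +oo)%E.
Proof.
move=> x0; have mR : measurable Rp by exact: measurable_itv.
have mf (D : set R) : measurable D ->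
    measurable_fun D (fun t : R => (expR (- t) * t `^ (x - 1))%:E).
  by move=> mD; apply/measurable_EFinP; exact: measurable_expN_powR.
have f0 (t : R) : (0 <= (expR (- t) * t `^ (x - 1))%:E)%E.
  by rewrite lee_fin mulr_ge0 ?expR_ge0 ?powR_ge0.
rewrite /Gint ge0_integral_split1 //; last exact: mf.
apply: lte_add_pinfty.
- apply: (@le_lt_trans _ _ (\int[mu]_(t in `]0%R, 1%R]) (t `^ (x - 1))%:E)%E).
    apply: ge0_le_integral => //.
    + by apply: mf; exact: measurable_itv.
    + by apply/measurable_EFinP; apply: measurable_powRD; exact: measurable_itv.
    + move=> t /=; rewrite in_itv /= => /andP[t0 _]; rewrite lee_fin.
      by rewrite ler_piMl ?powR_ge0 // expR_le1 oppr_le0 ltW.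
  by rewrite integral_powR_0_1 ?ltry // ltrBrDl subrr.
(* Any degree beyond [x] makes the exponent [q] of the majorant at infinity smaller than -1. *)
- have [n _ hn] := nbhs_infty_gtr x; have {hn} xn := hn n (leqnn n).
  have xn1 : x < n.+1%:R by apply: lt_trans xn _; rewrite ltr_nat.
  pose q := x - 1 - n.+1%:R.
  have q1 : q < -1 by rewrite /q; lra.
  apply: (@le_lt_trans _ _ (\int[mu]_(t in `[1%R, +oo[) ((n.+1`!%:R)%:E * (t `^ q)%:E))%E).
    apply: ge0_le_integral => //.
    + by apply: mf; exact: measurable_itv.
    + apply: measurable_funeM; apply/measurable_EFinP.
      by apply: measurable_powRD; exact: measurable_itv.
    + move=> t /=; rewrite in_itv /= andbT => t1; rewrite -EFinM lee_fin.
      have t0 : 0 < t by exact: lt_le_trans t1.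
      have -> : t `^ q = t `^ (- n.+1%:R) * t `^ (x - 1).
        by rewrite -powRD ?(gt_eqF t0) ?implybT // addrC.
      by rewrite mulrA ler_wpM2r ?powR_ge0 // expR_powR_le.
  rewrite ge0_integralZl_EFin //.
  + by rewrite integral_powR_1_y // -EFinM ltry.
  + by move=> t _; rewrite lee_fin powR_ge0.
  + by apply/measurable_EFinP; apply: measurable_powRD; exact: measurable_itv.
Qed.

Lemma GintE x : 0 < x -> Gint x = (Gam x)%:E.
Proof. by move=> x0; rewrite /Gam fineK // ge0_fin_numE ?Gint_ge0 // Gint_lty. Qed.

(** Tonelli's theorem for e^(- c t) t^x over [c >= 1] and [t > 0]. Integrating in [c] first leaves
    the integrand of Gamma (x); integrating in [t] first leaves Gamma (x + 1) c^(- (x + 1)), whose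
    integral is Gamma (x + 1) / x. *)
Lemma Gint_add1 x : 0 < x -> Gint (x + 1) = (x%:E * Gint x)%E.
Proof.
move=> x0.
pose f (c t : R) := expR (- (c * t)) * t `^ x.
have mf : measurable_fun setT (fun z : R * R => f z.1 z.2).
  by apply: measurable_funM; [exact: measurable_expR_mul2 | exact: measurable_powR_snd].
have f0 c t : 0 <= f c t by rewrite mulr_ge0 ?expR_ge0 ?powR_ge0.
have mo : measurable (`[1, +oo[%classic : set R) by exact: measurable_itv.
have mR : measurable Rp by exact: measurable_itv.
have := tonelli_on mo mR mf (fun c t _ _ => f0 c t).
have -> : (\int[mu]_(c in `[1%R, +oo[) \int[mu]_(t in Rp) (f c t)%:E =
   (x^-1)%:E * Gint (x + 1))%E.
  transitivity (\int[mu]_(c in `[1%R, +oo[) ((c `^ (- (x + 1)))%:E * Gint (x + 1)))%E.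
    apply: eq_integral => c; rewrite inE /= in_itv /= andbT => c1.
    by rewrite -Gint_scale ?(lt_le_trans ltr01) // addrK.
  rewrite ge0_integralZr //.
  - rewrite integral_powR_1_y; last by rewrite ltrN2 ltrDr.
    by congr (_%:E * _)%E; rewrite opprD subrK invrN opprK.
  - by apply/measurable_EFinP; exact: measurable_powRD.
  - by move=> c _; rewrite lee_fin powR_ge0.
  - exact: Gint_ge0.
have -> : (\int[mu]_(t in Rp) \int[mu]_(c in `[1%R, +oo[) (f c t)%:E = Gint x)%E.
  apply: eq_integral => t; rewrite inE /= in_itv /= andbT => t0.
  under eq_integral do rewrite /f mulrC [_ * t]mulrC EFinM.
  rewrite ge0_integralZl_EFin //.
  - rewrite integral_expR_cy // mulr1 -EFinM; congr EFin.
    by rewrite mulrCA -powR_inv1 ?(ltW t0) // -powRD // (gt_eqF t0) implybT.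
  - apply/measurable_EFinP; apply: (measurable_funS measurableT) => //.
    exact: measurable_expRN.
  - exact: powR_ge0.
move=> <-; rewrite muleA -EFinM mulfV ?mul1e // gt_eqF //.
Qed.

Lemma Gam_add1 x : 0 < x -> Gam (x + 1) = x * Gam x.
Proof. by move=> x0; rewrite /Gam Gint_add1 // fineM // GintE. Qed.

Lemma Gam_reflection_int x : 0 < x < 1 ->
  (\int[mu]_(v in Rp) (v `^ (x - 1) / (1 + v))%:E = (Gam x * Gam (1 - x))%:E)%E.
Proof.
move=> /andP[x0 x1]; have x1' : 0 < 1 - x by rewrite subr_gt0.
(* The exponent of [t] is 0, left unreduced so that the factor [t ^ (- x)] from the scaled integral
   in [v] brings it to [1 - x - 1]. Integrating in [t] first gives instead [1 / (1 + v)]. *)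
pose f (t v : R) := (expR (- t) * t `^ (1 - x - 1 + x)) * (expR (- (t * v)) * v `^ (x - 1)).
have f0 c t : 0 <= f c t by rewrite !mulr_ge0 ?expR_ge0 ?powR_ge0.
have mf : measurable_fun setT (fun z : R * R => f z.1 z.2).
  apply: measurable_funM; apply: measurable_funM.
  - apply: measurableT_comp; first exact: measurable_expR.
    by apply: measurableT_comp; [exact: oppr_measurable | exact: measurable_fst].
  - exact: measurable_powR_fst.
  - exact: measurable_expR_mul2.
  - exact: measurable_powR_snd.
have mR : measurable Rp by exact: measurable_itv.
have := tonelli_on mR mR mf (fun c t _ _ => f0 c t).
have -> : (\int[mu]_(t in Rp) \int[mu]_(v in Rp) (f t v)%:E =
   (Gam x * Gam (1 - x))%:E)%E.
  transitivity (\int[mu]_(t in Rp) ((expR (- t) * t `^ (1 - x - 1))%:E * Gint x))%E.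
    apply: eq_integral => t; rewrite inE /= in_itv /= andbT => t0.
    under eq_integral do rewrite EFinM.
    rewrite ge0_integralZl_EFin //.
    - rewrite Gint_scale // muleA -EFinM -mulrA -powRD ?(gt_eqF t0) ?implybT //.
      by rewrite addrK.
    - by move=> v _; rewrite lee_fin mulr_ge0 ?expR_ge0 ?powR_ge0.
    - by apply/measurable_EFinP; exact: measurable_exp_powR.
    - by rewrite mulr_ge0 ?expR_ge0 ?powR_ge0.
  rewrite ge0_integralZr //.
  - by rewrite -/(Gint (1 - x)) !GintE // -EFinM mulrC.
  - by apply/measurable_EFinP; exact: measurable_expN_powR.
  - by move=> v _; rewrite lee_fin mulr_ge0 ?expR_ge0 ?powR_ge0.
  - exact: Gint_ge0.
move=> ->; apply: eq_integral => v; rewrite inE /= in_itv /= andbT => v0.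
have v1 : 0 < 1 + v by rewrite addr_gt0.
transitivity (\int[mu]_(t in Rp) ((v `^ (x - 1))%:E * (expR (- ((1 + v) * t)))%:E))%E.
  rewrite ge0_integralZl_EFin ?powR_ge0 //.
    by rewrite integral_expR_0y.
  apply/measurable_EFinP; apply: (measurable_funS measurableT) => //.
  exact: measurable_expRN.
apply: eq_integral => t _; rewrite -EFinM; congr EFin.
have e0 : 1 - x - 1 + x = 0 by ring.
rewrite /f e0 powRr0 mulr1 mulrA -expRD mulrC; congr (expR _ * _).
by rewrite mulrDl mul1r opprD [v * t]mulrC.
Qed.

End RealGamma.

(** * The real integrals behind the reflection formula and the functional equation *)

Section MellinIntegrals.
Variable R : realType.
Local Notation mu := (@lebesgue_measure R).
Local Notation Rp := (`]0, +oo[%classic : set R).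
Implicit Types (a p q s : R).

Lemma ge0_integral_sub (D : set R) (f g : R -> R) (x y : R) : measurable D ->
  measurable_fun D f -> measurable_fun D g ->
  (forall t, D t -> 0 <= g t) -> (forall t, D t -> g t <= f t) ->
  (\int[mu]_(t in D) (f t)%:E = x%:E)%E -> (\int[mu]_(t in D) (g t)%:E = y%:E)%E ->
  (\int[mu]_(t in D) (f t - g t)%:E = (x - y)%:E)%E.
Proof.
move=> mD mf mg g0 gf fx gy.
have : (\int[mu]_(t in D) ((f t - g t)%:E + (g t)%:E) = x%:E)%E.
  by rewrite -fx; apply: eq_integral => t _; rewrite -EFinD subrK.
rewrite ge0_integralD //.
- by rewrite gy EFinB => <-; rewrite addeK.
- by move=> t Dt; rewrite lee_fin subr_ge0 gf.
- by apply/measurable_EFinP; exact: measurable_funB.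
- exact/measurable_EFinP.
Qed.

Lemma integral_powR_sub_0_1 p q : -1 < p -> p <= q ->
  (\int[mu]_(x in `]0%R, 1%R]) (x `^ p - x `^ q)%:E = ((p + 1)^-1 - (q + 1)^-1)%:E)%E.
Proof.
move=> p1 pq; apply: ge0_integral_sub.
- exact: measurable_itv.
- by apply: measurable_powRD; exact: measurable_itv.
- by apply: measurable_powRD; exact: measurable_itv.
- by move=> t _; exact: powR_ge0.
- by move=> t /=; rewrite in_itv /= => t01; exact: ger_powR.
- exact: integral_powR_0_1.
- by apply: integral_powR_0_1; exact: lt_le_trans pq.
Qed.

Lemma integral_powR_sub_1_y p q : p < -1 -> q <= p ->
  (\int[mu]_(x in `[1%R, +oo[) (x `^ p - x `^ q)%:E = ((- p - 1)^-1 - (- q - 1)^-1)%:E)%E.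
Proof.
move=> p1 pq; have -> : (- p - 1)^-1 - (- q - 1)^-1 = - (p + 1)^-1 - - (q + 1)^-1.
  by rewrite -!opprD !invrN; ring.
apply: ge0_integral_sub.
- exact: measurable_itv.
- by apply: measurable_powRD; exact: measurable_itv.
- by apply: measurable_powRD; exact: measurable_itv.
- by move=> t _; exact: powR_ge0.
- by move=> t /=; rewrite in_itv /= andbT => t01; exact: ler_powR.
- exact: integral_powR_1_y.
- by apply: integral_powR_1_y; exact: le_lt_trans p1.
Qed.

(** The alternating series is taken two terms at a time, so that its terms are nonnegative and it
    can be integrated term by term without a dominating function. *)
Lemma series_alt_geometric q : 0 <= q < 1 ->
  series (fun n => q ^+ n.*2 - q ^+ n.*2.+1) @ \oo --> (1 + q)^-1.
Proof.
move=> /andP[q0 q1]; have q0' : 0 < 1 + q by rewrite ltr_pwDl.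
have -> : series (fun n => q ^+ n.*2 - q ^+ n.*2.+1) = (fun n => (1 - (q ^+ 2) ^+ n) / (1 + q)).
  apply/funext => n; rewrite /series /=; elim: n => [|n IH].
    by rewrite big_geq // expr0 subrr mul0r.
  rewrite big_nat_recr //= IH -!exprM !mul2n doubleS !exprS; field.
  by rewrite gt_eqF.
rewrite -[X in _ --> X]mul1r; apply: cvgM; last exact: cvg_cst.
have : (fun n => 1 - (q ^+ 2) ^+ n) @ \oo --> 1 - (0 : R).
  apply: cvgB; first exact: cvg_cst.
  apply: cvg_expr; rewrite ger0_norm ?exprn_ge0 //.
  by rewrite exprn_ilt1.
by rewrite subr0.
Qed.

Lemma nneseries_alt_geometric (c q : R) : 0 <= q < 1 ->
  (\sum_(0 <= n <oo) (c * (q ^+ n.*2 - q ^+ n.*2.+1))%:E = (c / (1 + q))%:E)%E.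
Proof.
move=> q01; apply: nneseries_EFin.
have -> : series (fun n => c * (q ^+ n.*2 - q ^+ n.*2.+1)) =
    (fun n => c * series (fun n => q ^+ n.*2 - q ^+ n.*2.+1) n).
  by apply/funext => n; rewrite /series /= mulr_sumr.
by apply: cvgM; [exact: cvg_cst | exact: series_alt_geometric].
Qed.

Lemma measurable_invr_ge0 (D : set R) (g : R -> R) : (forall v, 0 <= g v) ->
  measurable_fun D g -> measurable_fun D (fun v : R => (g v)^-1).
Proof.
move=> g0 mg; have -> : (fun v : R => (g v)^-1) = (@powR R ^~ (-1)) \o g.
  by apply/funext => v /=; rewrite powR_inv1.
by apply: measurableT_comp => //; exact: measurable_powR.
Qed.

Lemma measurable_powR_div1 (D : set R) p q : measurable D ->
  measurable_fun D (fun v : R => v `^ q / (1 + v `^ p)).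
Proof.
move=> mD; apply: (measurable_funS measurableT) => //.
apply: measurable_funM; first exact: measurable_powR.
apply: measurable_invr_ge0; first by move=> v; rewrite addr_ge0 // powR_ge0.
by apply: measurable_funD; [exact: measurable_cst | exact: measurable_powR].
Qed.

(** The geometric series in [v ^ p] on []0, 1[] and in [v ^ (- p)] on []1, +oo[] integrate to the
    two halves of [csc_term], up to [p^-1]. The reflection formula takes [p = 1], the kernel of the
    functional equation [p = 2]. *)
Lemma integral_powR_div1 p a : 0 < p -> 0 < a < 1 ->
  (\int[mu]_(v in Rp) (v `^ (p * a - 1) / (1 + v `^ p))%:E =
    (p^-1 * (pi / sin (pi * a)))%:E)%E.
Proof.
move=> p0 /andP[a0 a1]; have pa : 0 < p * a by rewrite mulr_gt0.
have m01 : measurable (`]0%R, 1%R] : set R) by exact: measurable_itv.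
have m1y : measurable (`[1%R, +oo[ : set R) by exact: measurable_itv.
have one_p : (1 : R) `^ p = 1 by rewrite powR1.
have powX (v r : R) k : (v `^ r) ^+ k = v `^ (r * k%:R).
  by rewrite powRrM powR_mulrn // powR_ge0.
rewrite ge0_integral_split1; last 2 first.
- by apply/measurable_EFinP; apply: measurable_powR_div1; exact: measurable_itv.
- by move=> v _; rewrite lee_fin divr_ge0 ?addr_ge0 ?powR_ge0.
pose al n : R := p * a - 1 + p * n.*2%:R.
pose be n : R := p * a - 1 + p * n.*2.+1%:R.
have al1 n : -1 < al n.
  have : 0 <= p * n.*2%:R by rewrite mulr_ge0 // ltW.
  by rewrite /al; lra.
have al_be n : al n <= be n.
  by rewrite /al /be lerD2l ler_pM2l // ler_nat.
have I1 : (\int[mu]_(v in `]0%R, 1%R]) (v `^ (p * a - 1) / (1 + v `^ p))%:E =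
    \sum_(0 <= n <oo) ((al n + 1)^-1 - (be n + 1)^-1)%:E)%E.
  have mm n : measurable_fun (`]0, 1]%classic : set R) (fun v : R => v `^ al n - v `^ be n).
    by apply: measurable_funB; exact: measurable_powRD.
  (* At [v = 1] the paired series sums to 0 and not to 1/2, so the endpoint is removed before
     expanding. *)
  transitivity (\int[mu]_(v in `]0%R, 1%R[) (v `^ (p * a - 1) / (1 + v `^ p))%:E)%E.
    apply/esym; apply: integral_itv_bndo_bndc; apply/measurable_EFinP.
    by apply: measurable_powR_div1; exact: measurable_itv.
  transitivity (\int[mu]_(v in `]0%R, 1%R[) (\sum_(0 <= n <oo) (v `^ al n - v `^ be n)%:E))%E.
    apply: eq_integral => v; rewrite inE /= in_itv /= => /andP[v0 v1].
    have q1 : v `^ p < 1.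
      by rewrite -[ltRHS]one_p gt0_ltr_powR // ?nnegrE // ?ltW.
    rewrite -(nneseries_alt_geometric (v `^ (p * a - 1)) (q := v `^ p)) ?powR_ge0 //.
    apply: eq_eseriesr => n _; congr EFin.
    by rewrite mulrBr !powX /al /be -!powRD // (gt_eqF v0) implybT.
  rewrite integral_nneseries //.
  - apply: eq_eseriesr => n _; rewrite integral_itv_bndo_bndc.
      exact: integral_powR_sub_0_1.
    by apply/measurable_EFinP; apply: measurable_funS (mm n) => // v /=;
      rewrite !in_itv /= => /andP[-> /ltW].
  - by move=> n; apply/measurable_EFinP; apply: measurable_funS (mm n) => // v /=;
      rewrite !in_itv /= => /andP[-> /ltW].
  - move=> n v /=; rewrite in_itv /= => /andP[v0 v1].
    by rewrite lee_fin subr_ge0 ger_powR // v0 ltW.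
pose ga n : R := p * a - 1 - p - p * n.*2%:R.
pose de n : R := p * a - 1 - p - p * n.*2.+1%:R.
have ga1 n : ga n < -1.
  have : 0 <= p * n.*2%:R by rewrite mulr_ge0 // ltW.
  have : p * a < p by rewrite gtr_pMr.
  by rewrite /ga; lra.
have de_ga n : de n <= ga n.
  by rewrite /ga /de lerD2l lerN2 ler_pM2l // ler_nat.
have I2 : (\int[mu]_(v in `[1%R, +oo[) (v `^ (p * a - 1) / (1 + v `^ p))%:E =
    \sum_(0 <= n <oo) ((- ga n - 1)^-1 - (- de n - 1)^-1)%:E)%E.
  have mm n : measurable_fun (`[1, +oo[%classic : set R) (fun v : R => v `^ ga n - v `^ de n).
    by apply: measurable_funB; exact: measurable_powRD.
  transitivity (\int[mu]_(v in `]1%R, +oo[) (v `^ (p * a - 1) / (1 + v `^ p))%:E)%E.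
    apply/esym; apply: integral_itv_obnd_cbnd; apply/measurable_EFinP.
    by apply: measurable_powR_div1; exact: measurable_itv.
  transitivity (\int[mu]_(v in `]1%R, +oo[) (\sum_(0 <= n <oo) (v `^ ga n - v `^ de n)%:E))%E.
    apply: eq_integral => v; rewrite inE /= in_itv /= andbT => v1.
    have v0 : 0 < v by exact: lt_trans v1.
    have q1 : v `^ (- p) < 1.
      rewrite powRN invf_lt1 ?powR_gt0 //.
      by rewrite -[ltLHS]one_p gt0_ltr_powR // ?nnegrE // ltW.
    have -> : v `^ (p * a - 1) / (1 + v `^ p) = v `^ (p * a - 1 - p) / (1 + v `^ (- p)).
      rewrite (@powRB _ _ (p * a - 1)) ?(gt_eqF v0) ?implybT // powRN.
      have vp : 0 < v `^ p by rewrite powR_gt0.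
      by field; rewrite !gt_eqF // addr_gt0.
    rewrite -(nneseries_alt_geometric (v `^ (p * a - 1 - p)) (q := v `^ (- p))) ?powR_ge0 //.
    apply: eq_eseriesr => n _; congr EFin.
    by rewrite mulrBr !powX /ga /de !mulNr -!powRD // (gt_eqF v0) implybT.
  rewrite integral_nneseries //.
  - apply: eq_eseriesr => n _; rewrite integral_itv_obnd_cbnd.
      exact: integral_powR_sub_1_y.
    by apply/measurable_EFinP; apply: measurable_funS (mm n) => // v /=;
      rewrite !in_itv /= !andbT => /ltW.
  - by move=> n; apply/measurable_EFinP; apply: measurable_funS (mm n) => // v /=;
      rewrite !in_itv /= !andbT => /ltW.
  - move=> n v /=; rewrite in_itv /= andbT => v1.
    by rewrite lee_fin subr_ge0 ler_powR // ltW.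
rewrite I1 I2 -nneseriesD; last 2 first.
- move=> n _ _; rewrite lee_fin subr_ge0 lef_pV2 ?posrE.
  + by rewrite lerD2r.
  + by have := al1 n; have := al_be n; lra.
  + by have := al1 n; lra.
- move=> n _ _; rewrite lee_fin subr_ge0 lef_pV2 ?posrE.
  + by rewrite lerD2r lerN2.
  + by have := ga1 n; have := de_ga n; lra.
  + by have := ga1 n; lra.
rewrite (eq_eseriesr (g := fun n => (p^-1 * csc_term a n)%:E)); last first.
  move=> n _; rewrite -EFinD; congr EFin.
  have h (x y : R) : y = p * x -> y^-1 = p^-1 * x^-1 by move=> ->; rewrite invfM.
  rewrite /csc_term.
  rewrite (h (n.*2%:R + a) (al n + 1)); last by rewrite /al; ring.
  rewrite (h (n.*2.+1%:R + a) (be n + 1)); last by rewrite /be; ring.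
  rewrite (h (n.*2.+1%:R - a) (- ga n - 1)); last by rewrite /ga -natr1; ring.
  rewrite (h (n.*2.+2%:R - a) (- de n - 1)); last by rewrite /de -[n.*2.+2%:R]natr1; ring.
  by ring.
apply: nneseries_EFin.
have -> : series (fun n => p^-1 * csc_term a n) = (fun n => p^-1 * series (csc_term a) n).
  by apply/funext => n; rewrite /series /= mulr_sumr.
apply: cvgM; first exact: cvg_cst.
by apply: csc_expansion; rewrite a0.
Qed.

Lemma Gam_reflection a : 0 < a < 1 -> Gam a * Gam (1 - a) = pi / sin (pi * a).
Proof.
move=> a01; have := Gam_reflection_int a01.
have := integral_powR_div1 ltr01 a01; rewrite invr1 !mul1r => h1 h2.
suff : (Gam a * Gam (1 - a))%:E = (pi / sin (pi * a))%:E by move=> [].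
rewrite -h1 -h2; apply: eq_integral => v; rewrite inE /= in_itv /= andbT => v0.
by rewrite powRr1 // ltW.
Qed.

(* Expand [1 / (e^t - 1)] as a geometric series. *)
Lemma integral_bose s : 1 < s ->
  (\int[mu]_(t in Rp) (t `^ (s - 1) / (expR t - 1))%:E =
    (\sum_(0 <= n <oo) (n.+1%:R `^ (- s))%:E) * (Gam s)%:E)%E.
Proof.
move=> s1; have s0 : 0 < s by exact: lt_trans s1.
transitivity (\int[mu]_(t in Rp) (\sum_(0 <= n <oo) (expR (- (n.+1%:R * t)) * t `^ (s - 1))%:E))%E.
  apply: eq_integral => t; rewrite inE /= in_itv /= andbT => t0.
  apply/esym; apply: nneseries_EFin.
  have e1 : expR (- t) < 1 by rewrite expR_lt1 oppr_lt0.
  have e2 : expR t - 1 != 0 by rewrite subr_eq0 gt_eqF // expR_gt1.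
  have -> : series (fun n => expR (- (n.+1%:R * t)) * t `^ (s - 1)) =
      (fun n => (1 - expR (- t) ^+ n) * (t `^ (s - 1) / (expR t - 1))).
    apply/funext => n; rewrite /series /=; elim: n => [|n IH].
      by rewrite big_geq // expr0 subrr mul0r.
    rewrite big_nat_recr //= IH -mulrN expRM_natl exprS expRN.
    by field; rewrite e2 gt_eqF // expR_gt0.
  rewrite -[X in _ --> X]mul1r; apply: cvgM; last exact: cvg_cst.
  have : (fun n => 1 - expR (- t) ^+ n) @ \oo --> 1 - (0 : R).
    apply: cvgB; first exact: cvg_cst.
    by apply: cvg_expr; rewrite ger0_norm ?expR_ge0.
  by rewrite subr0.
rewrite integral_nneseries //; last 2 first.
- by move=> n; apply/measurable_EFinP; apply: measurable_exp_powR; exact: measurable_itv.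
- by move=> n t _; rewrite lee_fin mulr_ge0 ?expR_ge0 ?powR_ge0.
rewrite muleC -nneseriesZl; last by move=> n _; rewrite lee_fin powR_ge0.
by apply: eq_eseriesr => n _; rewrite Gint_scale // muleC GintE.
Qed.

(** The kernel 1 / (e^t - 1) without the first two terms [1 / t] and [- 1 / 2] of its Laurent
    expansion at 0. It is of order [t] at 0 and tends to 1/2 at infinity, hence the strip
    [-1 < s < 0] of its Mellin integral. *)
Definition bern (t : R) : R := (expR t - 1)^-1 - t^-1 + 2^-1.

(** The substitution [t = k v] reduces it to [integral_powR_div1] with [p = 2] and
    [a = (s + 1) / 2], for which [p * a - 1 = s]. *)
Lemma integral_cauchy_powR (k s : R) : 0 < k -> -1 < s < 0 ->
  (\int[mu]_(t in Rp) (t `^ (s - 1) * (2 * t / (t ^+ 2 + k ^+ 2)))%:E =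
    (k `^ (s - 1) * (pi / sin (pi * ((s + 1) / 2))))%:E)%E.
Proof.
move=> k0 /andP[s0 s1].
have a01 : 0 < (s + 1) / 2 < 1 by apply/andP; split; lra.
have := integral_powR_div1 (ltr0n R 2 : 0 < 2 :> R) a01.
have -> : 2 * ((s + 1) / 2) - 1 = s by field.
pose f (v : R) : \bar R := ((2 * k `^ s / k ^+ 2)%:E * (v `^ s / (1 + v `^ 2))%:E)%E.
have f0 v : (0 <= (v `^ s / (1 + v `^ 2))%:E)%E.
  by rewrite lee_fin divr_ge0 ?addr_ge0 ?powR_ge0.
have mf : measurable_fun Rp (fun v : R => (v `^ s / (1 + v `^ 2))%:E).
  by apply/measurable_EFinP; apply: measurable_powR_div1; exact: measurable_itv.
have c0 : 0 <= 2 * k `^ s / k ^+ 2.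
  by rewrite divr_ge0 // ?sqr_ge0 // mulr_ge0 // powR_ge0.
have ki0 : 0 < k^-1 by rewrite invr_gt0.
have sc : (\int[mu]_(t in Rp) f (k^-1 * t)%R = (k^-1)^-1%:E * \int[mu]_(t in Rp) f t)%E.
  apply: ge0_integral_scale => //.
  - by apply: measurable_funeM.
  - by move=> t _; rewrite /f; apply: mule_ge0 => //; rewrite lee_fin; exact: c0.
move=> h.
transitivity (\int[mu]_(t in Rp) f (k^-1 * t)%R)%E.
  apply: eq_integral => t; rewrite inE /= in_itv /= andbT => t0.
  rewrite /f -!EFinM; congr EFin.
  have -> : t `^ (s - 1) = t `^ s / t.
    by rewrite powRD ?(gt_eqF t0) ?implybT // powR_inv1 ?ltW.
  rewrite (powRM s (ltW ki0) (ltW t0)) powR_mulrn; last by apply: mulr_ge0; exact: ltW.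
  have -> : k^-1 `^ s = (k `^ s)^-1.
    by rewrite -powR_inv1 ?(ltW k0) // -powRrM mulN1r powRN.
  have ks : 0 < k `^ s by rewrite powR_gt0.
  have kt : 0 < t ^+ 2 + k ^+ 2 by rewrite addr_gt0 // exprn_gt0.
  have kt' : 0 < k ^+ 2 + t ^+ 2 by rewrite addrC.
  by field; rewrite !gt_eqF.
rewrite sc /f (ge0_integralZl_EFin mu (measurable_itv _) (fun v _ => f0 v) mf c0).
rewrite h -!EFinM; congr EFin.
have -> : k `^ (s - 1) = k `^ s / k.
  by rewrite powRD ?(gt_eqF k0) ?implybT // powR_inv1 ?ltW.
have si0 : 0 < sin (pi * ((s + 1) / 2)).
  by have pi0 := pi_gt0 R; apply: sin_gt0_pi; apply/andP; split; nra.
move: (pi * ((s + 1) / 2)) si0 => z z0.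
by field; rewrite !gt_eqF.
Qed.

Lemma integral_bern s : -1 < s < 0 ->
  (\int[mu]_(t in Rp) (t `^ (s - 1) * bern t)%:E =
    (\sum_(0 <= n <oo) ((2 * pi * n.+1%:R) `^ (s - 1))%:E) *
    (pi / sin (pi * ((s + 1) / 2)))%:E)%E.
Proof.
move=> s01; have pi0 := pi_gt0 R.
have k0 (n : nat) : 0 < 2 * pi * n.+1%:R :> R by rewrite !mulr_gt0.
transitivity (\int[mu]_(t in Rp) (\sum_(0 <= n <oo)
   (t `^ (s - 1) * (2 * t / (t ^+ 2 + (2 * pi * n.+1%:R) ^+ 2)))%:E))%E.
  apply: eq_integral => t; rewrite inE /= in_itv /= andbT => t0.
  apply/esym; apply: nneseries_EFin.
  pose u (n : nat) : R := 2 * t / (t ^+ 2 + (2 * pi * n.+1%:R) ^+ 2).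
  change (series (fun n => t `^ (s - 1) * u n) @ \oo --> t `^ (s - 1) * bern t).
  have -> : series (fun n => t `^ (s - 1) * u n) = (fun n => t `^ (s - 1) * series u n).
    by apply/funext => n; rewrite /series /= mulr_sumr.
  by apply: cvgM; [exact: cvg_cst | exact: coth_expansion_real].
rewrite integral_nneseries //; last 2 first.
- move=> n; apply/measurable_EFinP; apply: (measurable_funS measurableT) => //.
  apply: measurable_funM; first exact: measurable_powR.
  apply: measurable_funM.
    by apply: measurable_funM; [exact: measurable_cst | exact: measurable_id].
  apply: measurable_invr_ge0; first by move=> v; rewrite addr_ge0 // sqr_ge0.
  apply: measurable_funD; last exact: measurable_cst.
  exact: exprn_measurable.
- move=> n t /=; rewrite in_itv /= andbT => t0.
  by rewrite lee_fin mulr_ge0 ?powR_ge0 // divr_ge0 // ?mulr_ge0 ?(ltW t0) // addr_ge0 // sqr_ge0.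
rewrite muleC -nneseriesZl; last by move=> n _; rewrite lee_fin powR_ge0.
by apply: eq_eseriesr => n _; rewrite integral_cauchy_powR // -EFinM mulrC.
Qed.

End MellinIntegrals.

(** * Term-by-term integration of a dominated series *)

Section DominatedSeries.
Variable R : realType.
Local Notation mu := (@lebesgue_measure R).
Local Notation Rp := (`]0, +oo[%classic : set R).
Local Notation Rint f := (\int[mu]_(t in Rp) f t)%R.

Let mRp : measurable Rp. Proof. exact: measurable_itv. Qed.

Lemma Rint_sum (u : nat -> R -> R) N : (forall k, mu.-integrable Rp (EFin \o u k)) ->
  mu.-integrable Rp (EFin \o (fun t => \sum_(0 <= k < N) u k t)) /\
  Rint (fun t => \sum_(0 <= k < N) u k t) = \sum_(0 <= k < N) Rint (u k).
Proof.
move=> iu; elim: N => [|N [IH1 IH2]].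
  have -> : (fun t : R => \sum_(0 <= k < 0) u k t) = (fun=> 0).
    by apply/funext => t; rewrite big_geq.
  by rewrite big_geq // Rintegral_cst // mul0r; split => //; exact: integrable0.
have -> : (fun t : R => \sum_(0 <= k < N.+1) u k t) =
    (fun t => \sum_(0 <= k < N) u k t + u N t).
  by apply/funext => t; rewrite big_nat_recr.
rewrite big_nat_recr //= -IH2 -RintegralD //; split => //.
have -> : EFin \o (fun t : R => \sum_(0 <= k < N) u k t + u N t) =
    ((EFin \o (fun t : R => (\sum_(0 <= k < N) u k t)%R)) \+ (EFin \o u N))%E.
  by apply/funext => t /=; rewrite EFinD.
by apply: integrableD.
Qed.

(** Dominated convergence for the partial sums. The third conclusion supplies the absolute bound
    that [ps_coef] asks of the integrated coefficients. *)
Lemma dominated_series (u : nat -> R -> R) (f D : R -> R) :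
  (forall n, measurable_fun Rp (u n)) -> mu.-integrable Rp (EFin \o D) ->
  (forall t N, 0 < t -> \sum_(0 <= k < N) `|u k t| <= D t) ->
  (forall t, 0 < t -> series (u^~ t) @ \oo --> f t) ->
  [/\ forall k, mu.-integrable Rp (EFin \o u k),
      series (fun k => Rint (u k)) @ \oo --> Rint f &
      forall N, \sum_(0 <= k < N) `|Rint (u k)| <= Rint D].
Proof.
move=> mu_ iD uD uf.
have D0 t : 0 < t -> 0 <= D t by move=> t0; have := uD t 0%N t0; rewrite big_geq.
have u1 k t : 0 < t -> `|u k t| <= D t.
  move=> t0; apply: le_trans (uD t k.+1 t0).
  by rewrite big_nat_recr //= lerDr sumr_ge0.
have iu k : mu.-integrable Rp (EFin \o u k).
  apply: (@le_integrable _ _ _ mu Rp mRp _ (EFin \o D) _ _ iD); first by apply/measurable_EFinP; exact: mu_.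
  move=> t /=; rewrite in_itv /= andbT => t0.
  by rewrite lee_fin [`|D t|]ger0_norm ?D0 // u1.
have iun k : mu.-integrable Rp (EFin \o (fun t => `|u k t|)).
  exact: integrable_abse (iu k).
split=> //; last first.
  move=> N; apply: (@le_trans _ _ (\sum_(0 <= k < N) Rint (fun t => `|u k t|))).
    by apply: ler_sum => k _; exact: le_normr_Rintegral.
  have [i1 <-] := Rint_sum N iun.
  by apply: le_Rintegral => // t /=; rewrite in_itv /= andbT; exact: uD.
pose S N t := \sum_(0 <= k < N) u k t.
have mS N : measurable_fun Rp (S N).
  by have [/integrableP[/measurable_EFinP]] := Rint_sum N iu.
have mf : measurable_fun Rp f.
  apply: measurable_fun_cvg mS _ => t /=; rewrite in_itv /= andbT; exact: uf.
have [] := @dominated_convergence _ _ R mu Rp mRp (fun N => EFin \o S N) (EFin \o f) (EFin \o D).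
- by move=> N; apply/measurable_EFinP; exact: mS.
- by apply/measurable_EFinP; exact: mf.
- apply: aeW => t /=; rewrite in_itv /= andbT => t0.
  by apply: cvg_EFin; [exact: nearW | exact: uf].
- exact: iD.
- apply: aeW => t N /=; rewrite in_itv /= andbT => t0; rewrite lee_fin.
  by apply: le_trans (ler_norm_sum _ _ _) _; exact: uD.
move=> i_f _ cv.
have fin_f : (\int[mu]_(t in Rp) (f t)%:E)%E \is a fin_num by exact: integrable_fin_num.
have fE : (\int[mu]_(t in Rp) (f t)%:E)%E = (Rint f)%:E by rewrite /Rintegral fineK.
have cv' : (fun N => (\int[mu]_(t in Rp) (S N t)%:E)%E) @ \oo --> (Rint f)%:E.
  by rewrite -fE; exact: cv.
have -> : series (fun k => Rint (u k)) =
    fine \o (fun N => (\int[mu]_(t in Rp) (S N t)%:E)%E).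
  by apply/funext => N; rewrite /series /=; have [_ <-] := Rint_sum N iu.
exact: fine_cvg cv'.
Qed.

End DominatedSeries.

(** * Mellin transforms as power series around real points *)

Section Mellin.
Variable R : realType.
Local Notation C := (cplx R).
Local Notation mu := (@lebesgue_measure R).
Local Notation Rp := (`]0, +oo[%classic : set R).

(** Shaped after [cgamma_integral], which is this transform of [fun t => expR (- t)] by
    conversion. *)
Definition mellin (g : R -> R) (z : C) : C :=
  Complex (\int[mu]_(t in Rp) cRe (ofReal (g t) * cpow t (z - 1)))%R
          (\int[mu]_(t in Rp) cIm (ofReal (g t) * cpow t (z - 1)))%R.

Lemma powRE (t x : R) : 0 < t -> t `^ x = expR (x * ln t).
Proof. by move=> t0; rewrite /powR gt_eqF. Qed.

Lemma cpow_ofReal (t x : R) : 0 < t -> cpow t (ofReal x) = ofReal (t `^ x).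
Proof. by move=> t0; rewrite /cpow -ofRealM cexp_ofReal powRE. Qed.

Lemma cpowD (t : R) (z w : C) : cpow t (z + w) = cpow t z * cpow t w.
Proof. by rewrite /cpow mulrDl cexpD. Qed.

Lemma mellin_ofReal (g : R -> R) (x : R) :
  mellin g (ofReal x) = ofReal (\int[mu]_(t in Rp) (g t * t `^ (x - 1)))%R.
Proof.
have h (t : R) : t \in Rp -> ofReal (g t) * cpow t (ofReal x - 1) = ofReal (g t * t `^ (x - 1)) :> C.
  rewrite inE /= in_itv /= andbT => t0.
  by rewrite -ofReal1 -ofRealB cpow_ofReal // -ofRealM.
rewrite /mellin; congr Complex.
  by apply: eq_Rintegral => t /h ->.
transitivity (\int[mu]_(t in Rp) (0 : R))%R.
  by apply: eq_Rintegral => t /h ->.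
by rewrite Rintegral_cst ?mul0r //; exact: measurable_itv.
Qed.

(** Since e^(r |ln t|) is at most t^(- r) + t^r, the expansion of t^(z - x0) in powers of [ln t] is
    dominated by the integrands at the two ends [x0 - r] and [x0 + r] of the real diameter, the
    points where integrability is assumed. *)
Lemma mellin_ps_disk (g : R -> R) (x0 r : R) : 0 < r ->
  measurable_fun Rp g -> (forall t, 0 < t -> 0 <= g t) ->
  (\int[mu]_(t in Rp) (g t * t `^ (x0 - r - 1))%:E < +oo)%E ->
  (\int[mu]_(t in Rp) (g t * t `^ (x0 + r - 1))%:E < +oo)%E ->
  exists M, ps_disk (mellin g) (ofReal x0) r M.
Proof.
move=> r0 mg g0 h1 h2.
have mRp : measurable Rp by exact: measurable_itv.
pose D (t : R) := g t * t `^ (x0 - r - 1) + g t * t `^ (x0 + r - 1).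
have ipow p : (\int[mu]_(t in Rp) (g t * t `^ p)%:E < +oo)%E ->
    mu.-integrable Rp (EFin \o (fun t => g t * t `^ p)).
  move=> hp; apply/integrableP; split.
    by apply/measurable_EFinP; apply: measurable_funM => //; exact: measurable_powRD.
  apply: le_lt_trans hp; rewrite le_eqVlt; apply/orP; left; apply/eqP.
  apply: eq_integral => t; rewrite inE /= in_itv /= andbT => t0.
  by rewrite ger0_norm // mulr_ge0 ?powR_ge0 // g0.
have iD : mu.-integrable Rp (EFin \o D).
  have -> : EFin \o D = ((EFin \o (fun t : R => (g t * t `^ (x0 - r - 1))%R)) \+
      (EFin \o (fun t : R => (g t * t `^ (x0 + r - 1))%R)))%E.
    by apply/funext => t /=; rewrite EFinD.
  by apply: integrableD => //; exact: ipow.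
pose G k (t : R) : R := g t * t `^ (x0 - 1) * (ln t ^+ k / k`!%:R).
have mG k : measurable_fun Rp (G k).
  apply: measurable_funM.
    by apply: measurable_funM => //; exact: measurable_powRD.
  apply: measurable_funM; last exact: measurable_cst.
  by apply: measurable_funX; apply: measurable_funTS; exact: measurable_ln.
have Gbound t N : 0 < t -> \sum_(0 <= k < N) `|G k t| * r ^+ k <= D t.
  move=> t0; have gt0 : 0 <= g t * t `^ (x0 - 1) by rewrite mulr_ge0 ?powR_ge0 // g0.
  apply: (@le_trans _ _ (g t * t `^ (x0 - 1) * expR (r * `|ln t|))).
    have := exp_coeff_bound N (_ : 0 <= r * `|ln t|).
    rewrite mulr_ge0 // ?(ltW r0) // => /(_ isT) h.
    apply: le_trans (ler_wpM2l gt0 h).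
    rewrite mulr_sumr; apply: ler_sum => k _.
    rewrite /G normrM (ger0_norm gt0) normrM normrX exprMn [`|_^-1|]ger0_norm ?invr_ge0 //.
    by rewrite -mulrA; apply: ler_wpM2l => //; rewrite mulrAC [r ^+ k * _]mulrC.
  have -> : D t = g t * t `^ (x0 - 1) * (t `^ (- r) + t `^ r).
    rewrite /D mulrDr -!mulrA -!powRD ?(gt_eqF t0) ?implybT //.
    by congr (_ * _ `^ _ + _ * _ `^ _); ring.
  rewrite ler_wpM2l // !powRE //.
  have [l0|l0] := lerP 0 (ln t).
    by rewrite ger0_norm // ler_wpDl ?expR_ge0.
  by rewrite ltr0_norm // mulNr -mulrN ler_wpDr ?expR_ge0.
have cexpS t (w : C) : 0 < t ->
    series (fun k => ofReal (G k t) * w ^+ k) @ \oo -->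
    ofReal (g t) * cpow t (ofReal x0 + w - 1).
  move=> t0.
  have -> : ofReal (g t) * cpow t (ofReal x0 + w - 1) =
      ofReal (g t * t `^ (x0 - 1)) * cexp (w * ofReal (ln t)).
    rewrite addrAC cpowD -ofReal1 -ofRealB cpow_ofReal // mulrA -ofRealM //.
  have -> : series (fun k => ofReal (G k t) * w ^+ k) =
     (fun N => ofReal (g t * t `^ (x0 - 1)) * series (fun k => (w * ofReal (ln t)) ^+ k / k`!%:R) N).
    apply/funext => N; rewrite /series /= mulr_sumr; apply: eq_bigr => k _.
    rewrite /G ofRealM -mulrA; congr (_ * _).
    by rewrite exprMn ofRealM ofRealX ofRealV ofReal_nat mulrC mulrA.
  by apply: cvgC_mull; exact: cexp_cvg.
have Gr t N : 0 < t -> \sum_(0 <= k < N) `|G k t * r ^+ k| <= D t.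
  move=> t0; apply: le_trans (Gbound t N t0); apply: ler_sum => k _.
  by rewrite normrM [`|r ^+ k|]ger0_norm // exprn_ge0 // ltW.
have mGr (c : nat -> R) k : measurable_fun Rp (fun t => G k t * c k).
  by apply: measurable_funM => //; exact: measurable_cst.
(* The offset [r] gives the absolute bound on the coefficients and, after division by [r ^+ k], the
   integrability of each [G k]. *)
have [iGr _ bGr] : [/\ forall k, mu.-integrable Rp (EFin \o (fun t => G k t * r ^+ k)),
    series (fun k => \int[mu]_(t in Rp) (G k t * r ^+ k))%R @ \oo -->
    (\int[mu]_(t in Rp) cRe (ofReal (g t) * cpow t (ofReal x0 + ofReal r - 1)))%R &
    forall N, \sum_(0 <= k < N) `|(\int[mu]_(t in Rp) (G k t * r ^+ k))%R| <= (\int[mu]_(t in Rp) D t)%R].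
  apply: (@dominated_series _ (fun k t => G k t * r ^+ k)) => //.
  move=> t t0; have -> : series (fun k => G k t * r ^+ k) =
      (fun N => cRe (series (fun k => ofReal (G k t) * (ofReal r) ^+ k) N)).
    apply/funext => N; rewrite /series /= cRe_sum; apply: eq_bigr => k _.
    by rewrite -ofRealX -ofRealM.
  by apply: cvgC_cRe; exact: cexpS.
have iG k : mu.-integrable Rp (EFin \o G k).
  have rk : r ^+ k != 0 by rewrite expf_neq0 // gt_eqF.
  have -> : EFin \o G k = (fun t => (r ^- k)%:E * (G k t * r ^+ k)%:E)%E.
    by apply/funext => t /=; rewrite -EFinM mulrC mulfK.
  exact: (@integrableZl _ _ _ mu Rp mRp _ _ (iGr k)).
pose c k : R := (\int[mu]_(t in Rp) G k t)%R.
exists (\int[mu]_(t in Rp) D t)%R, (fun k => ofReal (c k)); split=> [//|N|z zr].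
  apply: le_trans (bGr N); apply: ler_sum => k _.
  by rewrite cmod_ofReal RintegralZr // normrM [`|r ^+ k|]ger0_norm // exprn_ge0 // ltW.
set w := z - ofReal x0 in zr *.
have zw : z = ofReal x0 + w by rewrite /w addrC subrK.
(* Real and imaginary parts are treated at once: [f] stands for [cRe] or [cIm], of which only real
   linearity, continuity and the bound by the modulus enter. *)
have part (f : C -> R) : (forall v, `|f v| <= cmod v) ->
    (forall (a : R) v, f (ofReal a * v) = a * f v) ->
    (forall (u : nat -> C) N, f (\sum_(0 <= k < N) u k) = \sum_(0 <= k < N) f (u k)) ->
    (forall (u : nat -> C) (l : C), u @ \oo --> l -> (fun n => f (u n)) @ \oo --> f l) ->
    (fun N => f (series (fun k => ofReal (c k) * w ^+ k) N)) @ \oo -->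
    (\int[mu]_(t in Rp) f (ofReal (g t) * cpow t (z - 1)))%R.
  move=> fle fM fsum fcv.
  have [_ + _] : [/\ forall k, mu.-integrable Rp (EFin \o (fun t => G k t * f (w ^+ k))),
    series (fun k => \int[mu]_(t in Rp) (G k t * f (w ^+ k)))%R @ \oo -->
    (\int[mu]_(t in Rp) f (ofReal (g t) * cpow t (z - 1)))%R &
    forall N, \sum_(0 <= k < N) `|(\int[mu]_(t in Rp) (G k t * f (w ^+ k)))%R| <= (\int[mu]_(t in Rp) D t)%R].
    apply: (@dominated_series _ (fun k t => G k t * f (w ^+ k))) => //.
    - by move=> k; exact: (mGr (fun k => f (w ^+ k))).
    - move=> t N t0; apply: le_trans (Gbound t N t0); apply: ler_sum => k _.
      rewrite normrM ler_wpM2l // (le_trans (fle _)) // cmodX ler_pow //.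
    - move=> t t0; rewrite zw; have -> : series (fun k => G k t * f (w ^+ k)) =
        (fun N => f (series (fun k => ofReal (G k t) * w ^+ k) N)).
        by apply/funext => N; rewrite /series /= fsum; apply: eq_bigr => k _; rewrite fM.
      by apply: fcv; exact: cexpS.
  have -> // : series (fun k => \int[mu]_(t in Rp) (G k t * f (w ^+ k)))%R =
     (fun N => f (series (fun k => ofReal (c k) * w ^+ k) N)).
  apply/funext => N; rewrite /series /= fsum; apply: eq_bigr => k _.
  by rewrite fM RintegralZr.
apply: cvgC_ReIm.
- apply: (part (@cRe R)).
  + exact: ler_cRe.
  + by move=> a v; rewrite cReM /= mul0r subr0.
  + by move=> u N; exact: cRe_sum.
  + by move=> u l; exact: cvgC_cRe.
- apply: (part (@cIm R)).
  + exact: ler_cIm.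
  + by move=> a v; rewrite cImM /= mul0r addr0.
  + by move=> u N; exact: cIm_sum.
  + by move=> u l; exact: cvgC_cIm.
Qed.

End Mellin.

(** * Identity theorem on vertical strips, and analyticity of Mellin transforms *)

Section HalfPlane.
Variable R : realType.
Local Notation C := (cplx R).
Local Notation mu := (@lebesgue_measure R).
Local Notation Rp := (`]0, +oo[%classic : set R).
Implicit Types (f g : C -> C) (z : C).

(** The segment from [ofReal x] to [z] keeps its real parts in the interval [I]. *)
Lemma strip_ident (I : set R) f g (x d : R) : is_interval I -> I x -> 0 < d ->
  (forall z, I (cRe z) -> analytic_at f z /\ analytic_at g z) ->
  (forall y, `|y - x| < d -> f (ofReal y) = g (ofReal y)) ->
  forall z, I (cRe z) -> f z = g z.
Proof.
move=> cI Ix d0 fg e z Iz; apply: nearP_eq.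
apply: (@analytic_segment_ident _ _ _ (ofReal x)); last first.
  by have [af ag] := fg (ofReal x) Ix; exact: (analytic_real_ident d0 af ag).
move=> t /andP[t0 t1]; apply: fg; rewrite /seg cReD cReM /= mul0r subr0 cReB /=.
have [xz|zx] := lerP x (cRe z).
- by apply: (cI x (cRe z)) => //; apply/andP; split; nra.
- by apply: (cI (cRe z) x) => //; apply/andP; split; nra.
Qed.

(** [mellin_ps_disk] only offers disks with a real centre. The disk of centre [c + h] and radius [h]
    touches the line of real part [c]; with [h = (a^2 + b^2) / a] the squared distance from [z] to
    its centre is [h^2 - h * a], so [z] lies inside, and [r] is a radius in between. *)
Lemma mellin_analytic (g : R -> R) (c : R) z :
  measurable_fun Rp g -> (forall t, 0 < t -> 0 <= g t) ->
  (forall x, c < x -> (\int[mu]_(t in Rp) (g t * t `^ (x - 1))%:E < +oo)%E) ->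
  c < cRe z -> analytic_at (mellin g) z.
Proof.
move=> mg g0 ig cz; pose a := cRe z - c; pose b := cIm z.
have a0 : 0 < a by rewrite /a subr_gt0.
pose h := (a ^+ 2 + b ^+ 2) / a; pose x0 := c + h.
have ha : h * a = a ^+ 2 + b ^+ 2 by rewrite /h mulfVK // gt_eqF.
have h0 : 0 < h by rewrite /h divr_gt0 // ltr_wpDr ?sqr_ge0 // exprn_gt0.
have yh : cmod (z - ofReal x0) < h.
  rewrite -(@ltr_pXn2r _ 2) ?nnegrE ?cmod_ge0 ?(ltW h0) // cplx_sq cReB cImB /= subr0.
  have -> : cRe z - x0 = a - h by rewrite /x0 /a opprD addrA.
  rewrite -/b; have -> : (a - h) ^+ 2 + b ^+ 2 = h ^+ 2 - h * a + (a ^+ 2 + b ^+ 2 - h * a) by ring.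
  rewrite -ha subrr addr0 -subr_gt0 opprB addrC subrK; exact: mulr_gt0.
pose r := (cmod (z - ofReal x0) + h) / 2.
have yr : cmod (z - ofReal x0) < r by rewrite /r ltr_pdivlMr //; lra.
have rh : r < h by rewrite /r ltr_pdivrMr //; lra.
have r0 : 0 < r by apply: le_lt_trans yr; exact: cmod_ge0.
have l1 : c < x0 - r by rewrite /x0; lra.
have l2 : c < x0 + r by rewrite /x0; lra.
have [M hM] := @mellin_ps_disk R g x0 r r0 mg g0 (ig (x0 - r) l1) (ig (x0 + r) l2).
exact: (ps_disk_analytic_in hM yr).
Qed.

End HalfPlane.

(** * The complex gamma function: continuation, recursion and reflection *)

Section Gamma.
Variable R : realType.
Local Notation C := (cplx R).
Implicit Types z : C.
Local Notation Gi := (@cgamma_integral R).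

Lemma cgamma_integral_analytic z : 0 < cRe z -> analytic_at Gi z.
Proof.
move=> z0; apply: (@mellin_analytic R (fun t => expR (- t)) 0) => //.
- apply: measurable_funTS; apply: measurableT_comp => //.
- by move=> x x0; exact: Gint_lty.
Qed.

Lemma cgamma_integral_ofReal (x : R) : Gi (ofReal x) = ofReal (Gam x).
Proof. exact: (mellin_ofReal (fun t => expR (- t))). Qed.

Let is_interval_gt (c : R) : is_interval [set x | c < x].
Proof. by move=> x y /= cx cy w /andP[xw _]; exact: lt_le_trans cx xw. Qed.

Lemma analytic_addc f c z : analytic_at f (z + c) -> analytic_at (fun w : C => f (w + c)) z.
Proof.
move=> h; apply: (@analytic_ext _ (fun w => f (1 * w + c))); first by move=> w; rewrite mul1r.
by apply: analytic_affine; rewrite mul1r.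
Qed.

Lemma cgamma_integral_add1 z : 0 < cRe z -> Gi (z + 1) = z * Gi z.
Proof.
have h w : 0 < cRe w -> analytic_at (fun w => Gi (w + 1)) w /\ analytic_at (fun w => w * Gi w) w.
  move=> w0; split.
    by apply: analytic_addc; apply: cgamma_integral_analytic; rewrite cReD /=; lra.
  by apply: analytic_mul; [exact: analytic_id | exact: cgamma_integral_analytic].
apply: (@strip_ident _ [set x | 0 < x] (fun w => Gi (w + 1)) (fun w => w * Gi w) 1 1
  (is_interval_gt (c := 0)) ltr01 ltr01 h).
move=> y; rewrite ltr_distl => /andP[y0 _]; have {}y0 : 0 < y by lra.
by rewrite -ofReal1 -ofRealD !cgamma_integral_ofReal -ofRealM Gam_add1.
Qed.

(** The recursion applied [n] times and solved for the value at [z]: this continues Euler's integral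
    to [cRe z > - n]. *)
Definition cgamma_n n z : C := Gi (z + n%:R) * \prod_(0 <= k < n) (z + k%:R)^-1.

Lemma cgamma_n_add n m z : ~ nonpos_integers z -> 0 < cRe z + n%:R ->
  cgamma_n (n + m) z = cgamma_n n z.
Proof.
move=> nz n0; elim: m => [|m <-]; first by rewrite addn0.
rewrite /cgamma_n addnS big_nat_recr //= -[_.+1%:R]natr1 addrA cgamma_integral_add1; last first.
  by rewrite cReD -ofReal_nat /= natrD; have : 0 <= m%:R :> R by []; lra.
have zn : z + (n + m)%:R != 0.
  by apply/eqP => e; apply: nz; exists (n + m)%N; apply/eqP; rewrite -addr_eq0 e.
have e (u G P : C) : u != 0 -> u * G * (P * u^-1) = G * P by move=> u0; field.
exact: e.
Qed.

Lemma analytic_prod (F : nat -> C -> C) n z : (forall k, (k < n)%N -> analytic_at (F k) z) ->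
  analytic_at (fun w => \prod_(0 <= k < n) F k w) z.
Proof.
elim: n => [|n IH] h.
  by apply: (@analytic_ext _ (fun=> 1)); [move=> w; rewrite big_geq | exact: analytic_cst].
apply: (@analytic_ext _ (fun w => \prod_(0 <= k < n) F k w * F n w)).
  by move=> w; rewrite big_nat_recr.
apply: analytic_mul; last exact: h.
by apply: IH => k kn; apply: h; exact: ltnW.
Qed.

Lemma cgamma_n_analytic n z : ~ nonpos_integers z -> 0 < cRe z + n%:R ->
  analytic_at (cgamma_n n) z.
Proof.
move=> nz n0; apply: analytic_mul.
  by apply: analytic_addc; apply: cgamma_integral_analytic; rewrite cReD -ofReal_nat.
apply: analytic_prod => k _.
apply: (@analytic_ext _ (fun w => (w - - k%:R)^-1)); first by move=> w; rewrite opprK.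
by apply: analytic_inv; apply/eqP => e; apply: nz; exists k.
Qed.

Lemma analytic_neq0_near f z : analytic_at f z -> f z != 0 -> \forall w \near z, f w != 0.
Proof.
move=> af fz; case: (analytic_dichotomy af) => h.
  by case/eqP: fz; exact: (nearP_eq (g := fun=> 0) h).
move/nearC: h => [d d0 h]; apply/nearC; exists d => // w wd.
by have [->|wz] := eqVneq w z; [|exact: h].
Qed.

(** [n] is so large that a nonpositive integer within distance 1 of [z] is among 0, -1, ..., - (n -
    1), that is, a zero of the polynomial [F]. Since [F] does not vanish at [z], it does not vanish
    nearby. *)
Lemma nonpos_integers_closed z : ~ nonpos_integers z -> \forall w \near z, ~ nonpos_integers w.
Proof.
move=> nz; pose n := (Num.truncn `|cRe z - 1|).+1.
have nP : 0 < cRe z - 1 + n%:R.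
  have := truncnS_gt `|cRe z - 1|; rewrite -/n => h.
  by have := ler_norm (- (cRe z - 1)); rewrite normrN; lra.
pose F w : C := \prod_(0 <= k < n) (w + k%:R).
have aF : analytic_at F z.
  by apply: analytic_prod => k _; apply: analytic_add; [exact: analytic_id|exact: analytic_cst].
have Fz : F z != 0.
  rewrite /F prodf_seq_neq0; apply/allP => k _ /=; apply/eqP => e; apply: nz.
  by exists k; apply/eqP; rewrite -addr_eq0 e.
have [d d0 hd] := iffLR (nearC _ _) (analytic_neq0_near aF Fz).
apply/nearC; exists (Num.min d 1); first by rewrite lt_min d0 ltr01.
move=> w; rewrite lt_min => /andP[wd w1] [k wk].
have := hd w wd; rewrite /F prodf_seq_neq0 => /allP/(_ k).
rewrite mem_index_iota /= wk addNr eqxx => kn; suff /kn : (k < n)%N by [].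
have := le_lt_trans (ler_cRe (w - z)) w1.
rewrite cReB wk cReN -ofReal_nat ltr_distl /= => /andP[h _]. have : k%:R < n%:R :> R by lra.
by rewrite ltr_nat.
Qed.

(** [xget] returns a member of the set as soon as there is one, so exhibiting one continuation is
    enough. The witness uses at each point enough steps of the recursion, [N z], to reach the right
    half-plane. *)
Lemma cgamma_spec : analytic_on (~` @nonpos_integers R) (@cgamma R) /\
  forall z, 0 < cRe z -> cgamma z = Gi z.
Proof.
rewrite /cgamma /analytic_continuation; set S := (X in xget _ X).
suff [f Sf] : exists f, S f by exact: (xgetPex _ (ex_intro _ f Sf)).
pose N z := (Num.truncn `|cRe z|).+1.
have NP z : 0 < cRe z + (N z)%:R.
  have := truncnS_gt `|cRe z|; rewrite -/(N z) => h.
  by have := ler_norm (- cRe z); rewrite normrN; lra.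
exists (fun z => cgamma_n (N z) z); split; last first.
  move=> z /= z0; have [p|] := pselect (nonpos_integers z).
    have [n zn] := p; move: z0; rewrite zn cReN -ofReal_nat /= oppr_gt0.
    by rewrite ltNge ler0n.
  move=> nz; rewrite -[N z]add0n cgamma_n_add ?addr0 //.
  by rewrite /cgamma_n big_geq // mulr1 addr0.
(* The number of steps varies with the point; [(N z).+1] of them suffice for all [w] within distance
   1 of [z], and [cgamma_n_add] identifies the two counts. *)
move=> z nz; apply: (@analytic_near _ (cgamma_n (N z).+1)).
  have [d d0 hd] := iffLR (nearC _ _) (nonpos_integers_closed nz).
  apply/nearC; exists (Num.min d 1); first by rewrite lt_min d0 ltr01.
  move=> w; rewrite lt_min => /andP[wd w1].
  have wz : 0 < cRe w + (N z).+1%:R.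
    have := le_lt_trans (ler_cRe (w - z)) w1; rewrite cReB ltr_distl => /andP[h _].
    by rewrite -natr1; have := NP z; lra.
  have [le|le] := leqP (N w) (N z).+1.
    by rewrite -(subnKC le) cgamma_n_add //; exact: hd.
  by rewrite -(subnKC (ltnW le)) cgamma_n_add //; exact: hd.
apply: cgamma_n_analytic => //.
by rewrite -natr1; have := NP z; lra.
Qed.

Definition cgamma_analytic := cgamma_spec.1.
Definition cgammaE := cgamma_spec.2.

Lemma cgamma_ofReal (x : R) : 0 < x -> cgamma (ofReal x) = ofReal (Gam x).
Proof. by move=> x0; rewrite cgammaE // cgamma_integral_ofReal. Qed.

Lemma ofReal_int (m : int) : ofReal m%:~R = m%:~R :> C.
Proof.
by case: m => n; rewrite ?NegzE ?mulrNz ?ofRealN -!pmulrn ofReal_nat.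
Qed.

Lemma nonreal_not_integer z : cIm z != 0 -> ~ integers z.
Proof. by move=> z0 [m zm]; move: z0; rewrite zm -ofReal_int /= eqxx. Qed.

Lemma nonpos_integers_int z : nonpos_integers z -> integers z.
Proof. by case=> n ->; exists (- n%:Z); rewrite mulrNz. Qed.

Lemma real_not_integer (m : int) (x : R) : m%:~R < x < (m + 1)%:~R -> ~ integers (ofReal x).
Proof.
move=> xm [k]; rewrite -ofReal_int => /ofReal_inj xk; move: xm.
by rewrite xk !ltr_int ltzD1 ltNge => /andP[/negP].
Qed.

Lemma cgamma_add1 z : ~ nonpos_integers z -> cgamma (1 + z) = z * cgamma z.
Proof.
move=> nz; apply: (nearP_eq (f := fun z => cgamma (1 + z)) (g := fun z => z * cgamma z)).
apply: (@analytic_nonreal_ident _ (~` @nonpos_integers R) _ _ 1) nz.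
- by move=> w /nonreal_not_integer + /nonpos_integers_int.
- case=> n /(congr1 (@cRe R)); rewrite cReN -ofReal_nat /=.
  by have : 0 <= n%:R :> R by []; lra.
- move=> w nw; apply: (@analytic_ext _ (fun w => cgamma (w + 1))).
    by move=> v; rewrite addrC.
  apply: analytic_addc; apply: cgamma_analytic => -[n wn]; apply: nw; exists n.+1.
  by rewrite -natr1 opprD -wn addrK.
- by move=> w nw; apply: analytic_mul; [exact: analytic_id | exact: cgamma_analytic].
- apply/nearC; exists 1 => // w; move/(le_lt_trans (ler_cRe _)).
  rewrite cReB ltr_distl /= => /andP[w0 _].
  rewrite !cgammaE ?cReD /= ?[1 + w]addrC ?cgamma_integral_add1 //; lra.
Qed.

(** Written as a product, so that both sides are visibly analytic off the integers and the formula
    also shows that the sine does not vanish there. It starts from [Gam_reflection] on the real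
    interval around 1/2. *)
Lemma cgamma_reflection z : ~ integers z ->
  cgamma (1 - z) * cgamma z * csin (ofReal pi * z) = ofReal pi.
Proof.
move=> nz; pose f (w : C) := cgamma (1 - w) * cgamma w * csin (ofReal pi * w).
suff h : \forall w \near z, f w = ofReal pi by exact: (nearP_eq (g := fun=> ofReal pi) h).
have i1 w : integers (1 - w) -> integers w.
  by case=> m e; exists (1 - m); rewrite mulrzBr mulr1z -e opprB addrC subrK.
have af w : ~ integers w -> analytic_at f w.
  move=> nw; apply: analytic_mul; first apply: analytic_mul.
  + apply: (@analytic_ext _ (fun w => cgamma (-1 * w + 1))).
      by move=> v; rewrite mulN1r addrC.
    apply: analytic_affine; rewrite mulN1r addrC; apply: cgamma_analytic.
    by move=> /nonpos_integers_int /i1.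
  + by apply: cgamma_analytic => /nonpos_integers_int.
  + apply: (@analytic_ext _ (fun w => csin (ofReal pi * w + 0))).
      by move=> v; rewrite addr0.
    by apply: analytic_affine; exact: analytic_csin.
have half : ~ integers (ofReal 2^-1 : C) by apply: (@real_not_integer 0); rewrite /=; lra.
have i2 w : cIm w != 0 -> (~` @integers R) w by move/nonreal_not_integer.
apply: (@analytic_nonreal_ident _ (~` @integers R) f (fun=> ofReal pi) 2^-1 i2 half af _ _ z nz).
  by move=> w _; exact: analytic_cst.
have d0 : 0 < 2^-1 :> R by [].
apply: (analytic_real_ident d0 (af _ half)); first exact: analytic_cst.
move=> y; rewrite ltr_distl => /andP[y0 y1].
have {}y0 : 0 < y by lra.
have {}y1 : y < 1 by lra.
have y01 : 0 < 1 - y by lra.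
have s0 : 0 < sin (pi * y).
  by apply: sin_gt0_pi; rewrite mulr_gt0 ?pi_gt0 // gtr_pMr ?pi_gt0.
rewrite /f -ofReal1 -ofRealB !cgamma_ofReal //.
rewrite -(ofRealM pi) csin_ofReal -!ofRealM; congr ofReal.
by rewrite [Gam (1 - y) * _]mulrC Gam_reflection ?y0 // divfK // gt_eqF.
Qed.

End Gamma.

(** * The Dirichlet series for real part greater than 1 *)

Section ZetaSeries.
Variable R : realType.
Local Notation C := (cplx R).
Implicit Types s z : C.

(** The integral comparison in exponential form: with [u = ln (n + 2) - ln (n + 1)], one has
    [u >= 1 / (n + 2)], and [expR (p * u) >= 1 + p / (n + 2)]. *)
Lemma powR_telescope_le (p : R) (n : nat) : 0 < p ->
  n.+2%:R `^ (- (p + 1)) <= p^-1 * (n.+1%:R `^ (- p) - n.+2%:R `^ (- p)).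
Proof.
move=> p0; have n1 : 0 < n.+1%:R :> R by [].
have n2 : 0 < n.+2%:R :> R by [].
rewrite mulrC ler_pdivlMr // mulrC.
pose u : R := ln n.+2%:R - ln n.+1%:R.
have hu : n.+2%:R^-1 <= u.
  have h : 1 - n.+2%:R^-1 <= expR (- n.+2%:R^-1) :> R by exact: expR_ge1Dx.
  have e : 1 - n.+2%:R^-1 = n.+1%:R / n.+2%:R :> R.
    rewrite -[n.+2%:R]natr1; move: (n.+1%:R : R) n1 => a a0.
    by field; rewrite gt_eqF //; lra.
  have : ln (n.+1%:R / n.+2%:R) <= - n.+2%:R^-1 :> R.
    by rewrite -ler_expR lnK ?posrE ?divr_gt0 // -e.
  by rewrite ln_div ?posrE // lerNr opprB.
have e1 : n.+1%:R `^ (- p) = n.+2%:R `^ (- p) * expR (p * u).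
  by rewrite !powRE // -expRD; congr expR; rewrite /u; ring.
rewrite e1 opprD powRD ?pnatr_eq0 ?implybT // powR_inv1 ?(ltW n2) //.
have h3 : 1 + p * n.+2%:R^-1 <= expR (p * u).
  by apply: le_trans (expR_ge1Dx _); rewrite lerD2l ler_wpM2l // ltW.
have a0 := powR_ge0 (n.+2%:R : R) (- p).
by rewrite lerBrDl mulrCA -[X in X + _]mulr1 -mulrDr ler_wpM2l.
Qed.

Lemma zeta_partial_le (x : R) : 1 < x -> exists M, forall N,
  \sum_(0 <= k < N) k.+1%:R `^ (- x) <= M :> R.
Proof.
move=> x1; pose p := x - 1; have p0 : 0 < p by rewrite /p subr_gt0.
exists (1 + p^-1) => N.
have h n : \sum_(0 <= k < n.+1) k.+1%:R `^ (- x) <= 1 + p^-1 * (1 - n.+1%:R `^ (- p)) :> R.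
  elim: n => [|n IH]; first by rewrite big_nat1 !powR1 subrr mulr0 addr0.
  rewrite big_nat_recr //=; have := powR_telescope_le n p0.
  rewrite (_ : p + 1 = x) ?subrK // !mulrBr; move: IH; rewrite mulrBr; lra.
case: N => [|N]; first by rewrite big_geq // addr_ge0 // invr_ge0 ltW.
apply: le_trans (h N) _; by rewrite lerD2l ger_pMr ?invr_gt0 // gerBl powR_ge0.
Qed.

Definition Zr (x : R) : R := limn (series (fun n : nat => n.+1%:R `^ (- x))).

Lemma Zr_cvg (x : R) : 1 < x -> series (fun n : nat => n.+1%:R `^ (- x)) @ \oo --> Zr x.
Proof.
move=> /zeta_partial_le[M hM].
have [L [hL _ _]] := series_bound_cvg (fun k => powR_ge0 (k.+1%:R : R) (- x)) hM.
by rewrite /Zr (cvg_lim _ hL).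
Qed.

(** The logarithm of [n.+1] is nonnegative, so the absolute series sums to the modulus at the
    leftmost point [z0 - r] of the disk. *)
Lemma cpow_natN (n : nat) (z0 : C) r : 0 < r ->
  ps_disk (fun s => cpow n.+1%:R (- s)) z0 r (n.+1%:R `^ (- (cRe z0 - r))).
Proof.
move=> r0; pose l : R := ln n.+1%:R.
have l0 : 0 <= l by rewrite ln_ge0 // ler1n.
exists (fun k => cpow n.+1%:R (- z0) * (ofReal ((- l) ^+ k / k`!%:R))); split=> [//|N|z _].
  have -> : n.+1%:R `^ (- (cRe z0 - r)) = cmod (cpow n.+1%:R (- z0)) * expR (r * l).
    rewrite /cpow cmod_cexp cReM /= mulr0 subr0 cReN powRE // -expRD; congr expR.
    by rewrite /l; ring.
  apply: le_trans (ler_wpM2l (cmod_ge0 _) (exp_coeff_bound N _)); last first.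
    by rewrite mulr_ge0 // ltW.
  rewrite mulr_sumr; apply: ler_sum => k _; rewrite cmodM -mulrA.
  rewrite ler_wpM2l ?cmod_ge0 // cmod_ofReal normrM normrX normrN (ger0_norm l0).
  by rewrite ger0_norm ?invr_ge0 // exprMn mulrC mulrA.
have e : - z * ofReal l = - z0 * ofReal l + (z - z0) * ofReal (- l).
  by rewrite ofRealN; ring.
rewrite [X in _ --> X](_ : _ = cpow n.+1%:R (- z0) * cexp ((z - z0) * ofReal (- l))); last first.
  by rewrite /cpow -cexpD -e.
have -> : series (fun k => cpow n.+1%:R (- z0) * ofReal ((- l) ^+ k / k`!%:R) * (z - z0) ^+ k) =
  (fun N => cpow n.+1%:R (- z0) * series (fun k => ((z - z0) * ofReal (- l)) ^+ k / k`!%:R) N).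
  apply/funext => N; rewrite /series /= mulr_sumr; apply: eq_bigr => k _.
  rewrite -mulrA; congr (_ * _); rewrite exprMn ofRealM ofRealX ofRealV ofReal_nat.
  by rewrite mulrC mulrA.
by apply: cvgC_mull; exact: cexp_cvg.
Qed.

Lemma cmod_cpow_natN n s : cmod (cpow n.+1%:R (- s)) = n.+1%:R `^ (- cRe s).
Proof. by rewrite /cpow cmod_cexp cReM /= mulr0 subr0 cReN powRE. Qed.

Lemma czeta_series_cvg s : 1 < cRe s ->
  series (fun n : nat => cpow n.+1%:R (- s)) @ \oo --> czeta_series s.
Proof.
move=> /zeta_partial_le[M hM].
have hc N : \sum_(0 <= k < N) cmod (cpow k.+1%:R (- s)) <= M.
  by under eq_bigr do rewrite cmod_cpow_natN; exact: hM.
have [l hl _] := csum_bound_cvg hc.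
by rewrite /czeta_series (limCE hl).
Qed.

Lemma czeta_series_analytic s : 1 < cRe s -> analytic_at (@czeta_series R) s.
Proof.
move=> s1; pose r := (cRe s - 1) / 2; have r0 : 0 < r by rewrite /r; lra.
have h : 1 < cRe s - r by rewrite /r; lra.
have [M hM] := zeta_partial_le h.
apply: (@ps_disk_analytic _ _ s r M); apply: (ps_disk_series _ hM).
  by move=> i; exact: cpow_natN.
move=> z zr; apply: czeta_series_cvg.
have := le_trans (ler_cRe (z - s)) zr; rewrite cReB ler_distl => /andP[+ _]; lra.
Qed.

Lemma czeta_series_ofReal (x : R) : 1 < x -> czeta_series (ofReal x) = ofReal (Zr x) :> C.
Proof.
move=> x1; apply: limCE.
have -> : series (fun n : nat => cpow n.+1%:R (- ofReal x)) =
    (fun N => ofReal (series (fun n : nat => n.+1%:R `^ (- x)) N)) :> (nat -> C).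
  apply/funext => N; rewrite /series /= ofReal_sum; apply: eq_bigr => k _.
  by rewrite -ofRealN cpow_ofReal.
by apply: cvgC_ofReal; exact: Zr_cvg.
Qed.

Lemma nneseries_Zr (x : R) : 1 < x ->
  (\sum_(0 <= n <oo) (n.+1%:R `^ (- x))%:E = (Zr x)%:E)%E.
Proof. by move=> /Zr_cvg; exact: nneseries_EFin. Qed.

End ZetaSeries.

(** * Gamma zeta as a Mellin transform, on both sides of the critical strip *)

Section ZetaMellin.
Variable R : realType.
Local Notation C := (cplx R).
Local Notation mu := (@lebesgue_measure R).
Local Notation Rp := (`]0, +oo[%classic : set R).
Local Notation I01 := (`]0, 1]%classic : set R).
Local Notation I1y := (`]1, +oo[%classic : set R).

Definition bose (t : R) : R := (expR t - 1)^-1.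

Lemma bose_ge0 t : 0 < t -> 0 <= bose t.
Proof. by move=> t0; rewrite /bose invr_ge0 subr_ge0 ltW // expR_gt1. Qed.

Lemma bern_ge0 (t : R) : 0 < t -> 0 <= bern t.
Proof.
move=> t0; have h := coth_expansion_real t0.
rewrite /bern -(cvg_lim _ h) //; apply: limr_ge; first by apply/cvg_ex; exists (bern t).
apply: nearW => N; apply: sumr_ge0 => n _.
by rewrite divr_ge0 ?mulr_ge0 ?addr_ge0 ?sqr_ge0 // ltW.
Qed.

Lemma measurable_bose (D : set R) : measurable D -> D `<=` Rp -> measurable_fun D bose.
Proof.
move=> mD D0; apply: (@eq_measurable_fun _ _ _ _ _ (fun t => (Num.max 0 (expR t - 1))^-1)).
  move=> t; rewrite inE => /D0 /=; rewrite in_itv /= andbT => t0.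
  by rewrite /bose max_r // subr_ge0 ltW // expR_gt1.
apply: measurable_invr_ge0; first by move=> v; rewrite le_max lexx.
apply: measurable_maxr; first exact: measurable_cst.
apply: measurable_funB; last exact: measurable_cst.
by apply: measurable_funTS; exact: measurable_expR.
Qed.

Lemma measurable_bern (D : set R) : measurable D -> D `<=` Rp -> measurable_fun D (@bern R).
Proof.
move=> mD D0; apply: measurable_funD; last exact: measurable_cst.
apply: measurable_funB; first exact: measurable_bose.
apply: (@eq_measurable_fun _ _ _ _ _ (fun t : R => t `^ (-1))).
  move=> t; rewrite inE => /D0 /=; rewrite in_itv /= andbT => t0.
  by rewrite powR_inv1 // ltW.
exact: measurable_powRD.
Qed.

Lemma measurable_powR_bern (D : set R) x : measurable D -> D `<=` Rp ->
  measurable_fun D (fun t : R => (t `^ x * bern t)%:E).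
Proof.
move=> mD D0; apply/measurable_EFinP.
by apply: measurable_funM; [exact: measurable_powRD | exact: measurable_bern].
Qed.

Lemma measurable_powR_bose (D : set R) x : measurable D -> D `<=` Rp ->
  measurable_fun D (fun t : R => (t `^ x * bose t)%:E).
Proof.
move=> mD D0; apply/measurable_EFinP.
by apply: measurable_funM; [exact: measurable_powRD | exact: measurable_bose].
Qed.

(** The polar terms are subtracted only on []0, 1]]: this gains convergence at 0 down to [-1 < x]
    and keeps the exponential decay at infinity. *)
Definition zkernel (t : R) : R := if t <= 1 then bern t else bose t.

Let mRp : measurable Rp. Proof. exact: measurable_itv. Qed.
Let m01 : measurable I01. Proof. exact: measurable_itv. Qed.
Let m1y : measurable I1y. Proof. exact: measurable_itv. Qed.

Let s01 : I01 `<=` Rp.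
Proof. by move=> t /=; rewrite !in_itv /= andbT => /andP[]. Qed.

Let s1y : I1y `<=` Rp.
Proof. by move=> t /=; rewrite !in_itv /= !andbT; exact: lt_trans. Qed.

Lemma RpE : Rp = I01 `|` I1y.
Proof.
apply/seteqP; split=> t /=; rewrite !in_itv /= !andbT.
  by move=> t0; have [t1|t1] := lerP t 1; [left; rewrite t0|right].
by case=> [/andP[]//|]; exact: lt_trans.
Qed.

Lemma zkernel_ge0 t : 0 < t -> 0 <= zkernel t.
Proof. by move=> t0; rewrite /zkernel; case: ifP => _; [exact: bern_ge0|exact: bose_ge0]. Qed.

Lemma measurable_zkernel : measurable_fun Rp zkernel.
Proof.
rewrite RpE measurable_funU //; split.
  apply: (@eq_measurable_fun _ _ _ _ _ (@bern R)); last exact: measurable_bern.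
  by move=> t; rewrite inE /= in_itv /= => /andP[_ t1]; rewrite /zkernel t1.
apply: (@eq_measurable_fun _ _ _ _ _ bose); last exact: measurable_bose.
by move=> t; rewrite inE /= in_itv /= andbT => t1; rewrite /zkernel leNgt t1.
Qed.

Lemma ge0_integral_splitRp (f : R -> R) : measurable_fun Rp f -> (forall t, 0 < t -> 0 <= f t) ->
  (\int[mu]_(t in Rp) (f t)%:E =
    \int[mu]_(t in I01) (f t)%:E + \int[mu]_(t in I1y) (f t)%:E)%E.
Proof.
move=> mf f0; rewrite {1}RpE ge0_integral_setU //.
- by rewrite -RpE; exact/measurable_EFinP.
- by rewrite -RpE => t /=; rewrite in_itv /= andbT => t0; rewrite lee_fin f0.
- rewrite disj_set2E; apply/eqP/seteqP; split=> t //=.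
  by rewrite !in_itv /= andbT => -[/andP[_]]; rewrite leNgt => /negP.
Qed.

Definition b01 (x : R) : \bar R := (\int[mu]_(t in I01) (t `^ (x - 1) * bern t)%:E)%E.
Definition b1y (x : R) : \bar R := (\int[mu]_(t in I1y) (t `^ (x - 1) * bose t)%:E)%E.

Lemma zkernel_split x :
  (\int[mu]_(t in Rp) (zkernel t * t `^ (x - 1))%:E = b01 x + b1y x)%E.
Proof.
rewrite ge0_integral_splitRp; last 2 first.
- by apply: measurable_funM; [exact: measurable_zkernel | exact: measurable_powRD].
- by move=> t t0; rewrite mulr_ge0 ?powR_ge0 ?zkernel_ge0.
congr (_ + _)%E; apply: eq_integral => t; rewrite inE /= in_itv /=.
  by move=> /andP[_ t1]; rewrite /zkernel t1 mulrC.
by rewrite andbT => t1; rewrite /zkernel leNgt t1 /= mulrC.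
Qed.

Lemma bose_split x :
  (\int[mu]_(t in Rp) (t `^ (x - 1) * bose t)%:E =
    \int[mu]_(t in I01) (t `^ (x - 1) * bose t)%:E + b1y x)%E.
Proof.
rewrite ge0_integral_splitRp //.
  by apply: measurable_funM; [exact: measurable_powRD | exact: measurable_bose].
by move=> t t0; rewrite mulr_ge0 ?powR_ge0 ?bose_ge0.
Qed.

Lemma bern_split x :
  (\int[mu]_(t in Rp) (t `^ (x - 1) * bern t)%:E =
    b01 x + \int[mu]_(t in I1y) (t `^ (x - 1) * bern t)%:E)%E.
Proof.
rewrite ge0_integral_splitRp //.
  by apply: measurable_funM; [exact: measurable_powRD | exact: measurable_bern].
by move=> t t0; rewrite mulr_ge0 ?powR_ge0 ?bern_ge0.
Qed.

Lemma integral_bose_fin x : 1 < x ->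
  (\int[mu]_(t in Rp) (t `^ (x - 1) * bose t)%:E = (Zr x * Gam x)%:E)%E.
Proof. by move=> x1; rewrite integral_bose // nneseries_Zr. Qed.

Lemma integral_bern_fin x : -1 < x < 0 ->
  (\int[mu]_(t in Rp) (t `^ (x - 1) * bern t)%:E =
   ((2 * pi) `^ (x - 1) * Zr (1 - x) * (pi / sin (pi * ((x + 1) / 2))))%:E)%E.
Proof.
move=> /andP[x1 x0]; rewrite integral_bern ?x1 // [RHS]EFinM; congr (_ * _)%E.
have x2 : 1 < 1 - x by lra.
apply: nneseries_EFin.
have -> : series (fun n : nat => (2 * pi * n.+1%:R) `^ (x - 1)) =
    (fun N => (2 * pi) `^ (x - 1) * series (fun n : nat => n.+1%:R `^ (- (1 - x))) N).
  apply/funext => N; rewrite /series /= mulr_sumr; apply: eq_bigr => k _.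
  by rewrite powRM ?mulr_ge0 ?pi_ge0 // opprB.
by apply: cvgMr; exact: Zr_cvg.
Qed.

Lemma b01_ge0 x : (0 <= b01 x)%E.
Proof.
apply: integral_ge0 => t /s01 /=; rewrite in_itv /= andbT => t0.
by rewrite lee_fin mulr_ge0 ?powR_ge0 ?bern_ge0.
Qed.

Lemma b1y_ge0 x : (0 <= b1y x)%E.
Proof.
apply: integral_ge0 => t /s1y /=; rewrite in_itv /= andbT => t0.
by rewrite lee_fin mulr_ge0 ?powR_ge0 ?bose_ge0.
Qed.

(** On []0, 1]] the integrand decreases with [x], so [x] may be lowered to a point of []-1, 0[],
    where [integral_bern_fin] gives a finite value. *)
Lemma b01_lty x : -1 < x -> (b01 x < +oo)%E.
Proof.
move=> x1; pose y := Num.min x (- 2^-1).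
have y1 : -1 < y < 0.
  by rewrite /y lt_min x1 gt_min /=; apply/andP; split; [|apply/orP; right]; lra.
apply: (@le_lt_trans _ _ (b01 y)); last first.
  apply: (@le_lt_trans _ _ (\int[mu]_(t in Rp) (t `^ (y - 1) * bern t)%:E)%E).
    rewrite bern_split leeDl //; apply: integral_ge0 => t /s1y /=.
    by rewrite in_itv /= andbT => t0; rewrite lee_fin mulr_ge0 ?powR_ge0 ?bern_ge0.
  by rewrite integral_bern_fin // ltry.
apply: ge0_le_integral => //.
- move=> t /s01 /=; rewrite in_itv /= andbT => t0.
  by rewrite lee_fin mulr_ge0 ?powR_ge0 ?bern_ge0.
- exact: measurable_powR_bern.
- exact: measurable_powR_bern.
- move=> t /=; rewrite in_itv /= => /andP[t0 t1].
  rewrite lee_fin ler_wpM2r ?bern_ge0 // !powRE // ler_expR ler_wnM2r //.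
    by rewrite -ln1 ler_ln ?posrE.
  by rewrite lerD2r /y ge_min lexx.
Qed.

(** On []1, +oo[] the integrand increases with [x], so [x] may be raised to at least 2, where
    [integral_bose_fin] applies. *)
Lemma b1y_lty x : (b1y x < +oo)%E.
Proof.
pose y := Num.max x 2.
have y1 : 1 < y by rewrite /y lt_max; apply/orP; right; lra.
apply: (@le_lt_trans _ _ (b1y y)); last first.
  apply: (@le_lt_trans _ _ (\int[mu]_(t in Rp) (t `^ (y - 1) * bose t)%:E)%E).
    rewrite bose_split leeDr //; apply: integral_ge0 => t /s01 /=.
    by rewrite in_itv /= andbT => t0; rewrite lee_fin mulr_ge0 ?powR_ge0 ?bose_ge0.
  by rewrite integral_bose_fin // ltry.
apply: ge0_le_integral => //.
- move=> t /s1y /=; rewrite in_itv /= andbT => t0.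
  by rewrite lee_fin mulr_ge0 ?powR_ge0 ?bose_ge0.
- exact: measurable_powR_bose.
- exact: measurable_powR_bose.
- move=> t /=; rewrite in_itv /= andbT => t1; have t0 : 0 < t by exact: lt_trans t1.
  rewrite lee_fin ler_wpM2r ?bose_ge0 // !powRE // ler_expR ler_wpM2r //.
    by rewrite ln_ge0 // ltW.
  by rewrite lerD2r /y le_max lexx.
Qed.

Lemma zkernel_lty x : -1 < x -> (\int[mu]_(t in Rp) (zkernel t * t `^ (x - 1))%:E < +oo)%E.
Proof. by move=> x1; rewrite zkernel_split lte_add_pinfty ?b01_lty ?b1y_lty. Qed.

Definition zmellin (x : R) : R := (\int[mu]_(t in Rp) (zkernel t * t `^ (x - 1)))%R.

Lemma zmellinE x : -1 < x -> (b01 x + b1y x)%E = (zmellin x)%:E.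
Proof.
move=> x1; rewrite -zkernel_split /zmellin /Rintegral fineK // ge0_fin_numE ?zkernel_lty //.
apply: integral_ge0 => t /=; rewrite in_itv /= andbT => t0.
by rewrite lee_fin mulr_ge0 ?powR_ge0 ?zkernel_ge0.
Qed.

(** For [1 < x] the subtracted part t^(x - 2) - t^(x - 1) / 2 is integrable on []0, 1]], and its
    integral is the correction. *)
Lemma zmellin_gt1 x : 1 < x -> zmellin x + (x - 1)^-1 - (2 * x)^-1 = Zr x * Gam x.
Proof.
move=> x1; have x2 : -1 < x by lra.
apply: EFin_inj; rewrite -integral_bose_fin // bose_split.
have q : (\int[mu]_(t in I01) (t `^ (x - 2) - 2^-1 * t `^ (x - 1))%:E =
    ((x - 1)^-1 - (2 * x)^-1)%:E)%E.
  apply: ge0_integral_sub => //.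
  - exact: measurable_powRD.
  - by apply: measurable_funM => //; exact: measurable_powRD.
  - by move=> t _; rewrite mulr_ge0 ?powR_ge0.
  - move=> t /=; rewrite in_itv /= => /andP[t0 t1].
    have -> : x - 1 = x - 2 + 1 by ring.
    rewrite powRD ?(gt_eqF t0) ?implybT // powRr1 ?(ltW t0) // mulrCA ger_pMr ?powR_gt0 //; lra.
  - by rewrite integral_powR_0_1; [congr (_^-1)%:E; ring | lra].
  - rewrite (@eq_integral _ _ _ mu _ (fun t => (2^-1)%:E * (t `^ (x - 1))%:E)%E) //.
    rewrite ge0_integralZl_EFin //; last 2 first.
    + by move=> t _; rewrite lee_fin powR_ge0.
    + by apply/measurable_EFinP; exact: measurable_powRD.
    rewrite integral_powR_0_1; last lra.
    by rewrite -EFinM subrK invfM.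
have -> : (\int[mu]_(t in I01) (t `^ (x - 1) * bose t)%:E =
    b01 x + ((x - 1)^-1 - (2 * x)^-1)%:E)%E.
  rewrite -q -ge0_integralD //.
  - apply: eq_integral => t; rewrite inE /= in_itv /= => /andP[t0 t1].
    rewrite -EFinD; congr EFin.
    have -> : t `^ (x - 2) = t `^ (x - 1) * t^-1.
      rewrite -powR_inv1 ?(ltW t0) // -powRD ?(gt_eqF t0) ?implybT //; congr (_ `^ _); ring.
    by rewrite /bern -/(bose t); ring.
  - move=> t /s01 /=; rewrite in_itv /= andbT => t0.
    by rewrite lee_fin mulr_ge0 ?powR_ge0 ?bern_ge0.
  - exact: measurable_powR_bern.
  - move=> t /=; rewrite in_itv /= => /andP[t0 t1]; rewrite lee_fin subr_ge0.
    have -> : x - 1 = x - 2 + 1 by ring.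
    rewrite powRD ?(gt_eqF t0) ?implybT // powRr1 ?(ltW t0) // mulrCA ger_pMr ?powR_gt0 //; lra.
  - apply/measurable_EFinP; apply: measurable_funB; first exact: measurable_powRD.
    by apply: measurable_funM => //; exact: measurable_powRD.
by rewrite -addeA [(_%:E + b1y x)%E]addeC addeA zmellinE // -EFinD addrA.
Qed.

(** For [x < 0] the same correction is minus the integral over []1, +oo[] of t^(x - 2) - t^(x - 1) /
    2, which turns [bose] into [bern] there as well. *)
Lemma zmellin_lt0 x : -1 < x < 0 -> zmellin x + (x - 1)^-1 - (2 * x)^-1 =
  (2 * pi) `^ (x - 1) * Zr (1 - x) * (pi / sin (pi * ((x + 1) / 2))).
Proof.
move=> x10; have /andP[x1 x0] := x10.
apply: EFin_inj; rewrite -integral_bern_fin // bern_split.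
move Ec : (\int[mu]_(t in I1y) _)%E => c.
have c0 : (0 <= c)%E.
  rewrite -Ec; apply: integral_ge0 => t /s1y /=; rewrite in_itv /= andbT => t0.
  by rewrite lee_fin mulr_ge0 ?powR_ge0 ?bern_ge0.
have I1yE p : p < -1 -> (\int[mu]_(t in I1y) (t `^ p)%:E = (- (p + 1)^-1)%:E)%E.
  move=> p1; rewrite -integral_powR_1_y // integral_itv_obnd_cbnd //.
  by apply/measurable_EFinP; exact: measurable_powRD.
(* Integrated form of [bern t + 1 / t = bose t + 1 / 2], arranged so that all four integrands are
   nonnegative; both numbers are positive as [x < 0]. *)
have e : (c + (- (x - 1)^-1)%:E = b1y x + (- (2 * x)^-1)%:E)%E.
  have -> : (- (x - 1)^-1)%:E = (\int[mu]_(t in I1y) (t `^ (x - 2))%:E)%E.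
    by rewrite I1yE; [congr (- _^-1)%:E; ring | lra].
  have -> : (- (2 * x)^-1)%:E = (\int[mu]_(t in I1y) (2^-1 * t `^ (x - 1))%:E)%E.
    rewrite (@eq_integral _ _ _ mu _ (fun t => (2^-1)%:E * (t `^ (x - 1))%:E)%E) //.
    rewrite ge0_integralZl_EFin //; last 2 first.
    + by move=> t _; rewrite lee_fin powR_ge0.
    + by apply/measurable_EFinP; exact: measurable_powRD.
    rewrite I1yE; last lra.
    by rewrite -EFinM subrK mulrN invfM.
  have mp p : measurable_fun I1y (fun t : R => (t `^ p)%:E).
    by apply/measurable_EFinP; exact: measurable_powRD.
  rewrite -Ec -!ge0_integralD //.
  - apply: eq_integral => t; rewrite inE => /s1y /=; rewrite in_itv /= andbT => t0.
    rewrite -!EFinD; congr EFin.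
    have -> : t `^ (x - 2) = t `^ (x - 1) * t^-1.
      rewrite -powR_inv1 ?(ltW t0) // -powRD ?(gt_eqF t0) ?implybT //; congr (_ `^ _); ring.
    by rewrite /bern -/(bose t); ring.
  - move=> t /s1y /=; rewrite in_itv /= andbT => t0.
    by rewrite lee_fin mulr_ge0 ?powR_ge0 ?bose_ge0.
  - exact: measurable_powR_bose.
  - by move=> t _; rewrite lee_fin mulr_ge0 ?powR_ge0.
  - by apply/measurable_EFinP; apply: measurable_funM => //; exact: measurable_powRD.
  - move=> t /s1y /=; rewrite in_itv /= andbT => t0.
    by rewrite lee_fin mulr_ge0 ?powR_ge0 ?bern_ge0.
  - exact: measurable_powR_bern.
  - by move=> t _; rewrite lee_fin powR_ge0.
  - exact: mp.
have [B hB] : exists B, b1y x = B%:E.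
  by exists (fine (b1y x)); rewrite fineK // ge0_fin_numE ?b1y_lty ?b1y_ge0.
have [B' hB'] : exists B, b01 x = B%:E.
  by exists (fine (b01 x)); rewrite fineK // ge0_fin_numE ?b01_lty ?b01_ge0.
have <- : B' + B = zmellin x by apply: EFin_inj; rewrite EFinD -hB -hB' zmellinE.
rewrite hB'.
(* The finiteness of [c] is read off from [e], whose right-hand side is finite. *)
move: e; rewrite hB; clear Ec; case: c c0 => [c _| _|]; last 2 first.
- by rewrite addye.
- by rewrite leeNy_eq.
move=> h; have e := EFin_inj h; rewrite -EFinD.
by congr EFin; lra.
Qed.

End ZetaMellin.

(** * Continuation of zeta and its functional equation *)

Section ZetaContinuation.
Variable R : realType.
Local Notation C := (cplx R).
Implicit Types s z : C.
Local Notation A := (mellin (@zkernel R)).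

Lemma zmellin_analytic z : -1 < cRe z -> analytic_at A z.
Proof.
apply: mellin_analytic; [exact: measurable_zkernel|exact: zkernel_ge0|exact: zkernel_lty].
Qed.

Lemma analytic_1sub f z : analytic_at f (1 - z) -> analytic_at (fun w : C => f (1 - w)) z.
Proof.
move=> h; apply: (@analytic_ext _ (fun w => f (-1 * w + 1))).
  by move=> w; rewrite mulN1r addrC.
by apply: analytic_affine; rewrite mulN1r addrC.
Qed.

Lemma analytic_scale f c z : analytic_at f (c * z) -> analytic_at (fun w : C => f (c * w)) z.
Proof.
move=> h; apply: (@analytic_ext _ (fun w => f (c * w + 0))); first by move=> w; rewrite addr0.
by apply: analytic_affine; rewrite addr0.
Qed.

(** The quotient sin (pi z) / z with its singularity at 0 removed; its missing factor [z] cancels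
    the pole of [1 / (2 s)] in [zstrip]. *)
Lemma csin_factor : exists sc : C -> C, (forall z, analytic_at sc z) /\
  forall z, z * sc z = csin (ofReal pi * z).
Proof.
have h z : analytic_at (fun w : C => csin (ofReal pi * w)) z.
  by apply: analytic_scale; exact: analytic_csin.
have s0 : csin (ofReal pi * 0) = 0 :> C by rewrite mulr0 -ofReal0 csin_ofReal sin0.
have [g [ag]] := analytic_factor (h 0).
rewrite s0 => /nearC[d d0 hd].
pose sc z := if z == 0 then g 0 else csin (ofReal pi * z) * (z - 0)^-1.
exists sc; split=> z; last first.
  rewrite /sc; case: eqVneq => [->|z0]; first by rewrite mul0r s0.
  by rewrite subr0 mulrC mulfVK.
have [->|z0] := eqVneq z 0.
  apply: (analytic_near _ ag); apply/nearC; exists d => // w /hd e.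
  rewrite /sc; case: eqVneq => [->//|w0].
  by rewrite e add0r !subr0 mulrC mulKf.
apply: (@analytic_near _ (fun w => csin (ofReal pi * w) * (w - 0)^-1)).
  apply/nearC; exists (cmod z); first by rewrite cmod_gt0.
  move=> w wz; rewrite /sc; case: eqVneq => // w0.
  by move: wz; rewrite w0 sub0r cmodN ltxx.
by apply: analytic_mul; [exact: h|exact: analytic_inv].
Qed.

Lemma near_cRe_gt (c : R) z : c < cRe z -> \forall w \near z, c < cRe w.
Proof.
move=> cz; apply/nearC; exists (cRe z - c); first by rewrite subr_gt0.
move=> w /(le_lt_trans (ler_cRe _)); rewrite cReB ltr_distl => /andP[+ _]; lra.
Qed.

Lemma near_cRe_lt (c : R) z : cRe z < c -> \forall w \near z, cRe w < c.
Proof.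
move=> cz; apply/nearC; exists (c - cRe z); first by rewrite subr_gt0.
move=> w /(le_lt_trans (ler_cRe _)); rewrite cReB ltr_distl => /andP[_ +]; lra.
Qed.

(** [F] is the Dirichlet series while the continuation is being built, and [czeta] itself in the
    final equation. *)
Definition czeta_rhs (F : C -> C) s : C :=
  2 * cpow (2 * pi) (s - 1) * csin (ofReal (pi / 2) * s) * cgamma (1 - s) * F (1 - s).

Lemma czeta_rhs_analytic F s : ~ nonpos_integers (1 - s) -> analytic_at F (1 - s) ->
  analytic_at (czeta_rhs F) s.
Proof.
move=> ns aF; apply: analytic_mul; last exact: analytic_1sub.
apply: analytic_mul; last by apply: analytic_1sub; exact: cgamma_analytic.
apply: analytic_mul; last by apply: analytic_scale; exact: analytic_csin.
apply: analytic_mul; first exact: analytic_cst.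
by apply: analytic_addc; exact: analytic_cpow.
Qed.

Lemma cRe_gt0_nonpos z : 0 < cRe z -> ~ nonpos_integers z.
Proof.
by move=> z0 [n zn]; move: z0; rewrite zn cReN -ofReal_nat /= oppr_gt0 ltNge ler0n.
Qed.

Lemma czeta_rhs_series_analytic s : cRe s < 0 -> analytic_at (czeta_rhs (@czeta_series R)) s.
Proof.
move=> s0; apply: czeta_rhs_analytic.
  by apply: cRe_gt0_nonpos; rewrite cReB /=; lra.
by apply: czeta_series_analytic; rewrite cReB /=; lra.
Qed.

Section Strip.
Variable sc : C -> C.
Hypothesis sc_analytic : forall z, analytic_at sc z.
Hypothesis scE : forall z, z * sc z = csin (ofReal pi * z).

(** The Mellin expression [A s + (s - 1)^-1 - (2 * s)^-1] for Gamma zeta, multiplied by sin (pi s)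
    Gamma (1 - s) / pi, which is 1 / Gamma (s). A factor [s] is moved from the sine to the bracket
    so that nothing is singular at 0. *)
Definition zstrip s : C :=
  (s * A s + s * (s - 1)^-1 - 2^-1) * sc s * cgamma (1 - s) * (ofReal pi)^-1.

Lemma zstrip_analytic s : -1 < cRe s < 2 -> s != 1 -> analytic_at zstrip s.
Proof.
move=> /andP[s1 s2] s3; apply: analytic_mul; last exact: analytic_cst.
apply: analytic_mul; last first.
  (* The poles of Gamma (1 - s) are the positive integers, and [cRe s < 2] leaves only [s = 1]. *)
  apply: analytic_1sub; apply: cgamma_analytic => -[[|n]].
    by rewrite oppr0 => /eqP; rewrite subr_eq0 eq_sym (negPf s3).
  move/(congr1 (@cRe R)); rewrite cReB cReN -ofReal_nat /= => h.
  have : 1 <= n.+1%:R :> R by rewrite ler1n.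
  lra.
apply: analytic_mul; last exact: sc_analytic.
apply: analytic_sub; last exact: analytic_cst.
apply: analytic_add.
  by apply: analytic_mul; [exact: analytic_id | exact: zmellin_analytic].
by apply: analytic_mul; [exact: analytic_id | exact: analytic_inv].
Qed.

Lemma zstrip_ofReal (x : R) : x != 0 -> x != 1 -> zstrip (ofReal x) =
  ofReal ((zmellin x + (x - 1)^-1 - (2 * x)^-1) * sin (pi * x) / pi) * cgamma (1 - ofReal x).
Proof.
move=> x0 x1; pose s : C := ofReal x; pose V := zmellin x + (x - 1)^-1 - (2 * x)^-1.
have e : s * A s + s * (s - 1)^-1 - 2^-1 = ofReal V * s.
  rewrite /s mellin_ofReal -/(zmellin x) -ofReal1 -ofRealB -ofRealV -!ofRealM.
  rewrite -(ofReal_nat R 2) -ofRealV -ofRealD -ofRealB; congr ofReal.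
  by rewrite /V; field; rewrite x0 subr_eq0 x1.
rewrite /zstrip -/s e -(mulrA (ofReal V)) scE /s -ofRealM csin_ofReal.
by rewrite ofRealM ofRealV ofRealM mulrAC.
Qed.

Lemma zstrip_series s : 1 < cRe s < 2 -> zstrip s = czeta_series s.
Proof.
have i : is_interval [set x : R | 1 < x < 2].
  move=> x y /= /andP[x1 _] /andP[_ y2] w /andP[xw wy].
  by rewrite (lt_le_trans x1 xw) (le_lt_trans wy y2).
have d : 0 < 2^-1 :> R by [].
have i3 : [set x : R | 1 < x < 2] (3 / 2) by rewrite /=; lra.
apply: (strip_ident i i3 d).
  move=> z /= /andP[z1 z2]; split.
    apply: zstrip_analytic; first by rewrite z2 andbT; lra.
    by apply/eqP => e; move: z1; rewrite e /= ltxx.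
  exact: czeta_series_analytic.
move=> x; rewrite ltr_distl => /andP[x1 x2].
have {}x1 : 1 < x by lra.
have {}x2 : x < 2 by lra.
have ni : ~ integers (ofReal x : C).
  by apply: (@real_not_integer _ 1); rewrite x1 /=.
have x0 : 0 < x by lra.
rewrite zstrip_ofReal ?gt_eqF // zmellin_gt1 // czeta_series_ofReal //.
have := cgamma_reflection ni; rewrite cgamma_ofReal // -(ofRealM pi) csin_ofReal => h.
have p0 : ofReal pi != 0 :> C by rewrite ofReal_eq0 gt_eqF ?pi_gt0.
apply: (mulIf p0); rewrite -[in RHS]h !ofRealM ofRealV.
by field.
Qed.

Lemma zstrip_rhs s : -1 < cRe s < 0 -> zstrip s = czeta_rhs (@czeta_series R) s.
Proof.
have i : is_interval [set x : R | -1 < x < 0].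
  move=> x y /= /andP[x1 _] /andP[_ y2] w /andP[xw wy].
  by rewrite (lt_le_trans x1 xw) (le_lt_trans wy y2).
have d : 0 < 2^-1 :> R by [].
have i3 : [set x : R | -1 < x < 0] (- 2^-1) by rewrite /=; lra.
apply: (strip_ident i i3 d).
  move=> z /= /andP[z1 z2]; split.
    apply: zstrip_analytic; first by rewrite z1 /=; lra.
    by apply/eqP => e; move: z2; rewrite e /=; lra.
  exact: czeta_rhs_series_analytic.
move=> x; rewrite ltr_distl => /andP[x1 x2].
have {}x1 : -1 < x by lra.
have {}x2 : x < 0 by lra.
have y1 : 1 < 1 - x by lra.
rewrite zstrip_ofReal ?lt_eqF //; last lra.
rewrite zmellin_lt0 ?x1 // /czeta_rhs -ofReal1 -!ofRealB czeta_series_ofReal //.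
have pp : 0 < 2 * pi :> R by rewrite mulr_gt0 ?pi_gt0.
rewrite cpow_ofReal // -(ofRealM (pi / 2)) csin_ofReal -(ofReal_nat R 2).
rewrite [RHS]mulrAC -!ofRealM; congr (ofReal _ * _).
have c0 : 0 < cos (pi / 2 * x).
  by apply: cos_gt0_pihalf; have := pi_gt0 R; nra.
(* This cosine, the denominator left by the Mellin integral of [bern], cancels against sin (pi x) =
   2 sin (pi x / 2) cos (pi x / 2); the sine of the functional equation remains. *)
have -> : sin (pi * ((x + 1) / 2)) = cos (pi / 2 * x).
  by rewrite -sinDpihalf; congr sin; ring.
have -> : sin (pi * x) = 2 * (sin (pi / 2 * x) * cos (pi / 2 * x)).
  have -> : pi * x = (pi / 2 * x) *+ 2 by rewrite mulr2n; field.
  by rewrite sin_mulr2n [in RHS]mulrC mulr_natr mulrC.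
move: (cos _) c0 => c c0; move: (@pi R) (pi_gt0 R) => p p0.
by field; rewrite (gt_eqF c0) (gt_eqF p0).
Qed.

(** The formula of the strip holds on [-1 < cRe s < 2] and overlaps each of the other two pieces in
    an open strip, whence analyticity on the lines of real part 0 and 1. *)
Definition zglue s : C := if 1 < cRe s then czeta_series s
  else if cRe s < 0 then czeta_rhs (@czeta_series R) s else zstrip s.

Lemma zglue_strip s : -1 < cRe s < 2 -> zglue s = zstrip s.
Proof.
move=> /andP[s1 s2]; rewrite /zglue; case: ifPn => h1.
  by rewrite zstrip_series // h1.
by case: ifPn => h2 //; rewrite zstrip_rhs // s1.
Qed.

Lemma zglue_analytic s : s != 1 -> analytic_at zglue s.
Proof.
move=> s1; have [h1|h1] := ltP 1 (cRe s).
  apply: (analytic_near _ (czeta_series_analytic h1)).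
  have /nearC[d d0 hd] := near_cRe_gt h1; apply/nearC; exists d => // w /hd.
  by rewrite /zglue => ->.
have [h0|h0] := ltP (cRe s) 0.
  apply: (analytic_near _ (czeta_rhs_series_analytic h0)).
  have /nearC[d d0 hd] := near_cRe_lt h0; apply/nearC; exists d => // w /hd w0.
  by rewrite /zglue w0 ltNge (ltW (lt_trans w0 ltr01)).
have s2 : -1 < cRe s < 2 by lra.
apply: (analytic_near _ (zstrip_analytic s2 s1)).
have /andP[a b] := s2.
have /nearC[d d0 hd] := near_cRe_gt a; have /nearC[e e0 he] := near_cRe_lt b.
apply/nearC; exists (Num.min d e); first by rewrite lt_min d0.
move=> w; rewrite lt_min => /andP[/hd wd /he we].
by rewrite zglue_strip // wd.
Qed.

End Strip.

(** The choice made by [xget] is constrained only by analyticity and by the series. The third item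
    is a consequence of uniqueness, by comparison with [zglue] from the point 2. *)
Lemma czeta_spec : [/\ analytic_on (~` [set 1]) (@czeta R),
  forall s, 1 < cRe s -> czeta s = czeta_series s &
  forall s, cRe s < 0 -> czeta s = czeta_rhs (@czeta_series R) s].
Proof.
have [sc [a_sc scE]] := csin_factor.
have Zan s : s != 1 -> analytic_at (zglue sc) s by exact: zglue_analytic.
have Zser s : 1 < cRe s -> zglue sc s = czeta_series s by rewrite /zglue => ->.
have [Can Cser] : analytic_on (~` [set 1]) (@czeta R) /\
    forall s, 1 < cRe s -> czeta s = czeta_series s.
  rewrite /czeta /analytic_continuation; set S := (X in xget _ X).
  suff Sf : S (zglue sc) by exact: (xgetPex _ (ex_intro _ _ Sf)).
  by split=> [s /eqP/Zan|s /Zser].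
split=> // s s0.
have s1 : s != 1 by apply/eqP => e; move: s0; rewrite e /=; lra.
have -> : czeta s = zglue sc s.
  apply: nearP_eq.
  apply: (@analytic_nonreal_ident _ (~` [set 1]) _ _ 2).
  - by move=> w w0 e; move: w0; rewrite e eqxx.
  - by case=> /eqP; rewrite -subr_eq0 addrK oner_eq0.
  - exact: Can.
  - by move=> w /eqP; exact: Zan.
  - have h : 1 < cRe (ofReal 2 : C) by rewrite /=; lra.
    have /nearC[d d0 hd] := near_cRe_gt h; apply/nearC; exists d => // w /hd w1.
    by rewrite Cser // Zser.
  - exact/eqP.
by rewrite /zglue s0 ltNge (ltW (lt_trans s0 ltr01)).
Qed.

Lemma czeta_analytic s : s != 1 -> analytic_at (@czeta R) s.
Proof. by have [h _ _] := czeta_spec => /eqP; exact: h. Qed.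

(** The domain [D] leaves out 0, where zeta (1 - s) is singular, and the positive integers, the
    poles of Gamma (1 - s). For [cRe s < 0] the values of [czeta] at [1 - s] are those of the
    series, and the identity spreads from the point -1. *)
Lemma czeta_functional s : s != 0 -> ~ nonpos_integers (1 - s) ->
  czeta s = czeta_rhs (@czeta R) s.
Proof.
have [_ hs hr] := czeta_spec => s0 ns.
pose D : set C := [set s | s != 0 /\ ~ nonpos_integers (1 - s)].
apply: nearP_eq; apply: (@analytic_nonreal_ident _ D _ _ (- 1)); last by split.
- move=> w w0; split; first by apply: contra_neq w0 => ->.
  by case=> n /(congr1 (@cIm R)); rewrite cImB cImN -ofReal_nat /= => h; move: w0; lra.
- split; first by rewrite ofReal_eq0 oppr_eq0 oner_eq0.
  by apply: cRe_gt0_nonpos; rewrite cReB /=; lra.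
- move=> w [w0 nw]; apply: czeta_analytic; apply/eqP => w1.
  by apply: nw; exists 0%N; rewrite w1 subrr oppr0.
- move=> w [w0 nw]; apply: czeta_rhs_analytic => //; apply: czeta_analytic.
  by apply: contra_neq w0 => e; rewrite -[w](subKr 1) e subrr.
- have h : cRe (ofReal (-1) : C) < 0 by rewrite /=; lra.
  have /nearC[d d0 hd] := near_cRe_lt h; apply/nearC; exists d => // w /hd w0.
  by rewrite hr // /czeta_rhs hs // cReB /=; lra.
Qed.

End ZetaContinuation.

(** * Passage to bicomplex numbers through the idempotent components *)

Section Bicomplex.
Variable R : realType.
Local Notation C := (cplx R).
Local Notation B := (bicomplex R).
Implicit Types w : B.

Lemma biP w w' : P1 w = P1 w' -> P2 w = P2 w' -> w = w'.
Proof. by move=> e1 e2; rewrite -[w]bicomb_proj -[w']bicomb_proj e1 e2. Qed.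

Lemma P1D w w' : P1 (w + w') = P1 w + P1 w'.
Proof. by case: w w' => [a b c d] [? ? ? ?]; congr Complex => /=; ring. Qed.

Lemma P2D w w' : P2 (w + w') = P2 w + P2 w'.
Proof. by case: w w' => [a b c d] [? ? ? ?]; congr Complex => /=; ring. Qed.

Lemma P1N w : P1 (- w) = - P1 w.
Proof. by case: w => [a b c d]; congr Complex => /=; ring. Qed.

Lemma P2N w : P2 (- w) = - P2 w.
Proof. by case: w => [a b c d]; congr Complex => /=; ring. Qed.

Lemma P1Z (x : R) w : P1 (x *: w) = ofReal x * P1 w.
Proof. by case: w => [a b c d]; congr Complex => /=; ring. Qed.

Lemma P2Z (x : R) w : P2 (x *: w) = ofReal x * P2 w.
Proof. by case: w => [a b c d]; congr Complex => /=; ring. Qed.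

Lemma bicombK1 (z1 z2 : C) : P1 (bicomb z1 z2) = z1.
Proof. by case: (bicombK z1 z2). Qed.

Lemma bicombK2 (z1 z2 : C) : P2 (bicomb z1 z2) = z2.
Proof. by case: (bicombK z1 z2). Qed.

Lemma unit_bicomplexE w : (w \is a GRing.unit) = (P1 w != 0) && (P2 w != 0).
Proof. by []. Qed.

Lemma one_plus_unitsE w : one_plus_units w <-> P1 w != 1 /\ P2 w != 1.
Proof.
rewrite /one_plus_units /= unit_bicomplexE P1D P2D P1N P2N P1_1 P2_1 !subr_eq0.
by split=> [/andP|[-> ->]].
Qed.

Lemma bgamma_add1 w : Omega_minus w -> bgamma (1 + w) = w * bgamma w.
Proof.
move=> [n1 n2]; apply: biP.
- by rewrite P1M !bicombK1 P1D P1_1 cgamma_add1.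
- by rewrite P2M !bicombK2 P2D P2_1 cgamma_add1.
Qed.

Lemma bgamma_reflection w : Omega w ->
  bgamma (1 - w) * bgamma w = pi%:A / bsin (pi *: w).
Proof.
move=> [n1 n2].
have p0 : ofReal pi != 0 :> C by rewrite ofReal_eq0 gt_eqF ?pi_gt0.
(* The sine cannot vanish, being a factor of a product equal to pi; the bicomplex sine is therefore
   a unit and the division is genuine. *)
have s0 (z : C) : ~ integers z -> csin (ofReal pi * z) != 0.
  move=> /cgamma_reflection e; apply/eqP => s0; move: p0.
  by rewrite -e s0 mulr0 eqxx.
have u : bsin (pi *: w) \is a GRing.unit.
  rewrite unit_bicomplexE /bsin bicombK1 bicombK2 P1Z P2Z.
  by apply/andP; split; exact: s0.
apply: (mulIr u); rewrite divrK //; apply: biP.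
- by rewrite !P1M !bicombK1 !P1Z P1D P1N P1_1 mulr1 cgamma_reflection.
- by rewrite !P2M !bicombK2 !P2Z P2D P2N P2_1 mulr1 cgamma_reflection.
Qed.

Lemma P1_zeta_rhs w : P1 (zeta_rhs w) = czeta_rhs (@czeta R) (P1 w).
Proof.
rewrite /zeta_rhs !P1M !bicombK1 !P1Z !P1D !P1N !P1_1 /czeta_rhs /cpow.
by rewrite [ofReal _ * (_ - 1)]mulrC.
Qed.

Lemma P2_zeta_rhs w : P2 (zeta_rhs w) = czeta_rhs (@czeta R) (P2 w).
Proof.
rewrite /zeta_rhs !P2M !bicombK2 !P2Z !P2D !P2N !P2_1 /czeta_rhs /cpow.
by rewrite [ofReal _ * (_ - 1)]mulrC.
Qed.

Lemma bzeta_functional w : zeta_rhs_dom w -> bzeta w = zeta_rhs w.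
Proof.
move=> [[n1 n2] /one_plus_unitsE].
rewrite !P1D !P2D !P1N !P2N P1_1 P2_1 in n1 n2 *.
have ne (z : C) : 1 - z != 1 -> z != 0.
  by apply: contra_neq => ->; rewrite subr0.
move=> [/ne h1 /ne h2]; apply: biP.
- by rewrite bicombK1 P1_zeta_rhs czeta_functional.
- by rewrite bicombK2 P2_zeta_rhs czeta_functional.
Qed.

(** The topology is the initial one for the coordinates, so a neighbourhood contains the preimage of
    an open set of tuples. *)
Lemma cvg_bicomplexP (T : Type) (F : set_system T) {FF : Filter F} (g : T -> B) w :
  [/\ bre (g x) @[x --> F] --> bre w, bim_i (g x) @[x --> F] --> bim_i w,
      bim_j (g x) @[x --> F] --> bim_j w & bim_k (g x) @[x --> F] --> bim_k w] ->
  g x @[x --> F] --> w.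
Proof.
move=> [c1 c2 c3 c4].
have cv : tuple_of_bicomplex (g x) @[x --> F] --> tuple_of_bicomplex w.
  exact: (cvg_pair (cvg_pair (cvg_pair c1 c2) c3) c4).
move=> A [_ [[U Uop <-] Us sUA]].
have hU : nbhs (tuple_of_bicomplex w) U by apply: open_nbhs_nbhs.
have hF : F (fun x => U (tuple_of_bicomplex (g x))) := cv _ hU.
change (F (fun x => A (g x))); apply: filterS hF => x; exact: sUA.
Qed.

Lemma tuple_of_bicomplex_continuous w : tuple_of_bicomplex x @[x --> w] --> tuple_of_bicomplex w.
Proof. exact: (@initial_continuous _ _ (@tuple_of_bicomplex R) w). Qed.

Lemma bicomplex_proj_continuous w :
  [/\ bre x @[x --> w] --> bre w, bim_i x @[x --> w] --> bim_i w,
      bim_j x @[x --> w] --> bim_j w & bim_k x @[x --> w] --> bim_k w].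
Proof.
have h := @tuple_of_bicomplex_continuous w.
have h1 : (tuple_of_bicomplex x).1 @[x --> w] --> (tuple_of_bicomplex w).1.
  exact: (cvg_comp _ _ h cvg_fst).
have h11 : (tuple_of_bicomplex x).1.1 @[x --> w] --> (tuple_of_bicomplex w).1.1.
  exact: (cvg_comp _ _ h1 cvg_fst).
split.
- exact: (cvg_comp _ _ h11 cvg_fst).
- exact: (cvg_comp _ _ h11 cvg_snd).
- exact: (cvg_comp _ _ h1 cvg_snd).
- exact: (cvg_comp _ _ h cvg_snd).
Qed.

Lemma P1_continuous w : P1 x @[x --> w] --> P1 w.
Proof.
have [c1 c2 c3 c4] := bicomplex_proj_continuous w.
exact: (cvgC_ReIm (cvgD c1 c3 : cRe (P1 x) @[x --> w] --> cRe (P1 w)) (cvgB c2 c4)).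
Qed.

Lemma P2_continuous w : P2 x @[x --> w] --> P2 w.
Proof.
have [c1 c2 c3 c4] := bicomplex_proj_continuous w.
exact: (cvgC_ReIm (cvgB c1 c3 : cRe (P2 x) @[x --> w] --> cRe (P2 w)) (cvgD c2 c4)).
Qed.

Lemma bicomb_cvg (T : Type) (F : set_system T) {FF : Filter F} (f g : T -> C) (a b : C) :
  f x @[x --> F] --> a -> g x @[x --> F] --> b ->
  bicomb (f x) (g x) @[x --> F] --> bicomb a b.
Proof.
move=> fa gb.
have f1 : cRe (f x) @[x --> F] --> cRe a by exact: cvgC_cRe.
have f2 : cIm (f x) @[x --> F] --> cIm a by exact: cvgC_cIm.
have g1 : cRe (g x) @[x --> F] --> cRe b by exact: cvgC_cRe.
have g2 : cIm (g x) @[x --> F] --> cIm b by exact: cvgC_cIm.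
under eq_fun do rewrite bicombE.
rewrite bicombE; apply: cvg_bicomplexP; split; apply: cvgMr.
- exact: cvgD.
- exact: cvgD.
- exact: cvgB.
- exact: cvgB.
Qed.

Lemma bzeta_continuous w : one_plus_units w -> bzeta x @[x --> w] --> bzeta w.
Proof.
move=> /one_plus_unitsE[w1 w2].
have c1 : czeta (P1 x) @[x --> w] --> czeta (P1 w).
  exact: (cvg_comp _ _ (@P1_continuous w) (analytic_continuous (czeta_analytic w1))).
have c2 : czeta (P2 x) @[x --> w] --> czeta (P2 w).
  exact: (cvg_comp _ _ (@P2_continuous w) (analytic_continuous (czeta_analytic w2))).
exact: bicomb_cvg c1 c2.
Qed.

End Bicomplex.

Theorem theorem1p1 (R : realType) :
  [/\ (forall w : bicomplex R, Omega_minus w ->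
         bgamma (1 + w) = w * bgamma w),
      (forall w : bicomplex R, Omega w ->
         bgamma (1 - w) * bgamma w = pi%:A / bsin (pi *: w))
    & (forall w : bicomplex R, one_plus_units w ->
         (zeta_rhs_dom w -> bzeta w = zeta_rhs w) /\
         zeta_rhs x @[x --> within (@zeta_rhs_dom R) (nbhs w)] --> bzeta w)].
Proof.
split; [exact: bgamma_add1 | exact: bgamma_reflection |] => w uw.
split; first exact: bzeta_functional.
(* Along [zeta_rhs_dom] the right-hand side coincides with [bzeta], so its limit is that of a
   function continuous at [w]. *)
move=> A hA.
have h : nbhs w (fun x => A (bzeta x)) := bzeta_continuous uw hA.
change (nbhs w (fun x => zeta_rhs_dom x -> A (zeta_rhs x))).
by apply: filterS h => x Ax /bzeta_functional <-.
Qed.
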